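(* Let $M$ be a quasi-Fuchsian manifold and $\Sigma$ a hyperbolic surface (of constant curvature $-1$), both with fundamental group identified with $\Gamma$. Suppose that $M$ and $\Sigma$ have proportional length spectrum, i.e. there exists $k\in\mathbb{R}^+$ such that $\ell_M(\gamma)=k\,\ell_\Sigma(\gamma)$ for all $\gamma\in\Gamma$. Then $M$ is Fuchsian, $k=1$, and $\Sigma$ is isometric to the totally geodesic surface in $M$.
   Context: $S$ is a compact (closed) surface of genus at least $2$ and $\Gamma=\pi_1(S)$. A quasi-Fuchsian representation is a discrete and faithful representation $\rho_{QF}:\Gamma\to\mathrm{PSL}_2(\mathbb{C})\subset\mathrm{Isom}(\mathbb{H}^3)$ whose limit set in $\partial\mathbb{H}^3$ is a Jordan curve; a quasi-Fuchsian manifold is $M=\mathbb{H}^3/\rho_{QF}(\Gamma)$. $M$ is Fuchsian if $\rho_{QF}(\Gamma)$ is conjugate to a subgroup of $\mathrm{PSL}_2(\mathbb{R})$; then $\rho_{QF}(\Gamma)$ preserves a totally geodesic copy of $\mathbb{H}^2$ in $\mathbb{H}^3$, whose quotient is the totally geodesic surface in $M$. The hyperbolic surface is $\Sigma=\mathbb{H}^2/\rho_0(\Gamma)$ with $\rho_0:\Gamma\to\mathrm{PSL}_2(\mathbb{R})$ discrete and faithful. For $\gamma\in\Gamma$, $\ell_M(\gamma)$ and $\ell_\Sigma(\gamma)$ denote the translation lengths of $\rho_{QF}(\gamma)$ on $\mathbb{H}^3$ and of $\rho_0(\gamma)$ on $\mathbb{H}^2$, respectively. $\mathbb{R}^+$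 denotes positive reals. *)

(* Defs.v *)
From HB Require Import structures.
From Stdlib Require Import Relation_Operators.
From mathcomp Require Import all_boot all_order all_algebra.
From mathcomp Require Import all_classical all_reals all_analysis.
From mathcomp Require Import complex.

Set Implicit Arguments.
Unset Strict Implicit.
Unset Printing Implicit Defensive.

Import Order.TTheory GRing.Theory Num.Theory.
Import numFieldNormedType.Exports.

Local Open Scope classical_set_scope.
Local Open Scope ring_scope.
Local Open Scope complex_scope.
Local Open Scope quotient_scope.

Section Surface.
Variable R : realType.

(* With [n = 4 * g], the sides of the [n]-gon are the arcs
   [circle_point n @` `[m, m + 1]] of the unit circle. *)
Definition circle_point (n : nat) (t : R) : R * R :=
  (cos (2 * pi * t / n%:R), sin (2 * pi * t / n%:R)).

(* Side pairing read off the word  a_0 b_0 a_0^-1 b_0^-1 a_1 b_1 ... :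
   side 4i is a_i, side 4i+1 is b_i, side 4i+2 is a_i backwards and
   side 4i+3 is b_i backwards. *)
Definition side_pairing (g : nat) (p q : R * R) : Prop :=
  exists (i : nat) (s : R), [/\ (i < g)%N, 0 <= s <= 1 &
    (p = circle_point (4 * g) ((4 * i)%N%:R + s) /\
     q = circle_point (4 * g) ((4 * i + 3)%N%:R - s)) \/
    (p = circle_point (4 * g) ((4 * i + 1)%N%:R + s) /\
     q = circle_point (4 * g) ((4 * i + 4)%N%:R - s))].

Definition unit_disk : set (R * R) := [set p | p.1 ^+ 2 + p.2 ^+ 2 <= 1].

(* [S] is the quotient of the closed [4 * g]-gon by the side pairing. The disk
   is compact and [S] is Hausdorff, so a continuous surjection whose fibres are
   the classes is automatically a quotient map. *)
Definition closed_orientable_surface (g : nat) (S : topologicalType) : Prop :=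
  hausdorff_space S /\
  exists q : R * R -> S,
    [/\ {within unit_disk, continuous q},
        q @` unit_disk = [set: S] &
        forall x y, unit_disk x -> unit_disk y ->
          (q x = q y <-> clos_refl_sym_trans _ (side_pairing g) x y)].

Definition is_loop (S : topologicalType) (x0 : S) (f : R -> S) : Prop :=
  [/\ {within `[0, 1], continuous f}, f 0 = x0 & f 1 = x0].

Definition concat (S : Type) (f1 f2 : R -> S) : R -> S :=
  fun t => if t <= 2^-1 then f1 (2 * t) else f2 (2 * t - 1).

Definition loop_homotopic (S : topologicalType) (x0 : S) (f1 f2 : R -> S) :=
  exists H : R * R -> S,
    [/\ {within `[0, 1] `*` `[0, 1], continuous H},
        forall t, 0 <= t <= 1 -> H (0, t) = f1 t,
        forall t, 0 <= t <= 1 -> H (1, t) = f2 t,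
        forall s, 0 <= s <= 1 -> H (s, 0) = x0 &
        forall s, 0 <= s <= 1 -> H (s, 1) = x0].

(* [cls] sends a loop to its homotopy class; it identifies the group of
   homotopy classes of loops at [x0] with [Gamma]. Its values on functions that
   are not loops are irrelevant. *)
Definition is_fundamental_group (S : topologicalType) (x0 : S)
    (Gamma : groupType) : Prop :=
  exists cls : (R -> S) -> Gamma,
    [/\ forall gamma, exists2 f, is_loop x0 f & cls f = gamma,
        forall f1 f2, is_loop x0 f1 -> is_loop x0 f2 ->
          (cls f1 = cls f2 <-> loop_homotopic x0 f1 f2) &
        forall f1 f2, is_loop x0 f1 -> is_loop x0 f2 ->
          cls (concat f1 f2) = (cls f1 * cls f2)%g].

End Surface.

Record SL2 (F : fieldType) := MkSL2 {
  SL2_mx :> 'M[F]_2;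
  _ : \det SL2_mx == 1 }.

Section SL2.
Variable F : fieldType.

HB.instance Definition _ := [isSub for @SL2_mx F].
HB.instance Definition _ := [Choice of SL2 F by <:].

Implicit Types A B : SL2 F.

Fact SL2_one_subproof : \det (1%:M : 'M[F]_2) == 1.
Proof. by rewrite det1. Qed.
Definition SL2_one : SL2 F := MkSL2 SL2_one_subproof.

Fact SL2_mul_subproof A B : \det (A *m B) == 1.
Proof. by rewrite det_mulmx (eqP (valP A)) (eqP (valP B)) mulr1. Qed.
Definition SL2_mul A B : SL2 F := MkSL2 (SL2_mul_subproof A B).

Fact SL2_inv_subproof A : \det (invmx A) == 1.
Proof. by rewrite det_inv (eqP (valP A)) invr1. Qed.
Definition SL2_inv A : SL2 F := MkSL2 (SL2_inv_subproof A).

Fact SL2_opp_subproof A : \det (- SL2_mx A) == 1.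
Proof. by rewrite -scaleN1r detZ sqrrN expr1n mul1r (valP A). Qed.
Definition SL2_opp A : SL2 F := MkSL2 (SL2_opp_subproof A).

Fact SL2_unit A : SL2_mx A \in unitmx.
Proof. by rewrite unitmxE (eqP (valP A)) unitr1. Qed.

Fact SL2_mulA : associative SL2_mul.
Proof. by move=> A B C; apply: val_inj; rewrite /= mulmxA. Qed.
Fact SL2_mul1 : left_id SL2_one SL2_mul.
Proof. by move=> A; apply: val_inj; rewrite /= mul1mx. Qed.
Fact SL2_mulr1 : right_id SL2_one SL2_mul.
Proof. by move=> A; apply: val_inj; rewrite /= mulmx1. Qed.
Fact SL2_mulV : left_inverse SL2_one SL2_inv SL2_mul.
Proof. by move=> A; apply: val_inj; rewrite /= mulVmx ?SL2_unit. Qed.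
Fact SL2_mulrV : right_inverse SL2_one SL2_inv SL2_mul.
Proof. by move=> A; apply: val_inj; rewrite /= mulmxV ?SL2_unit. Qed.

HB.instance Definition _ := isGroup.Build (SL2 F)
  SL2_mulA SL2_mul1 SL2_mulr1 SL2_mulV SL2_mulrV.

Definition eq_up_to_sign A B : bool := (A == B) || (A == SL2_opp B).

Fact SL2_oppK : involutive SL2_opp.
Proof. by move=> A; apply: val_inj; rewrite /= opprK. Qed.

Fact eq_up_to_sign_refl : reflexive eq_up_to_sign.
Proof. by move=> A; rewrite /eq_up_to_sign eqxx. Qed.
Fact eq_up_to_sign_sym : symmetric eq_up_to_sign.
Proof.
move=> A B; rewrite /eq_up_to_sign eq_sym; congr (_ || _).
by rewrite -[in RHS](inj_eq (inv_inj SL2_oppK)) SL2_oppK eq_sym.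
Qed.
Fact eq_up_to_sign_trans : transitive eq_up_to_sign.
Proof.
move=> B A C /orP[/eqP->//|/eqP->] /orP[/eqP->|/eqP->].
  by rewrite /eq_up_to_sign eqxx orbT.
by rewrite SL2_oppK eq_up_to_sign_refl.
Qed.

Canonical eq_up_to_sign_equiv := EquivRel eq_up_to_sign
  eq_up_to_sign_refl eq_up_to_sign_sym eq_up_to_sign_trans.

End SL2.

Definition PSL2 (F : fieldType) := {eq_quot (@eq_up_to_sign F)}.

Section PSL2.
Variable F : fieldType.

HB.instance Definition _ := Choice.on (PSL2 F).
HB.instance Definition _ := EqQuotient.on (PSL2 F).

Implicit Types (A B : SL2 F) (p q : PSL2 F).

Lemma PSL2_eqP A B :
  reflect (A = B \/ A = SL2_opp B) (\pi_(PSL2 F) A == \pi_(PSL2 F) B).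
Proof. by rewrite eqmodE; apply: (iffP orP) => -[] /eqP; auto. Qed.

Lemma PSL2_repr A :
  repr (\pi_(PSL2 F) A) = A \/ repr (\pi_(PSL2 F) A) = SL2_opp A.
Proof. by apply/PSL2_eqP; rewrite reprK. Qed.

Definition PSL2_one : PSL2 F := \pi_(PSL2 F) 1%g.
Definition PSL2_mul p q : PSL2 F := \pi_(PSL2 F) (repr p * repr q)%g.
Definition PSL2_inv p : PSL2 F := \pi_(PSL2 F) (repr p)^-1%g.

Fact SL2_mulNl A B : (SL2_opp A * B)%g = SL2_opp (A * B)%g.
Proof. by apply: val_inj; rewrite /= mulNmx. Qed.
Fact SL2_mulNr A B : (A * SL2_opp B)%g = SL2_opp (A * B)%g.
Proof. by apply: val_inj; rewrite /= mulmxN. Qed.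

Lemma PSL2_piM A B : PSL2_mul (\pi A) (\pi B) = \pi_(PSL2 F) (A * B)%g.
Proof.
apply/eqP/PSL2_eqP.
by case: (PSL2_repr A) (PSL2_repr B) => -> [] ->;
   rewrite ?SL2_mulNl ?SL2_mulNr ?SL2_oppK; auto.
Qed.

Fact PSL2_mulA : associative PSL2_mul.
Proof.
by move=> p q r; rewrite -[p]reprK -[q]reprK -[r]reprK !PSL2_piM mulgA.
Qed.
Fact PSL2_mul1 : left_id PSL2_one PSL2_mul.
Proof. by move=> p; rewrite -[p]reprK PSL2_piM mul1g. Qed.
Fact PSL2_mulr1 : right_id PSL2_one PSL2_mul.
Proof. by move=> p; rewrite -[p]reprK PSL2_piM mulg1. Qed.
Fact PSL2_mulV : left_inverse PSL2_one PSL2_inv PSL2_mul.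
Proof. by move=> p; rewrite -{2}[p]reprK PSL2_piM mulVg. Qed.
Fact PSL2_mulrV : right_inverse PSL2_one PSL2_inv PSL2_mul.
Proof. by move=> p; rewrite -{1}[p]reprK PSL2_piM mulgV. Qed.

HB.instance Definition _ := isGroup.Build (PSL2 F)
  PSL2_mulA PSL2_mul1 PSL2_mulr1 PSL2_mulV PSL2_mulrV.

End PSL2.

(* Every point of [G] is isolated in [G], for the topology that PSL_2 inherits
   from the matrix entries. *)
Definition discrete_in_PSL2 (F : numFieldType) (G : set (PSL2 F)) : Prop :=
  forall A : SL2 F, G (\pi A) -> exists2 e : F, 0 < e &
    forall B : SL2 F, G (\pi B) ->
      (forall i j, `|B i j - A i j| < e) -> \pi_(PSL2 F) B = \pi A.

Section Hyperbolic.
Variable R : realType.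
Local Notation C := R[i].

Definition arcosh (x : R) : R := ln (x + Num.sqrt (x ^+ 2 - 1)).

Definition normsq (z : C) : R := complex.Re z ^+ 2 + complex.Im z ^+ 2.

Definition H2 : set C := [set z | 0 < complex.Im z].

(* cosh d(z, w) = 1 + |z - w|^2 / (2 Im z Im w): curvature -1. *)
Definition dist2 (z w : C) : R :=
  arcosh (1 + normsq (z - w) / (2 * complex.Im z * complex.Im w)).

Definition moebius2 (A : 'M[R]_2) (z : C) : C :=
  ((A 0 0)%:C * z + (A 0 1)%:C) / ((A 1 0)%:C * z + (A 1 1)%:C).

Definition act2 (p : PSL2 R) (z : C) : C := moebius2 (repr p) z.

Definition H3 : set (C * R) := [set x | 0 < x.2].

(* cosh d((z, t), (w, s)) = 1 + (|z - w|^2 + (t - s)^2) / (2 t s): curvature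
   -1. *)
Definition dist3 (x y : C * R) : R :=
  arcosh (1 + (normsq (x.1 - y.1) + (x.2 - y.2) ^+ 2) / (2 * x.2 * y.2)).

(* Poincare extension of the Moebius transformation of matrix [A]. *)
Definition moebius3 (A : 'M[C]_2) (x : C * R) : C * R :=
  let: (z, t) := x in
  let u := A 0 0 * z + A 0 1 in
  let v := A 1 0 * z + A 1 1 in
  let N := normsq v + normsq (A 1 0) * t ^+ 2 in
  ((u * conjc v + A 0 0 * conjc (A 1 0) * (t ^+ 2)%:C) / N%:C, t / N).

Definition act3 (p : PSL2 C) (x : C * R) : C * R := moebius3 (repr p) x.

(* The choice of representatives in [act2] and [act3] is immaterial. *)
Lemma act2_pi (A : SL2 R) : act2 (\pi A) =1 moebius2 A.
Proof.
have NC (a : R) : (- a)%:C = - a%:C by exact: (rmorphN (real_complex R)).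
move=> z; rewrite /act2; case: (PSL2_repr A) => -> //=.
by rewrite /moebius2 !mxE !NC !mulNr -!opprD invrN mulrNN.
Qed.

Lemma act3_pi (A : SL2 C) : act3 (\pi A) =1 moebius3 A.
Proof.
have nN z : normsq (- z) = normsq z by case: z => a b; rewrite /normsq /= !sqrrN.
move=> [z t]; rewrite /act3; case: (PSL2_repr A) => -> //=.
by rewrite /moebius3 !mxE !mulNr -!opprD !nN !rmorphN ?mulrN ?mulNr ?opprK.
Qed.

Definition translation_length (T : Type) (X : set T) (d : T -> T -> R)
    (f : T -> T) : R :=
  inf [set d x (f x) | x in X].

(* The sphere R^3 \cup {oo}, which contains the compactification of H^3 by its
   boundary  (C x {0}) \cup {oo}. *)
Definition sphere3 := one_point_compactification (R * R * R)%type.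

Definition to_sphere3 (x : C * R) : sphere3 :=
  Some (complex.Re x.1, complex.Im x.1, x.2).

Definition boundary_H3 : set sphere3 :=
  [set None] `|` [set to_sphere3 (z, 0) | z in [set: C]].

Variable Gamma : groupType.

Definition orbit (T G : Type) (act : G -> T -> T) (rho : Gamma -> G) (x : T) :
    set T :=
  [set act (rho gamma) x | gamma in [set: Gamma]].

(* Accumulation set in the boundary of the orbit of (0, 1); for a discrete group
   it does not depend on the base point. *)
Definition limit_set (rho : Gamma -> PSL2 C) : set sphere3 :=
  boundary_H3 `&` closure (to_sphere3 @` orbit act3 rho (0, 1)).

Definition unit_circle : set (R * R) := [set p | p.1 ^+ 2 + p.2 ^+ 2 = 1].

Definition jordan_curve (J : set sphere3) : Prop :=
  exists f : R * R -> sphere3,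
    [/\ {within unit_circle, continuous f}, set_inj unit_circle f &
        f @` unit_circle = J].

Definition discrete_faithful (F : numFieldType) (rho : Gamma -> PSL2 F) :=
  injective rho /\ discrete_in_PSL2 (range rho).

Definition quasi_fuchsian (rho : {multiplicative Gamma -> PSL2 C}) : Prop :=
  discrete_faithful rho /\ jordan_curve (limit_set rho).

Fact SL2_complexify_subproof (A : SL2 R) :
  \det (map_mx (real_complex R) A) == 1.
Proof. by rewrite det_map_mx (eqP (valP A)) rmorph1. Qed.
Definition SL2_complexify (A : SL2 R) : SL2 C :=
  MkSL2 (SL2_complexify_subproof A).

Definition PSL2R_in_PSL2C : set (PSL2 C) :=
  [set p | exists A : SL2 R, p = \pi_(PSL2 C) (SL2_complexify A)].

Definition fuchsian (rho : {multiplicative Gamma -> PSL2 C}) : Prop :=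
  exists h : PSL2 C,
    forall gamma, PSL2R_in_PSL2C (h * rho gamma * h^-1)%g.

Definition length_M (rho : Gamma -> PSL2 C) (gamma : Gamma) : R :=
  translation_length H3 dist3 (act3 (rho gamma)).

Definition length_Sigma (rho : Gamma -> PSL2 R) (gamma : Gamma) : R :=
  translation_length H2 dist2 (act2 (rho gamma)).

(* X / rho(Gamma) is represented by its set of orbits; the distance between two
   orbits, an infimum, is the path distance of the quotient metric. *)

Definition quotient_space (T G : Type) (act : G -> T -> T) (rho : Gamma -> G)
    (X : set T) : set (set T) :=
  [set orbit act rho x | x in X].

Definition quotient_dist (T : Type) (d : T -> T -> R) (U V : set T) : R :=
  inf [set d u v | u in U & v in V].

Definition isometric (T1 T2 : Type) (X1 : set T1) (d1 : T1 -> T1 -> R)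
    (X2 : set T2) (d2 : T2 -> T2 -> R) : Prop :=
  exists f : T1 -> T2, set_bij X1 X2 f /\
    forall x y, X1 x -> X1 y -> d2 (f x) (f y) = d1 x y.

(* A distance-preserving map of H^2 into H^3 sends geodesics to geodesics, so
   these are the totally geodesic copies of H^2 in H^3. *)
Definition totally_geodesic_plane (P : set (C * R)) : Prop :=
  P `<=` H3 /\ isometric H2 dist2 P dist3.

Definition preserves (rho : Gamma -> PSL2 C) (P : set (C * R)) : Prop :=
  forall gamma, act3 (rho gamma) @` P = P.

Definition isometric_to_totally_geodesic_surface
    (rho : Gamma -> PSL2 C) (rho0 : Gamma -> PSL2 R) : Prop :=
  exists P : set (C * R),
    [/\ totally_geodesic_plane P, preserves rho P &
        isometric (quotient_space act2 rho0 H2) (quotient_dist dist2)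
                  (quotient_space act3 rho P) (quotient_dist dist3)].

End Hyperbolic.

(* Main.v *)
Require Import Defs.
From mathcomp Require Import all_boot all_order all_algebra.
From mathcomp Require Import all_classical all_reals all_analysis.
From mathcomp Require Import complex.
From mathcomp Require Import ring lra.

Set Implicit Arguments.
Unset Strict Implicit.
Unset Printing Implicit Defensive.

Import Order.TTheory GRing.Theory Num.Theory.
Import numFieldNormedType.Exports.

Local Open Scope classical_set_scope.
Local Open Scope ring_scope.
Local Open Scope complex_scope.
Local Open Scope quotient_scope.

Import ComplexField.Normc.

(** The translation length of an isometry is a function of the trace of its
   matrix: its exponential, the stretch factor, is the square of the spectral
   radius [translation_length_H3, translation_length_H2]. Composing [rho0] with
   the inclusion of PSL_2(R) in PSL_2(C), the hypothesis becomes a relation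
   between two representations of [Gamma] in PSL_2(C), one of which has real
   traces: the stretch factors of the first are the [k]-th powers of those of
   the second.

   Write a loxodromic matrix of determinant one as [l P + l^-1 (1 - P)], where
   [|l| > 1] and [P] is the projector on the attracting eigenline. For two
   loxodromic elements [a] and [b], the stretch factor of [a^n b^n], divided by
   those of [a^n] and [b^n], tends to [|tr (P Q)|^2], the squared modulus of a
   cross-ratio of the four fixed points [cvg_stretch_pow]. Hence
   [|tr (P Q)| = |tr (P1 Q1)|^k], where the index 1 refers to the second
   representation [spec_trace]; replacing [b] by its inverse changes [Q] into
   [1 - Q], so that also [|1 - tr (P Q)| = |1 - tr (P1 Q1)|^k].

   The exponent is one. If [a] and [b] have no common fixed point, the same
   relations for [b] and its conjugates by [a^n] give
   [|l^n - l^-n| = |l1^n - l1^-n|^k] for all [n] [eigen_diff]. With [w = l^-2]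
   and [x = l1^-2], which lies in the interval ]0, 1[ because [l1] is real, this
   says that [|w| = x^k] and [|1 - w^n| = (1 - x^n)^k < 1] for all positive [n].
   All positive powers of [w] have therefore a positive real part, so [w] is
   positive, and [x^k + (1 - x)^k = 1], whose only solution is [k = 1]
   [exponent_eq1].

   Now [p = tr (P Q)] and the real number [p1 = tr (P1 Q1)] satisfy [|p| = |p1|]
   and [|1 - p| = |1 - p1|], so they are equal [spec_trace_eq]. The trace of the
   product determines a pair of projectors up to conjugation
   [pair_intertwiner], so that after a conjugation the two representations give
   the same projectors to [a] and [b]; by traces again they give the same
   projector to every loxodromic element [pair_separates], and they coincide
   [rigidity]. So [rhoQF] is conjugate to [rho0], and the vertical half plane,
   moved by the conjugating element, is the required totally geodesic plane
   [totally_geodesic_quotient].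

   There remains to find two loxodromic elements without common fixed point
   [exists_loxodromic_pair]. Otherwise the orbit of a point would be bounded, or
   lie on a horosphere or at constant distance from a geodesic, and the limit
   set would have at most two points besides infinity, while a Jordan curve is
   infinite. Discreteness excludes elements that share exactly one fixed point
   with a loxodromic element. *)

(** * Linear combinations of equations *)

(** An equation [x = y] follows from given equations once [x - y] is exhibited as
   a linear combination of the differences of their sides. *)
Section LinearCombination.
Variable A : comNzRingType.
Implicit Types x y u v c : A.

Lemma lincomb1 x y u v (E : u = v) c : x - y = c * (u - v) -> x = y.
Proof. by move/eqP; rewrite E subrr mulr0 subr_eq0 => /eqP. Qed.

Lemma lincomb2 x y u v (E : u = v) c u' v' (E' : u' = v') c' :
  x - y = c * (u - v) + c' * (u' - v') -> x = y.
Proof. by rewrite E' subrr mulr0 addr0; exact: lincomb1. Qed.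

Lemma lincomb3 x y u v (E : u = v) c u' v' (E' : u' = v') c'
    u'' v'' (E'' : u'' = v'') c'' :
  x - y = c * (u - v) + c' * (u' - v') + c'' * (u'' - v'') -> x = y.
Proof. by rewrite E'' subrr mulr0 addr0; exact: lincomb2. Qed.

Lemma lincomb4 x y u v (E : u = v) c u' v' (E' : u' = v') c'
    u'' v'' (E'' : u'' = v'') c'' u3 v3 (E3 : u3 = v3) c3 :
  x - y = c * (u - v) + c' * (u' - v') + c'' * (u'' - v'') + c3 * (u3 - v3) ->
  x = y.
Proof. by rewrite E3 subrr mulr0 addr0; exact: lincomb3. Qed.

End LinearCombination.
Arguments lincomb1 {A x y u v} E c.
Arguments lincomb2 {A x y u v} E c {u' v'} E' c'.
Arguments lincomb3 {A x y u v} E c {u' v'} E' c' {u'' v''} E'' c''.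
Arguments lincomb4 {A x y u v} E c {u' v'} E' c' {u'' v''} E'' c'' {u3 v3} E3 c3.

(** * Two by two matrices *)

Section Mx2.
Variable F : fieldType.
Implicit Types (a b c d : F) (M N : 'M[F]_2).

(** The matrix with rows [(a, b)] and [(c, d)]. *)
Definition mx2 a b c d : 'M[F]_2 :=
  \matrix_(i, j) if i == 0 then (if j == 0 then a else b)
                 else (if j == 0 then c else d).

Lemma mx2P M : M = mx2 (M 0 0) (M 0 1) (M 1 0) (M 1 1).
Proof.
apply/matrixP => i j; rewrite mxE.
by case: i j => [[|[|//]] ?] [[|[|//]] ?]; congr (M _ _); apply/val_inj.
Qed.

Lemma mx2_ind (P : 'M[F]_2 -> Prop) :
  (forall a b c d, P (mx2 a b c d)) -> forall M, P M.
Proof. by move=> H M; rewrite (mx2P M). Qed.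

Lemma mx2E a b c d :
  (mx2 a b c d 0 0 = a) * (mx2 a b c d 0 1 = b) *
  (mx2 a b c d 1 0 = c) * (mx2 a b c d 1 1 = d).
Proof. by rewrite !mxE. Qed.

Lemma mx2_inj a b c d a' b' c' d' :
  mx2 a b c d = mx2 a' b' c' d' -> [/\ a = a', b = b', c = c' & d = d'].
Proof. by move=> E; split; [have := congr1 (fun M : 'M[F]_2 => M 0 0) E
  | have := congr1 (fun M : 'M[F]_2 => M 0 1) E
  | have := congr1 (fun M : 'M[F]_2 => M 1 0) E
  | have := congr1 (fun M : 'M[F]_2 => M 1 1) E]; rewrite !mx2E. Qed.

Lemma mul_mx2 a b c d a' b' c' d' : mx2 a b c d *m mx2 a' b' c' d' =
  mx2 (a * a' + b * c') (a * b' + b * d') (c * a' + d * c') (c * b' + d * d').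
Proof. by rewrite [LHS]mx2P !mxE !big_ord_recl !big_ord0 /= !mxE /= !addr0. Qed.

Lemma add_mx2 a b c d a' b' c' d' : mx2 a b c d + mx2 a' b' c' d' =
  mx2 (a + a') (b + b') (c + c') (d + d').
Proof. by rewrite [LHS]mx2P !mxE. Qed.

Lemma opp_mx2 a b c d : - mx2 a b c d = mx2 (- a) (- b) (- c) (- d).
Proof. by rewrite [LHS]mx2P !mxE. Qed.

Lemma scale_mx2 e a b c d :
  e *: mx2 a b c d = mx2 (e * a) (e * b) (e * c) (e * d).
Proof. by rewrite [LHS]mx2P !mxE. Qed.

Lemma mx2_1 : 1%:M = mx2 1 0 0 1.
Proof. by rewrite [LHS]mx2P !mxE. Qed.

Lemma mx2_0 : 0 = mx2 0 0 0 0.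
Proof. by rewrite [LHS]mx2P !mxE. Qed.

Lemma det_mx2 a b c d : \det (mx2 a b c d) = a * d - b * c.
Proof.
rewrite (expand_det_row _ 0) !big_ord_recl big_ord0 /cofactor !det_mx11 !mxE /=.
by rewrite expr0 expr1 !mul1r mulN1r mulrN addr0.
Qed.

Lemma tr_mx2 a b c d : \tr (mx2 a b c d) = a + d.
Proof. by rewrite /mxtrace !big_ord_recl big_ord0 !mxE /= addr0. Qed.

Definition mx2_simp := (mul_mx2, add_mx2, opp_mx2, scale_mx2, mx2_1, mx2_0,
  det_mx2, tr_mx2).

Lemma invmx_mx2 a b c d : a * d - b * c = 1 ->
  invmx (mx2 a b c d) = mx2 d (- b) (- c) a.
Proof.
move=> det1; have U : mx2 a b c d \in unitmx by rewrite unitmxE det_mx2 det1 unitr1.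
have E : mx2 a b c d *m mx2 d (- b) (- c) a = 1%:M.
  by rewrite !mx2_simp -det1; congr mx2; ring.
by rewrite -[LHS]mulmx1 -E mulKmx.
Qed.

End Mx2.

(** * Moduli of complex numbers *)

Section Modulus.
Variable R : realType.
Local Notation C := R[i].
Implicit Types z w : C.

Lemma normc_ge0 z : 0 <= normc z.
Proof. by case: z => a b; rewrite sqrtr_ge0. Qed.

Lemma normc_sqr z : normc z ^+ 2 = normsq z.
Proof. by case: z => a b; rewrite /normsq /= sqr_sqrtr // addr_ge0 ?sqr_ge0. Qed.

Lemma normsq_ge0 z : 0 <= normsq z.
Proof. by rewrite -normc_sqr sqr_ge0. Qed.

Lemma normsqM z w : normsq (z * w) = normsq z * normsq w.
Proof. by rewrite -!normc_sqr normcM exprMn. Qed.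

Lemma normsqN z : normsq (- z) = normsq z.
Proof. by rewrite -!normc_sqr normcN. Qed.

Lemma normsqV z : normsq z^-1 = (normsq z)^-1.
Proof. by rewrite -!normc_sqr normcV exprVn. Qed.

Lemma normsq_real (x : R) : normsq x%:C = x ^+ 2.
Proof. by rewrite /normsq /= expr0n addr0. Qed.

Lemma normsqE z : (normsq z)%:C = z * conjc z.
Proof. by case: z => a b; rewrite /normsq; simpc; congr Complex; ring. Qed.

Lemma normc_real (x : R) : normc x%:C = `|x|.
Proof. by rewrite /= expr0n addr0 sqrtr_sqr. Qed.

Lemma normc_eq0 z : (normc z == 0) = (z == 0).
Proof. by apply/eqP/eqP => [/eq0_normc//|->]; rewrite normc0. Qed.

Lemma normsq_eq0 z : (normsq z == 0) = (z == 0).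
Proof. by rewrite -normc_sqr sqrf_eq0 normc_eq0. Qed.

Lemma normc_gt0 z : (0 < normc z) = (z != 0).
Proof. by rewrite lt_def normc_ge0 normc_eq0 andbT. Qed.

Lemma normcX z n : normc (z ^+ n) = normc z ^+ n.
Proof. by elim: n => [|n IH]; rewrite ?expr0 ?normc1 // !exprS normcM IH. Qed.

Lemma le_normcB z w : normc z - normc w <= normc (z - w).
Proof. by rewrite lerBlDr; have := le_normcD (z - w) w; rewrite subrK. Qed.

Lemma normc_dist z w : `|normc z - normc w| <= normc (z - w).
Proof.
by rewrite ler_norml le_normcB andbT lerNl opprB -[z - w]opprB normcN le_normcB.
Qed.

Lemma normc_normr z : `|z| = (normc z)%:C.
Proof. by case: z. Qed.

End Modulus.

(** * Stretch factors *)

Section Stretch.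
Variable R : realType.
Local Notation C := R[i].
Implicit Types t l z w : C.

(** [cosh] of the translation length of the isometry of H^3 defined by a matrix
   of determinant one and trace [t]. *)
Definition cosh_length t : R := (normsq t + normc (t ^+ 2 - 4)) / 4.

(** The exponential of that length, which is the square of the spectral radius
   of the matrix. *)
Definition stretch t : R := expR (arcosh (cosh_length t)).

Lemma expR_arcosh (s : R) : 1 <= s -> expR (arcosh ((s + s^-1) / 2)) = s.
Proof.
move=> s1; have s0 : 0 < s by apply: lt_le_trans s1.
have si1 : s^-1 <= s by rewrite (le_trans _ s1) // invf_le1.
rewrite /arcosh.
have -> : ((s + s^-1) / 2) ^+ 2 - 1 = ((s - s^-1) / 2) ^+ 2.
  by field; rewrite gt_eqF.
rewrite sqrtr_sqr ger0_norm; last by rewrite divr_ge0 // subr_ge0.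
have -> : (s + s^-1) / 2 + (s - s^-1) / 2 = s by field; rewrite gt_eqF.
by rewrite lnK.
Qed.

Lemma normsq_parallelogram z w :
  normsq (z + w) + normsq (z - w) = 2 * (normsq z + normsq w).
Proof. by case: z w => [a b] [c d]; rewrite /normsq /=; ring. Qed.

Lemma cosh_length_eigen l : l != 0 ->
  cosh_length (l + l^-1) = (normc l ^+ 2 + (normc l ^+ 2)^-1) / 2.
Proof.
move=> l0; rewrite /cosh_length.
have -> : (l + l^-1) ^+ 2 - 4 = (l - l^-1) ^+ 2 by field.
rewrite normcX !normc_sqr normsq_parallelogram normsqV; field.
by rewrite normsq_eq0.
Qed.

Lemma stretch_eigen l : 1 <= normc l -> stretch (l + l^-1) = normc l ^+ 2.
Proof.
move=> l1; rewrite /stretch cosh_length_eigen ?expR_arcosh ?exprn_ege1 //.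
by rewrite -normc_gt0 (lt_le_trans ltr01).
Qed.

(** Every [t] is the trace of a matrix of determinant one with eigenvalues [l] and
   [l^-1]; exchanging them makes [l] the dominant one. *)
Lemma eigen_ex t : exists2 l, 1 <= normc l & l + l^-1 = t.
Proof.
pose s := sqrtc (t ^+ 2 - 4).
have s2 : s ^+ 2 = t ^+ 2 - 4 by rewrite sqr_sqrtc.
pose l := (t + s) / 2; pose m := (t - s) / 2.
have lm : l * m = 1.
  have -> : l * m = (t ^+ 2 - s ^+ 2) / 4 by rewrite /l /m; field.
  by rewrite s2; field.
have l0 : l != 0 by apply: contraPneq lm => ->; rewrite mul0r => /esym/eqP; rewrite oner_eq0.
have m0 : m != 0 by apply: contraPneq lm => ->; rewrite mulr0 => /esym/eqP; rewrite oner_eq0.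
have li : l^-1 = m by rewrite -[LHS]mulr1 -lm mulKf.
have tlm : l + m = t by rewrite /l /m; field.
have [l1|l1] := leP 1 (normc l); first by exists l; rewrite ?li.
exists m; last by rewrite -li invrK li addrC.
have := congr1 (@normc R) lm; rewrite normcM normc1 => E.
by rewrite -E ler_piMl ?normc_ge0 ?ltW.
Qed.

Lemma stretch_ge1 t : 1 <= stretch t.
Proof. by have [l l1 <-] := eigen_ex t; rewrite stretch_eigen // exprn_ege1. Qed.

Lemma stretchN t : stretch (- t) = stretch t.
Proof. by rewrite /stretch /cosh_length normsqN sqrrN. Qed.

(** For large traces the stretch factor is the squared modulus of the trace, up to
   a bounded error. *)
Lemma stretch_near_normsq t : `|stretch t - normc t ^+ 2| <= 3.
Proof.
have [l l1 <-] := eigen_ex t; rewrite stretch_eigen //.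
have l0 : 0 < normc l by apply: lt_le_trans l1.
have U : normc (l + l^-1) <= normc l + (normc l)^-1.
  by rewrite -normcV le_normcD.
have L : normc l - (normc l)^-1 <= normc (l + l^-1).
  by rewrite -normcV -(normcN l^-1) -[X in _ <= normc (_ + X)]opprK le_normcB.
have i1 : (normc l)^-1 <= 1 by rewrite invf_le1.
have i0 : 0 < (normc l)^-1 by rewrite invr_gt0.
have li : normc l * (normc l)^-1 = 1 by rewrite divff // gt_eqF.
move: (normc l) (normc l)^-1 (normc (l + l^-1)) (normc_ge0 (l + l^-1)) l1 l0 U L i1 i0 li.
by move=> x y z z0 x1 x0 U L y1 y0 xy; rewrite ler_norml; nra.
Qed.

Lemma stretch_eq1 t : stretch t = 1 -> normc t <= 2.
Proof.
have [l l1 <-] := eigen_ex t; rewrite stretch_eigen // => E.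
have {}E : normc l = 1 by apply/eqP; rewrite -(@eqrXn2 _ 2) ?E ?expr1n ?normc_ge0.
by apply: le_trans (le_normcD _ _) _; rewrite normcV E invr1.
Qed.

Lemma stretch_eq1_eigen l : l != 0 -> stretch (l + l^-1) = 1 -> normc l = 1.
Proof.
wlog l1 : l / 1 <= normc l => [H l0 E|].
  have [/H|l1] := leP 1 (normc l); first exact.
  have := H l^-1; rewrite normcV invrK addrC E invr_eq0 l0.
  rewrite invf_ge1 ?normc_gt0 // => /(_ (ltW l1) isT erefl)/eqP.
  by rewrite invr_eq1 => /eqP.
rewrite stretch_eigen // => _ E.
by apply/eqP; rewrite -(@eqrXn2 _ 2) ?E ?expr1n ?normc_ge0.
Qed.

(** A loxodromic matrix with real trace has real eigenvalues. *)
Lemma eigen_real l : 1 < normc l -> complex.Im (l + l^-1) = 0 ->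
  complex.Im l = 0.
Proof.
move=> l1; have : 1 < normc l ^+ 2 by rewrite exprn_egt1.
rewrite normc_sqr; case: l {l1} => a b; rewrite /normsq /= => h.
have n0 : a ^+ 2 + b ^+ 2 != 0 by rewrite gt_eqF // (lt_trans ltr01).
move=> E; have : b * (a ^+ 2 + b ^+ 2 - 1) = 0.
  by rewrite -[RHS](mul0r (a ^+ 2 + b ^+ 2)) -E; field.
by move/eqP; rewrite mulf_eq0 subr_eq0 (gt_eqF h) orbF => /eqP.
Qed.

End Stretch.

(** * Lifts to matrices *)

Section Lift.
Variables (F : fieldType) (Gamma : groupType).
Implicit Types (rho : Gamma -> PSL2 F) (g h : Gamma) (M N : 'M[F]_2).

Lemma pi_PSL2M (A B : SL2 F) : (\pi_(PSL2 F) A * \pi_(PSL2 F) B)%g = \pi_(PSL2 F) (A * B)%g.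
Proof. exact: PSL2_piM. Qed.

Lemma pi_PSL2V (A : SL2 F) : (\pi_(PSL2 F) A)^-1%g = \pi_(PSL2 F) A^-1%g.
Proof. by apply: (mulgI (\pi_(PSL2 F) A)); rewrite mulgV pi_PSL2M mulgV. Qed.

(** [M] is one of the two matrices of determinant one above [rho g]. *)
Definition mxlift rho g M : Prop :=
  exists2 A : SL2 F, \pi_(PSL2 F) A = rho g & SL2_mx A = M.

Lemma mxlift_ex rho g : exists M, mxlift rho g M.
Proof. by exists (repr (rho g)); exists (repr (rho g)) => //; rewrite reprK. Qed.

Lemma mxlift_det rho g M : mxlift rho g M -> \det M = 1.
Proof. by case=> A _ <-; exact/eqP/(valP A). Qed.

Lemma mxlift_unit rho g M : mxlift rho g M -> M \in unitmx.
Proof. by case=> A _ <-; exact: SL2_unit. Qed.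

Lemma mxlift_sign rho g M N : mxlift rho g M -> mxlift rho g N -> N = M \/ N = - M.
Proof.
case=> A EA <- [B EB <-]; have /eqP/PSL2_eqP[->|->] : \pi_(PSL2 F) B = \pi A.
- by rewrite EA.
- by left.
- by right.
Qed.

Lemma mxliftN rho g M : mxlift rho g M -> mxlift rho g (- M).
Proof.
case=> A EA <-; exists (SL2_opp A) => //; rewrite -EA.
by apply/eqP/PSL2_eqP; right.
Qed.

Lemma mxlift_inj rho rho' g M : mxlift rho g M -> mxlift rho' g M -> rho g = rho' g.
Proof. by case=> A <- EM [B <-]; rewrite -EM => /val_inj ->. Qed.

Section Morphism.
Variable rho : Gamma -> PSL2 F.
Hypothesis rhoM : {morph rho : x y / (x * y)%g}.

Lemma mxliftM g h M N : mxlift rho g M -> mxlift rho h N -> mxlift rho (g * h)%g (M *m N).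
Proof.
case=> A EA <- [B EB <-]; exists (A * B)%g => //.
by rewrite rhoM -EA -EB; symmetry; exact: PSL2_piM.
Qed.

Lemma mxlift1 : mxlift rho 1%g 1%:M.
Proof.
exists 1%g => //; have : (rho 1 * rho 1 = rho 1 * 1)%g by rewrite -rhoM !mulg1.
by move/mulgI => ->.
Qed.

Lemma mxliftV g M : mxlift rho g M -> mxlift rho g^-1%g (invmx M).
Proof.
case=> A EA <-; exists (A^-1)%g => //.
have E1 : rho 1%g = 1%g by apply: (mulgI (rho 1%g)); rewrite -rhoM !mulg1.
apply: (mulgI (rho g)); rewrite -rhoM mulgV E1 -EA.
by rewrite [LHS]PSL2_piM mulgV.
Qed.

Lemma mxliftJ g h M N : mxlift rho g M -> mxlift rho h N ->
  mxlift rho (g * h * g^-1)%g (M *m N *m invmx M).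
Proof. by move=> gM hN; apply: mxliftM (mxliftV gM); apply: mxliftM. Qed.

End Morphism.
End Lift.

(** * Spectral projectors *)

Section Pencil.
Variable F : fieldType.
Implicit Types (P Q : 'M[F]_2) (x y : F).

(** The matrix with eigenvalue [x] on the image of the projector [P] and
   eigenvalue [y] on its kernel. *)
Definition pencil P x y : 'M[F]_2 := x *: P + y *: (1%:M - P).

Lemma pencilM P x y x' y' : P *m P = P ->
  pencil P x y *m pencil P x' y' = pencil P (x * x') (y * y').
Proof.
move=> PP; rewrite /pencil mulmxDl !mulmxDr -!scalemxAl -!scalemxAr.
rewrite mulmxBr mulmx1 !mulmxBl !mul1mx !mulmxBr mulmx1 PP !subrr !scaler0 addr0 add0r.
by rewrite subr0 !scalerA.
Qed.

Lemma pencil11 P : pencil P 1 1 = 1%:M.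
Proof. by rewrite /pencil !scale1r addrC subrK. Qed.

Lemma pencil10 P : pencil P 1 0 = P.
Proof. by rewrite /pencil scale1r scale0r addr0. Qed.

Lemma pencil_compl P x y : pencil (1%:M - P) x y = pencil P y x.
Proof. by rewrite /pencil subKr addrC. Qed.

Lemma idem_compl P : P *m P = P -> (1%:M - P) *m (1%:M - P) = 1%:M - P.
Proof. by move=> PP; rewrite mulmxBr mulmx1 mulmxBl mul1mx PP subrr subr0. Qed.

Lemma pencil_inv P x : P *m P = P -> x != 0 -> invmx (pencil P x x^-1) = pencil P x^-1 x.
Proof.
move=> PP x0; have E : pencil P x x^-1 *m pencil P x^-1 x = 1%:M.
  by rewrite pencilM // mulfV // mulVf // pencil11.
by rewrite -[LHS]mulmx1 -E mulKmx //; case/mulmx1_unit: E.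
Qed.

Lemma pencilJ P x y N : N \in unitmx ->
  N *m pencil P x y *m invmx N = pencil (N *m P *m invmx N) x y.
Proof.
move=> UN; rewrite /pencil mulmxDr mulmxDl -!scalemxAr -!scalemxAl.
by rewrite mulmxBr mulmxBl mulmx1 mulmxV.
Qed.

Lemma idemJ P N : N \in unitmx -> P *m P = P ->
  (N *m P *m invmx N) *m (N *m P *m invmx N) = N *m P *m invmx N.
Proof. by move=> UN PP; rewrite !mulmxA mulmxKV // -(mulmxA N) PP. Qed.

Lemma mxtraceJ P N : N \in unitmx -> \tr (N *m P *m invmx N) = \tr P.
Proof. by move=> UN; rewrite mxtrace_mulC mulmxA mulVmx // mul1mx. Qed.

Lemma mxtraceB P Q : \tr (P - Q) = \tr P - \tr Q.
Proof. exact: raddfB. Qed.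

Lemma mxtrace_pencilM P Q x y z w : \tr P = 1 -> \tr Q = 1 ->
  \tr (pencil P x y *m pencil Q z w) =
    (x * z + y * w) * \tr (P *m Q) + (x * w + y * z) * (1 - \tr (P *m Q)).
Proof.
move=> tP tQ; rewrite /pencil mulmxDl !mulmxDr -!scalemxAl -!scalemxAr.
rewrite mulmxBr mulmx1 !mulmxBl !mul1mx mulmxBr mulmx1.
rewrite !(mxtraceB, mxtraceD, mxtraceZ, mxtrace1, tP, tQ); ring.
Qed.

(** The spectral projector of a matrix with distinct eigenvalues is
   [(A - l^-1) / (l - l^-1)]. *)
Lemma pencil_ex (A : 'M[F]_2) l : \det A = 1 -> l != 0 -> l - l^-1 != 0 ->
  \tr A = l + l^-1 -> exists P, [/\ A = pencil P l l^-1, P *m P = P & \tr P = 1].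
Proof.
move=> dA l0 ll tl; exists ((l - l^-1)^-1 *: (A - l^-1%:M)).
have lm : l * l^-1 = 1 by rewrite mulfV.
have := mulVf ll; move: lm tl; rewrite /pencil.
move: (l - l^-1)^-1 => k; move: (l^-1) => m lm tl km.
elim/mx2_ind: A dA tl => a b c d; rewrite !mx2_simp => dA tl.
have -> : m%:M = mx2 m 0 0 m :> 'M[F]_2.
  by rewrite -scalemx1 !mx2_simp !mulr0 !mulr1.
have Ed : d = l + m - a by rewrite -tl; ring.
subst d.
have Ebc : b * c = a * (l + m - a) - 1 by rewrite -dA; ring.
split=> //; rewrite !mx2_simp; [congr mx2|congr mx2|].
- by apply: (lincomb1 km (- (a - m))); ring.
- by apply: (lincomb1 km (- b)); ring.
- by apply: (lincomb1 km (- c)); ring.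
- by apply: (lincomb1 km (- (l - a))); ring.
- by apply: (lincomb3 Ebc (k ^+ 2) km (k * (a - m)) lm (k ^+ 2)); ring.
- by apply: (lincomb1 km (k * b)); ring.
- by apply: (lincomb1 km (k * c)); ring.
- by apply: (lincomb3 Ebc (k ^+ 2) km (k * (l - a)) lm (k ^+ 2)); ring.
- by apply: (lincomb1 km 1); ring.
Qed.

End Pencil.

Section Spectral.
Variable R : realType.
Local Notation C := R[i].
Implicit Types (A P Q : 'M[C]_2) (l m : C).

(** [A] is loxodromic, with dominant eigenvalue [l] and spectral projector [P]
   on the attracting eigenline. *)
Definition spec_mx A l P : Prop :=
  [/\ A = pencil P l l^-1, P *m P = P, \tr P = 1 & 1 < normc l].

Lemma gt1_neq0 l : 1 < normc l -> l != 0.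
Proof. by move=> l1; rewrite -normc_gt0 (lt_trans ltr01). Qed.

Lemma gt1_neqV l : 1 < normc l -> l - l^-1 != 0.
Proof.
move=> l1; apply/eqP => /eqP; rewrite subr_eq0 => /eqP E.
have := l1; rewrite E normcV invf_gt1 ?(lt_trans ltr01) // => l1'.
by have := lt_trans l1 l1'; rewrite ltxx.
Qed.

Lemma mxtrace_spec A l P : spec_mx A l P -> \tr A = l + l^-1.
Proof.
by case=> -> _ tP _; rewrite !(mxtraceB, mxtraceD, mxtraceZ, mxtrace1, tP); ring.
Qed.

Lemma stretch_spec A l P : spec_mx A l P -> stretch (\tr A) = normc l ^+ 2.
Proof. by move=> S; rewrite (mxtrace_spec S) stretch_eigen //; case: S => _ _ _ /ltW. Qed.

Lemma spec_ex A : \det A = 1 -> 1 < stretch (\tr A) -> exists l P, spec_mx A l P.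
Proof.
have [l l1 tl] := eigen_ex (\tr A); rewrite -tl stretch_eigen // => dA s1.
have {s1} {}l1 : 1 < normc l by rewrite -(@expr_gt1 _ 2) ?normc_ge0.
have [P [PA PP tP]] := pencil_ex dA (gt1_neq0 l1) (gt1_neqV l1) (esym tl).
by exists l, P.
Qed.

Lemma spec_inv A l P : spec_mx A l P -> spec_mx (invmx A) l (1%:M - P).
Proof.
case=> -> PP tP l1; split=> //.
- by rewrite pencil_compl; apply: pencil_inv PP (gt1_neq0 l1).
- exact: idem_compl.
- by rewrite mxtraceB mxtrace1 tP; ring.
Qed.

Lemma spec_conj N A l P : N \in unitmx -> spec_mx A l P ->
  spec_mx (N *m A *m invmx N) l (N *m P *m invmx N).
Proof.
move=> UN [-> PP tP l1]; split=> //; first by rewrite pencilJ.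
- exact: idemJ.
- by rewrite mxtraceJ.
Qed.

End Spectral.

(** * The asymptotic relation between traces *)

Section Asymptotics.
Variable R : realType.
Local Notation C := R[i].
Implicit Types (l m : C) (A B P Q : 'M[C]_2).

Lemma cvg_powR (u : R^nat) (x k : R) : 0 < k -> 0 <= x -> (forall n, 0 <= u n) ->
  u @ \oo --> x -> (fun n => u n `^ k) @ \oo --> x `^ k.
Proof.
move=> k0; rewrite le_eqVlt => /orP[/eqP <-|x0] u0 ux; last first.
  apply: (cvg_comp u (fun y => y `^ k) ux).
  apply: (@differentiable_continuous _ _ _ x (fun y => y `^ k)); apply/derivable1_diffP.
  exact: (@ex_derive _ _ _ _ _ _ _ (is_derive1_powR k x0)).
rewrite powR0 ?gt_eqF //; apply/cvgrPdist_lt => e e0.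
have := @cvgr_dist_lt _ _ _ _ _ _ _ ux (e `^ k^-1).
rewrite powR_gt0 // => /(_ _ isT); apply: filterS => n.
rewrite !sub0r !normrN ger0_norm // ger0_norm ?powR_ge0 // => ue.
have := @gt0_ltr_powR _ _ k0 (u n) (e `^ k^-1).
rewrite !nnegrE u0 powR_ge0 -powRrM mulVf ?gt_eqF // powRr1 ?ltW //.
exact.
Qed.

Lemma cvg_dist_le (u v : R^nat) a : (forall n, `|u n - a| <= v n) ->
  v @ \oo --> (0 : R) -> u @ \oo --> a.
Proof.
move=> uv v0.
apply: (@squeeze_cvgr _ _ _ _ (fun n => a - v n) (fun n => a + v n)).
- by apply: nearW => n; rewrite -ler_distl.
- by rewrite -[X in _ --> X]subr0; apply: cvgB => //; exact: cvg_cst.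
- by rewrite -[X in _ --> X]addr0; apply: cvgD => //; exact: cvg_cst.
Qed.

Lemma cvg_pow0 (x : R) : 1 < x -> (fun n => (x ^- n)) @ \oo --> (0 : R).
Proof.
move=> x1; have -> : (fun n => x ^- n) = (fun n => x^-1 ^+ n).
  by apply/funext => n; rewrite exprVn.
apply: cvg_expr; rewrite ger0_norm ?invr_ge0 ?(le_trans ler01) ?ltW //.
by rewrite invf_lt1 // (lt_trans ltr01).
Qed.

(** Along the powers of two loxodromic matrices, the stretch factor of the
   product divided by the product of the stretch factors tends to the squared
   modulus of the trace of the product of the spectral projectors. *)
Lemma cvg_stretch_pow A B P Q l m :
  spec_mx A l P -> spec_mx B m Q ->
  (fun n => stretch (\tr (pencil P (l ^+ n) (l ^- n) *m pencil Q (m ^+ n) (m ^- n)))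
     / ((normc l * normc m) ^+ 2) ^+ n) @ \oo --> normc (\tr (P *m Q)) ^+ 2.
Proof.
move=> [_ PP tP l1] [_ QQ tQ m1].
have l0 := gt1_neq0 l1; have m0 := gt1_neq0 m1.
set p := \tr (P *m Q); pose D n := ((normc l * normc m) ^+ 2) ^+ n.
pose tau n := \tr (pencil P (l ^+ n) (l ^- n) *m pencil Q (m ^+ n) (m ^- n)).
pose z n := tau n / (l * m) ^+ n.
change ((fun n => stretch (tau n) / D n) @ \oo --> normc p ^+ 2).
have lm1 : 1 < normc l * normc m by rewrite (lt_trans l1) // ltr_pMr // (lt_trans ltr01).
have D0 n : 0 < D n by rewrite !exprn_gt0 // (lt_trans ltr01).
have zE n : z n - p = p * ((l * m) ^- n) ^+ 2 + (1 - p) * ((l ^- n) ^+ 2 + (m ^- n) ^+ 2).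
  rewrite /z /tau mxtrace_pencilM // -/p !exprMn.
  have := expf_neq0 n l0; have := expf_neq0 n m0.
  by move: (l ^+ n) (m ^+ n) => x y y0 x0; field; rewrite x0 y0.
have znorm n : normc (z n) ^+ 2 = normc (tau n) ^+ 2 / D n.
  by rewrite /z normcM normcV exprMn exprVn normcX normcM /D -!exprM mulnC.
have zp : (fun n => normc (z n)) @ \oo --> normc p.
  have zb n : normc (z n - p) <= normc p * ((normc l * normc m) ^- n) +
      normc (1 - p) * (normc l ^- n + normc m ^- n).
    have sq1 (w : C) j : 1 < normc w -> normc ((w ^- j) ^+ 2) <= normc w ^- j.
      move=> w1; rewrite normcX normcV normcX -[X in _ <= X]expr1 ler_wiXn2l //.
        by rewrite invr_ge0 exprn_ge0 // normc_ge0.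
      by rewrite invf_le1 ?exprn_ege1 ?ltW // exprn_gt0 // (lt_trans ltr01).
    rewrite zE (le_trans (le_normcD _ _)) // lerD //.
      rewrite normcM ler_wpM2l ?normc_ge0 //.
      by rewrite -normcM; apply: sq1; rewrite normcM.
    rewrite normcM ler_wpM2l ?normc_ge0 //.
    by rewrite (le_trans (le_normcD _ _)) // lerD // sq1.
  apply: (@cvg_dist_le _ _ _ (fun n => le_trans (normc_dist _ _) (zb n))).
  rewrite -[0]addr0; apply: cvgD.
    by rewrite -(mulr0 (normc p)); apply: cvgMl_tmp; exact: cvg_pow0.
  rewrite -(mulr0 (normc (1 - p))); apply: cvgMl_tmp.
  by rewrite -[0]addr0; apply: cvgD; exact: cvg_pow0.
have Dinv : (fun n => (D n)^-1) @ \oo --> (0 : R).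
  by apply: cvg_pow0; rewrite exprn_egt1.
have zp2 : (fun n => normc (z n) ^+ 2) @ \oo --> normc p ^+ 2.
  by rewrite expr2; under eq_fun do rewrite expr2; exact: cvgM.
have -> : (fun n => stretch (tau n) / D n) =
    (fun n => (stretch (tau n) / D n - normc (z n) ^+ 2) + normc (z n) ^+ 2).
  by apply/funext => n; rewrite subrK.
rewrite -[normc p ^+ 2]add0r; apply: cvgD zp2.
apply: (@cvg_dist_le _ (fun n => 3 * (D n)^-1)) => [n|]; last first.
  by rewrite -(mulr0 3); exact: cvgMl_tmp.
rewrite subr0 znorm -mulrBl normrM [X in _ * X]ger0_norm ?invr_ge0 ?(ltW (D0 n)) //.
by rewrite ler_pM2r ?invr_gt0 ?D0 // stretch_near_normsq.
Qed.

End Asymptotics.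

(** * Proportional stretch factors *)

Section RankOne.
Variable F : fieldType.

Lemma idem_rank1 (Q X : 'M[F]_2) : Q *m Q = Q -> \tr Q = 1 ->
  Q *m X *m Q = \tr (Q *m X) *: Q.
Proof.
elim/mx2_ind: Q => u v w s; elim/mx2_ind: X => a b c d.
rewrite !mx2_simp => /mx2_inj[E _ _ _] tQ.
have -> : s = 1 - u by rewrite -tQ; ring.
congr mx2.
- by apply: (lincomb1 E d); ring.
- by apply: (lincomb1 E (- b)); ring.
- by apply: (lincomb1 E (- c)); ring.
- by apply: (lincomb1 E a); ring.
Qed.

(** The compression of [X] to the image of [Q] is the scalar [tr (Q X)], hence
   [tr (Q M Q M^-1) = tr (Q M) tr (Q M^-1)]. *)
Lemma mxtrace_conj_pencil (P Q M : 'M[F]_2) x : M = pencil P x x^-1 ->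
  P *m P = P -> \tr P = 1 -> Q *m Q = Q -> \tr Q = 1 -> x != 0 ->
  1 - \tr (Q *m (M *m Q *m invmx M)) =
    - (\tr (P *m Q) * (1 - \tr (P *m Q)) * (x - x^-1) ^+ 2).
Proof.
move=> -> PP tP QQ tQ x0; rewrite pencil_inv // !mulmxA idem_rank1 // -scalemxAl mxtraceZ.
have E a b : \tr (Q *m pencil P a b) = a * \tr (P *m Q) + b * (1 - \tr (P *m Q)).
  by rewrite mxtrace_mulC -[Q in X in X = _]pencil10 mxtrace_pencilM //; ring.
rewrite !E; have xy := mulfV x0; move: x^-1 xy => y xy.
by apply: (lincomb1 xy (-1)); ring.
Qed.

End RankOne.

Section Exponent.
Variable R : realType.
Local Notation C := R[i].

(** A complex number all of whose powers have positive real part is positive: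
   otherwise repeated squaring doubles [1 - cos] of the argument until the
   cosine is negative. *)
Lemma Re_pow_gt0_real (w : C) : (forall n, 0 < complex.Re (w ^+ n.+1)) ->
  w = (normc w)%:C.
Proof.
move=> H; have w0 : w != 0.
  by apply/eqP => w0; have := H 0%N; rewrite w0 expr1 ltxx.
pose u := w * (normc w)^-1%:C.
have u1 : normc u = 1.
  by rewrite /u normcM normc_real ger0_norm ?invr_ge0 ?normc_ge0 // divff // normc_eq0.
have ReM (z : C) (x : R) : complex.Re (z * x%:C) = complex.Re z * x.
  by case: z => a b /=; ring.
have uH n : 0 < complex.Re (u ^+ n.+1).
  rewrite /u exprMn -rmorphXn ReM mulr_gt0 ?H // exprn_gt0 // invr_gt0.
  by rewrite normc_gt0.
have step (z : C) : normc z = 1 -> 0 < complex.Re z ->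
    2 * (1 - complex.Re z) <= 1 - complex.Re (z ^+ 2).
  move=> z1; have := normc_sqr z; rewrite z1 expr1n /normsq expr2.
  by case: z z1 => a b _ /= E a0; nra.
have Re1 (z : C) : normc z = 1 -> complex.Re z <= 1.
  move=> z1; have := normc_sqr z; rewrite z1 expr1n /normsq.
  by case: z z1 => a b _ /= E; nra.
have bound n : 2 ^+ n * (1 - complex.Re u) <= 1 - complex.Re (u ^+ (2 ^ n)).
  elim: n => [|n IH]; first by rewrite expr0 mul1r expn0 expr1.
  rewrite exprS -mulrA (le_trans (ler_wpM2l _ IH)) // expnSr exprM.
  apply: step; first by rewrite normcX u1 expr1n.
  by have := uH (2 ^ n).-1; rewrite prednK ?expn_gt0.
have Ru : complex.Re u = 1.
  apply/eqP; rewrite eq_le Re1 //= leNgt; apply/negP => lt1.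
  have d0 : 0 < 1 - complex.Re u by rewrite subr_gt0.
  have [n] : exists n : nat, (1 - complex.Re u)^-1 < n%:R.
    by exists (Num.bound (1 - complex.Re u)^-1); rewrite archi_boundP // invr_ge0 ltW.
  move=> hn; have := bound n.
  have := uH (2 ^ n).-1; rewrite prednK ?expn_gt0 // => r0.
  have n2 : n%:R <= 2 ^+ n :> R by rewrite -natrX ler_nat ltnW // ltn_expl.
  apply/negP; rewrite -ltNge; apply: (@lt_le_trans _ _ 1); first by rewrite ltrBlDr ltrDl.
  by rewrite -ler_pdivrMr // mul1r (le_trans (ltW hn)).
have Iu : complex.Im u = 0.
  have := normc_sqr u; rewrite u1 expr1n /normsq Ru expr1n => E.
  by apply/eqP; rewrite -sqrf_eq0; apply/eqP; move: E; lra.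
have Eu : u = 1 by case: u Ru Iu {u1 uH bound} => a b /= -> ->.
rewrite -[RHS]mul1r -Eu /u -mulrA -rmorphM mulVf ?normc_eq0 //.
by rewrite rmorph1 mulr1.
Qed.

(** Each term of the sum is a strictly decreasing function of [k], and the sum is
   one for [k = 1]. *)
Lemma powR_exponent_unique (x k : R) : 0 < x -> x < 1 ->
  x `^ k + (1 - x) `^ k = 1 -> k = 1.
Proof.
have lt_powR (y a b : R) : 0 < y < 1 -> a < b -> y `^ b < y `^ a.
  move=> /andP[y0 y1] ab; rewrite /powR gt_eqF // ltr_expR ltr_nM2r //.
  by rewrite ln_lt0 // y0.
move=> x0 x1; have xI : 0 < x < 1 by rewrite x0.
have yI : 0 < 1 - x < 1 by rewrite subr_gt0 x1 ltrBlDr ltrDl.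
have Ex : x `^ 1 + (1 - x) `^ 1 = 1.
  by rewrite !powRr1 ?subr_ge0 ?ltW // addrC subrK.
have [kl|kg|//] := ltrgtP k 1; rewrite -[X in _ = X -> _]Ex.
- by move/eqP; rewrite gt_eqF // ltrD // lt_powR.
- by move/eqP; rewrite lt_eqF // ltrD // lt_powR.
Qed.

(** By hypothesis [|1 - w^n| < 1], so every positive power of [w] has positive
   real part; then [w = x^k], and the case [n = 1] reads [1 - x^k = (1 - x)^k]. *)
Lemma exponent_eq1 (w : C) (x k : R) : 0 < k -> 0 < x < 1 -> normc w = x `^ k ->
  (forall n, normc (1 - w ^+ n.+1) = (1 - x ^+ n.+1) `^ k) -> k = 1.
Proof.
move=> k0 /andP[x0 x1] wx H.
have lt1 (y : R) : 0 <= y -> y < 1 -> y `^ k < 1.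
  move=> y0 y1; have := @gt0_ltr_powR _ _ k0 y 1.
  by rewrite powR1 !nnegrE y0 ler01; apply.
have wr : w = (normc w)%:C.
  apply: Re_pow_gt0_real => n.
  have xn0 : 0 < x ^+ n.+1 by rewrite exprn_gt0.
  have xn1 : x ^+ n.+1 < 1 by rewrite exprn_ilt1 // ltW.
  have : normc (1 - w ^+ n.+1) ^+ 2 < 1.
    rewrite exprn_ilt1 ?normc_ge0 // H lt1 //; first by rewrite subr_ge0 ltW.
    by rewrite ltrBlDr ltrDl.
  by rewrite normc_sqr; case: (w ^+ n.+1) => a b; rewrite /normsq /=; nra.
apply: (powR_exponent_unique x0 x1); have := H 0%N; rewrite !expr1 => <-.
have xk1 := lt1 x (ltW x0) x1.
rewrite wr wx -[1]/(1%:C) -rmorphB normc_real ger0_norm ?subr_ge0 ?ltW //.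
by rewrite addrC subrK.
Qed.

End Exponent.

Section Proportional.
Variables (R : realType) (Gamma : groupType).
Local Notation C := R[i].
Implicit Types (l m : C) (A B P Q M N : 'M[C]_2).

(** The image of [g] is loxodromic with dominant eigenvalue [l] (up to sign)
   and spectral projector [P]. *)
Definition spec (rho : Gamma -> PSL2 C) g l P : Prop :=
  exists2 A, mxlift rho g A & spec_mx A l P.

Section OneRepresentation.
Variable rho : Gamma -> PSL2 C.
Hypothesis rhoM : {morph rho : x y / (x * y)%g}.

Lemma mxliftX g l P n : mxlift rho g (pencil P l l^-1) -> P *m P = P ->
  mxlift rho (g ^+ n)%g (pencil P (l ^+ n) (l ^- n)).
Proof.
move=> gP PP; elim: n => [|n IH].
  by rewrite expg0 !expr0 invr1 pencil11; exact: mxlift1.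
by rewrite expgS !exprS invfM -pencilM //; apply: mxliftM.
Qed.

Lemma specV g l P : spec rho g l P -> spec rho g^-1%g l (1%:M - P).
Proof. by case=> A gA S; exists (invmx A); [exact: mxliftV | exact: spec_inv]. Qed.

Lemma specJ g h l P N : mxlift rho h N -> spec rho g l P ->
  spec rho (h * g * h^-1)%g l (N *m P *m invmx N).
Proof.
move=> hN [A gA S]; exists (N *m A *m invmx N); first exact: mxliftJ.
exact: spec_conj (mxlift_unit hN) S.
Qed.

Lemma spec_lift_ex g A : mxlift rho g A -> 1 < stretch (\tr A) ->
  exists l P, spec rho g l P.
Proof.
move=> gA; case/(spec_ex (mxlift_det gA)) => l [P S].
by exists l, P, A.
Qed.

(** Products of projectors have real traces when the matrices do. *)
Lemma spec_trace_real : (forall g A, mxlift rho g A -> complex.Im (\tr A) = 0) ->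
  forall a b l m P Q, spec rho a l P -> spec rho b m Q ->
  complex.Im (\tr (P *m Q)) = 0.
Proof.
move=> real a b l m P Q [A aA SA] [B bB SB].
have := real _ _ aA; have := real _ _ bB; rewrite (mxtrace_spec SA) (mxtrace_spec SB).
case: SA SB aA bB => -> _ tP l1 [-> _ tQ m1] aA bB.
move=> /(eigen_real m1) m0 /(eigen_real l1) l0.
have {l0} El : l = (complex.Re l)%:C by case: l l0 {l1 aA} => x y /= ->.
have {m0} Em : m = (complex.Re m)%:C by case: m m0 {m1 bB} => x y /= ->.
have := real _ _ (mxliftM rhoM aA bB).
have := gt1_neqV l1; have := gt1_neqV m1; move: El Em => -> ->.
move: (complex.Re l) (complex.Re m) => x y; rewrite mxtrace_pencilM //.
move: (\tr _) => p; rewrite -!fmorphV -!rmorphM -!rmorphD -!rmorphB /=.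
have CI z : (z%:C == 0 :> C) = (z == 0) by rewrite (inj_eq (@complexI R)).
rewrite !CI => y0 x0.
case: p => p q /=; rewrite !mul0r !addr0 sub0r => E.
have : (x - x^-1) * (y - y^-1) * q = 0 by rewrite -E; ring.
by move/eqP; rewrite !mulf_eq0 (negPf x0) (negPf y0) => /eqP.
Qed.

End OneRepresentation.

Lemma powRV (x k : R) : 0 <= x -> (x^-1) `^ k = (x `^ k)^-1.
Proof. by move=> x0; rewrite -powR_inv1 // powRAC powR_inv1 // powR_ge0. Qed.

Lemma powRX (x k : R) n : 0 <= x -> (x ^+ n) `^ k = (x `^ k) ^+ n.
Proof. by move=> x0; rewrite -powR_mulrn // powRAC powR_mulrn // powR_ge0. Qed.

Lemma sqr_inj (x y : R) : 0 <= x -> 0 <= y -> x ^+ 2 = y ^+ 2 -> x = y.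
Proof. by move=> x0 y0 /eqP; rewrite eqrXn2 // => /eqP. Qed.

Variables (rho rho1 : Gamma -> PSL2 C) (k : R).
Hypothesis rhoM : {morph rho : x y / (x * y)%g}.
Hypothesis rho1M : {morph rho1 : x y / (x * y)%g}.
Hypothesis k0 : 0 < k.
Hypothesis stretchE : forall g A A1, mxlift rho g A -> mxlift rho1 g A1 ->
  stretch (\tr A) = stretch (\tr A1) `^ k.

Lemma spec_modulus g l l1 P P1 : spec rho g l P -> spec rho1 g l1 P1 ->
  normc l = normc l1 `^ k.
Proof.
move=> [A gA S] [A1 gA1 S1]; have := stretchE gA gA1.
rewrite (stretch_spec S) (stretch_spec S1) powRX ?normc_ge0 //.
by apply: sqr_inj; rewrite ?normc_ge0 ?powR_ge0.
Qed.

Lemma spec_transfer g l P : spec rho g l P -> exists l1 P1, spec rho1 g l1 P1.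
Proof.
move=> [A gA S]; have [A1 gA1] := mxlift_ex rho1 g.
apply: (spec_lift_ex gA1); rewrite lt_def stretch_ge1 andbT.
apply/negP => /eqP E; have := stretchE gA gA1; rewrite E powR1 (stretch_spec S).
by move/eqP; rewrite gt_eqF // exprn_egt1 //; case: S.
Qed.

(** By the limit of the stretch factors of [a^n b^n] in both representations. *)
Lemma spec_trace a b l l1 m m1 P P1 Q Q1 :
  spec rho a l P -> spec rho1 a l1 P1 -> spec rho b m Q -> spec rho1 b m1 Q1 ->
  normc (\tr (P *m Q)) = normc (\tr (P1 *m Q1)) `^ k.
Proof.
move=> sa sa1 sb sb1.
have la := spec_modulus sa sa1; have lb := spec_modulus sb sb1.
case: sa sa1 sb sb1 => [A aA SA] [A1 aA1 SA1] [B bB SB] [B1 bB1 SB1].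
have c := cvg_stretch_pow SA SB; have c1 := cvg_stretch_pow SA1 SB1.
apply: sqr_inj; rewrite ?normc_ge0 ?powR_ge0 // -powRX ?normc_ge0 //.
have {c1} c1 := cvg_powR k0 (sqr_ge0 _) _ c1.
apply: (cvg_unique (@Rhausdorff R) c); apply: cvg_trans (c1 _); last first.
  move=> n; apply: divr_ge0; first exact: le_trans (stretch_ge1 _).
  by rewrite !exprn_ge0 // mulr_ge0 // normc_ge0.
apply: near_eq_cvg; apply: nearW => n.
have s0 t : 0 <= stretch t :> R by rewrite (le_trans ler01) ?stretch_ge1.
have lm0 : 0 <= normc l1 * normc m1 by rewrite mulr_ge0 // normc_ge0.
rewrite powRM ?s0 // ?invr_ge0 ?exprn_ge0 //.
case: SA SA1 SB SB1 aA aA1 bB bB1 => -> PP _ _ [-> PP1 _ _] [-> QQ _ _] [-> QQ1 _ _].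
move=> aA aA1 bB bB1.
rewrite -(stretchE (mxliftM rhoM (mxliftX rhoM n aA PP) (mxliftX rhoM n bB QQ))
  (mxliftM rho1M (mxliftX rho1M n aA1 PP1) (mxliftX rho1M n bB1 QQ1))).
congr (_ * _); rewrite la lb -powRM ?normc_ge0 // -powRX //.
by rewrite powRV ?powRX // ?exprn_ge0.
Qed.

Hypothesis rho1_real :
  forall g A, mxlift rho1 g A -> complex.Im (\tr A) = 0.

Lemma spec_eigen_real g l P : spec rho1 g l P -> exists x : R, l = x%:C.
Proof.
move=> [A gA S]; have := rho1_real gA; rewrite (mxtrace_spec S).
case: S => _ _ _ l1 /(eigen_real l1); case: l {l1} => x y /= ->.
by exists x.
Qed.

Lemma spec_trace_compl a b l l1 m m1 P P1 Q Q1 :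
  spec rho a l P -> spec rho1 a l1 P1 -> spec rho b m Q -> spec rho1 b m1 Q1 ->
  normc (1 - \tr (P *m Q)) = normc (1 - \tr (P1 *m Q1)) `^ k.
Proof.
move=> sa sa1 sb sb1.
have := spec_trace sa sa1 (specV rhoM sb) (specV rho1M sb1).
case: sa sa1 => [A _ [_ _ tP _]] [A1 _ [_ _ tP1 _]].
by rewrite !mulmxBr !mulmx1 !mxtraceB tP tP1.
Qed.

(** By [spec_trace_compl] for [b] and [a^n b a^-n], whose projectors satisfy
   [1 - tr (Q M Q M^-1) = - p (1 - p) (l^n - l^-n)^2] with [p = tr (P Q)]. *)
Lemma eigen_diff a b l l1 m m1 P P1 Q Q1 n :
  spec rho a l P -> spec rho1 a l1 P1 -> spec rho b m Q -> spec rho1 b m1 Q1 ->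
  \tr (P *m Q) != 0 -> \tr (P *m Q) != 1 ->
  normc (l ^+ n - l ^- n) = normc (l1 ^+ n - l1 ^- n) `^ k.
Proof.
move=> sa sa1 sb sb1 p0 p1.
have E := spec_trace sa sa1 sb sb1; have E' := spec_trace_compl sa sa1 sb sb1.
have [A aA [EA PP tP lt]] := sa; have [A1 aA1 [EA1 PP1 tP1 lt1]] := sa1.
have [B _ [_ QQ tQ _]] := sb; have [B1 _ [_ QQ1 tQ1 _]] := sb1.
rewrite {}EA in aA; rewrite {}EA1 in aA1.
have [M EM aN] : exists2 M, M = pencil P (l ^+ n) (l ^- n) & mxlift rho (a ^+ n)%g M.
  by exists (pencil P (l ^+ n) (l ^- n)); [reflexivity | exact (mxliftX rhoM n aA PP)].
have [M1 EM1 aN1] :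
    exists2 M, M = pencil P1 (l1 ^+ n) (l1 ^- n) & mxlift rho1 (a ^+ n)%g M.
  by exists (pencil P1 (l1 ^+ n) (l1 ^- n)); [reflexivity | exact (mxliftX rho1M n aA1 PP1)].
have := spec_trace_compl sb sb1 (specJ rhoM aN sb) (specJ rho1M aN1 sb1).
have l0 := expf_neq0 n (gt1_neq0 lt); have l10 := expf_neq0 n (gt1_neq0 lt1).
rewrite (mxtrace_conj_pencil EM PP tP QQ tQ l0).
rewrite (mxtrace_conj_pencil EM1 PP1 tP1 QQ1 tQ1 l10).
rewrite !normcN !normcM E E' -!expr2.
rewrite (powRM _ (mulr_ge0 (normc_ge0 _) (normc_ge0 _)) (sqr_ge0 _)).
rewrite (powRM _ (normc_ge0 _) (normc_ge0 _)) (powRX _ _ (normc_ge0 _)).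
move/mulfI => H; apply: sqr_inj; rewrite ?normc_ge0 ?powR_ge0 //.
by apply: H; rewrite -E -E' mulf_neq0 // normc_eq0 // subr_eq0 eq_sym.
Qed.

(** [eigen_diff] is [exponent_eq1] for [w = l^-2] and [x = l1^-2], after division
   by [|l|^n = |l1|^(n k)]. *)
Lemma exponent_one a b l m P Q : spec rho a l P -> spec rho b m Q ->
  \tr (P *m Q) != 0 -> \tr (P *m Q) != 1 -> k = 1.
Proof.
move=> sa sb p0 p1.
have [l1 [P1 sa1]] := spec_transfer sa; have [m1 [Q1 sb1]] := spec_transfer sb.
have [x Ex] := spec_eigen_real sa1; have ll := spec_modulus sa sa1.
have H n := eigen_diff n sa sa1 sb sb1 p0 p1.
have [_ _ [_ _ _ lt]] := sa; have [_ _ [_ _ _ lt1]] := sa1.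
have fact (z : C) n : 1 < normc z ->
    normc (z ^+ n - z ^- n) = normc z ^+ n * normc (1 - (z ^- 2) ^+ n).
  move=> /gt1_neq0 z0; rewrite -normcX -normcM exprVn -exprM mulnC exprM.
  by congr normc; have := expf_neq0 n z0; move: (z ^+ n) => y y0; field.
have x2 : 1 < x ^+ 2 by rewrite -real_normK ?num_real // exprn_egt1 // -normc_real -Ex.
have x20 : 0 < x ^+ 2 by rewrite (lt_trans ltr01).
apply: (@exponent_eq1 _ (l ^- 2) (x ^- 2)) => //.
- by rewrite invr_gt0 x20 invf_lt1.
- rewrite normcV normcX ll -powRX ?normc_ge0 // -powRV ?sqr_ge0 //.
  by rewrite Ex normc_real real_normK ?num_real.
- move=> n; have := H n.+1; rewrite !fact // powRM ?exprn_ge0 ?normc_ge0 //.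
  rewrite powRX ?normc_ge0 // ll => /mulfI ->.
    rewrite Ex -rmorphXn -fmorphV -rmorphXn -(rmorph1 (real_complex R)) -rmorphB.
    rewrite normc_real ger0_norm // subr_ge0 exprn_ile1 ?invr_ge0 ?(ltW x20) //.
    by rewrite invf_le1 // ltW.
  by rewrite expf_neq0 // gt_eqF // powR_gt0 // (lt_trans ltr01).
Qed.

(** With exponent one, the traces of the products of two projectors agree: they
   are determined by the moduli of [p] and [1 - p] as soon as [p] is real. *)
Lemma spec_trace_eq a b l l1 m m1 P P1 Q Q1 : k = 1 ->
  spec rho a l P -> spec rho1 a l1 P1 -> spec rho b m Q -> spec rho1 b m1 Q1 ->
  \tr (P *m Q) = \tr (P1 *m Q1).
Proof.
move=> k1 sa sa1 sb sb1.
have := spec_trace sa sa1 sb sb1; have := spec_trace_compl sa sa1 sb sb1.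
rewrite k1 !powRr1 ?normc_ge0 //.
have := spec_trace_real rho1M rho1_real sa1 sb1.
move: (\tr _) (\tr _) => p q q0 /(congr1 (fun x => x ^+ 2)) + /(congr1 (fun x => x ^+ 2)).
rewrite !normc_sqr; case: p q q0 => [a1 a2] [b1 b2] /= ->.
rewrite /normsq /= => E E'.
have Ea : a1 = b1 by move: E E'; nra.
have /eqP : a2 ^+ 2 = 0 by move: E'; rewrite Ea; lra.
by rewrite sqrf_eq0 Ea => /eqP ->.
Qed.

End Proportional.

(** * Pairs of projectors *)

Section Pairs.
Variable F : fieldType.
Implicit Types (P Q V X T : 'M[F]_2).

(** A projector of rank one has a nonzero vector in its image. *)
Lemma idem_vector P : P *m P = P -> \tr P = 1 ->
  exists x y, [/\ (x != 0) || (y != 0), P 0 0 * x + P 0 1 * y = x &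
    P 1 0 * x + P 1 1 * y = y].
Proof.
elim/mx2_ind: P => u v w s; rewrite !mx2_simp !mx2E => /mx2_inj[E _ _ _] t.
have Es : s = 1 - u by rewrite -t; ring.
have [u0|u0] := eqVneq u 0; last first.
  exists u, w; rewrite u0; split=> //.
  by rewrite Es; ring.
exists v, 1; rewrite oner_neq0 orbT Es u0; split=> //; first by ring.
by apply: (lincomb1 E 1); rewrite u0; ring.
Qed.

(** Two projectors of rank one without common eigenvector are determined, up to
   simultaneous conjugation, by the trace of their product. *)
Lemma pair_normal_form P Q p :
  P *m P = P -> \tr P = 1 -> Q *m Q = Q -> \tr Q = 1 ->
  \tr (P *m Q) = p -> p != 0 -> p != 1 ->
  exists V, [/\ V \in unitmx, P *m V = V *m mx2 1 0 0 0 &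
    Q *m V = V *m mx2 p 1 (p * (1 - p)) (1 - p)].
Proof.
move=> PP tP QQ tQ Ep p0 p1.
have [x [y [xy0 e1 e2]]] := idem_vector PP tP.
have PQP := idem_rank1 Q PP tP; rewrite {}Ep in PQP.
have q0 : 1 - p != 0 by rewrite subr_eq0 eq_sym.
move: QQ tQ PQP e1 e2 {PP tP}.
elim/mx2_ind: P => u v w s; elim/mx2_ind: Q => a b c d.
rewrite !mx2_simp !mx2E => /mx2_inj[Q1 Q2 Q3 Q4] tQ /mx2_inj[R1 R2 R3 R4] e1 e2.
(* [P (Q v) = p v] for the chosen vector [v = (x, y)] *)
have f1 : u * (a * x + b * y) + v * (c * x + d * y) = p * x.
  by apply: (lincomb4 R1 x R2 y e1 (p - (u * a + v * c)) e2 (- (u * b + v * d))); ring.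
have f2 : w * (a * x + b * y) + s * (c * x + d * y) = p * y.
  by apply: (lincomb4 R3 x R4 y e1 (- (w * a + s * c)) e2 (p - (w * b + s * d))); ring.
pose k := (p * (1 - p))^-1.
have kp : k * (p * (1 - p)) = 1 by rewrite mulVf // mulf_neq0.
pose x' := k * (a * x + b * y - p * x); pose y' := k * (c * x + d * y - p * y).
have k0 : k != 0 by rewrite invr_eq0 mulf_neq0.
have D0 : x * y' - x' * y != 0.
  apply/eqP => /eqP.
  have -> : x * y' - x' * y = k * (x * (c * x + d * y) - y * (a * x + b * y)).
    by rewrite /x' /y'; ring.
  rewrite mulf_eq0 (negPf k0) subr_eq0 => /eqP par.
  have [E1 E2] : a * x + b * y = p * x /\ c * x + d * y = p * y.
    case/orP: xy0 => n0; split; apply: (mulfI n0).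
    - by apply: (lincomb3 f1 x par (- v) e1 (- (a * x + b * y))); ring.
    - by apply: (lincomb3 f1 y par u e1 (- (c * x + d * y))); ring.
    - by apply: (lincomb3 f2 x par (- s) e2 (- (a * x + b * y))); ring.
    - by apply: (lincomb3 f2 y par w e2 (- (c * x + d * y))); ring.
  have pq0 z : p * (1 - p) * z = 0 -> z = 0.
    by move/eqP; rewrite !mulf_eq0 (negPf p0) (negPf q0) => /eqP.
  case/orP: xy0 => /eqP; apply; apply: pq0.
  - by apply: (lincomb4 Q1 (- x) Q2 (- y) E1 (a + p - 1) E2 b); ring.
  - by apply: (lincomb4 Q3 (- x) Q4 (- y) E1 c E2 (d + p - 1)); ring.
exists (mx2 x x' y y'); split.
- by rewrite unitmxE det_mx2 unitfE.
- rewrite !mx2_simp; congr mx2; rewrite ?mulr1 ?mulr0 ?addr0 //.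
  + apply: (lincomb2 f1 k e1 (- (k * p))); rewrite /x' /y'; ring.
  + apply: (lincomb2 f2 k e2 (- (k * p))); rewrite /x' /y'; ring.
- rewrite !mx2_simp; congr mx2; rewrite ?mulr1 ?mulr0 ?addr0 //.
  + apply: (lincomb1 kp (- (a * x + b * y - p * x))); rewrite /x' /y'; ring.
  + apply: (lincomb3 Q1 (k * x) Q2 (k * y) kp x); rewrite /x' /y'; ring.
  + apply: (lincomb1 kp (- (c * x + d * y - p * y))); rewrite /x' /y'; ring.
  + apply: (lincomb3 Q3 (k * x) Q4 (k * y) kp y); rewrite /x' /y'; ring.
Qed.

Lemma mxtrace_basis V T X X' : V \in unitmx -> X *m V = V *m X' ->
  \tr (T *m X) = \tr (invmx V *m T *m V *m X').
Proof.
move=> UV E; have -> : X = V *m X' *m invmx V by rewrite -E mulmxK.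
by rewrite !mulmxA mxtrace_mulC !mulmxA.
Qed.

Lemma pencil_basis P V x y : V \in unitmx -> P *m V = V *m mx2 1 0 0 0 ->
  pencil P x y *m V = V *m mx2 x 0 0 y.
Proof.
move=> UV E; rewrite /pencil mulmxDl -!scalemxAl mulmxBl mul1mx E.
rewrite -[X in _ *: (X - _)]mulmx1 -mulmxBr !scalemxAr -mulmxDr; congr (_ *m _).
by rewrite !mx2_simp; congr mx2; ring.
Qed.

(** A matrix is determined by its traces against the identity, two projectors in
   general position and one suitable conjugate of the second projector. *)
Lemma pair_separates P Q T l :
  P *m P = P -> \tr P = 1 -> Q *m Q = Q -> \tr Q = 1 ->
  \tr (P *m Q) != 0 -> \tr (P *m Q) != 1 -> l != 0 -> l * l - l^-1 * l^-1 != 0 ->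
  \tr T = 0 -> \tr (T *m P) = 0 -> \tr (T *m Q) = 0 ->
  \tr (T *m (pencil P l l^-1 *m Q *m invmx (pencil P l l^-1))) = 0 -> T = 0.
Proof.
move=> PP tP QQ tQ p0 p1 l0 l4.
have [V [UV EP EQ]] := pair_normal_form PP tP QQ tQ erefl p0 p1.
rewrite pencil_inv //.
have EN : pencil P l l^-1 *m Q *m pencil P l^-1 l *m V =
    V *m (mx2 l 0 0 l^-1 *m
      mx2 (\tr (P *m Q)) 1 (\tr (P *m Q) * (1 - \tr (P *m Q))) (1 - \tr (P *m Q)) *m
      mx2 l^-1 0 0 l).
  rewrite -mulmxA (pencil_basis _ _ UV EP) mulmxA -(mulmxA _ Q) EQ mulmxA.
  by rewrite (pencil_basis _ _ UV EP) !mulmxA.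
have q0 : 1 - \tr (P *m Q) != 0 by rewrite subr_eq0 eq_sym.
rewrite (mxtrace_basis T UV EP) (mxtrace_basis T UV EQ) (mxtrace_basis T UV EN).
have T1 : T *m 1%:M = T by rewrite mulmx1.
have E1 : 1%:M *m V = V *m 1%:M by rewrite mulmx1 mul1mx.
rewrite -{1}T1 (mxtrace_basis T UV E1) mulmx1.
have ET : T = V *m (invmx V *m T *m V) *m invmx V
  by rewrite !mulmxA mulmxK // mulmxV // mul1mx.
rewrite {}[T in _ -> T = 0]ET {EN T1 EP EQ E1}.
move: (\tr (P *m Q)) (invmx V *m T *m V) p0 q0 => p; elim/mx2_ind => a b c d p0 q0.
rewrite !mx2_simp => H1 H2 H3 H4.
have a0 : a = 0 by rewrite -H2; ring.
have d0 : d = 0 by rewrite -H1 a0; ring.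
have lm : l * l^-1 = 1 by rewrite mulfV.
have b0 : b = 0.
  have : (l * l - l^-1 * l^-1) * (p * (1 - p)) * b = 0.
    move: l^-1 lm H4 => m lm H4.
    by apply: (lincomb4 H3 (l * l) H4 (-1) a0 (l * m * p - l * l * p)
      d0 (m * l * (1 - p) - l * l * (1 - p))); ring.
  by move/eqP; rewrite !mulf_eq0 (negPf l4) (negPf p0) (negPf q0) => /eqP.
have c0 : c = 0 by move: H3; rewrite a0 b0 d0 => <-; ring.
by rewrite a0 b0 c0 d0 -mx2_0 mulmx0 mul0mx.
Qed.

(** A matrix that commutes with two projectors in general position is scalar. *)
Lemma pair_commutant P Q X :
  P *m P = P -> \tr P = 1 -> Q *m Q = Q -> \tr Q = 1 ->
  \tr (P *m Q) != 0 -> \tr (P *m Q) != 1 ->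
  X *m P = P *m X -> X *m Q = Q *m X -> exists c, X = c%:M.
Proof.
move=> PP tP QQ tQ p0 p1 XP XQ.
have [V [UV EP EQ]] := pair_normal_form PP tP QQ tQ erefl p0 p1.
have comm Y Y' : Y *m V = V *m Y' -> X *m Y = Y *m X ->
    (invmx V *m X *m V) *m Y' = Y' *m (invmx V *m X *m V).
  move=> EY XY; have -> : Y' = invmx V *m Y *m V by rewrite -mulmxA EY mulKmx.
  by rewrite !mulmxA mulmxK // -(mulmxA (invmx V)) XY mulmxA mulmxK // .
have := comm _ _ EQ XQ; have := comm _ _ EP XP.
have ET : X = V *m (invmx V *m X *m V) *m invmx V
  by rewrite !mulmxA mulmxK // mulmxV // mul1mx.
rewrite {}[X in exists c, X = _]ET {EP EQ comm}.
move: (invmx V *m X *m V); elim/mx2_ind => a b c d.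
rewrite !mx2_simp => /mx2_inj[_ E1 E2 _] /mx2_inj[_ E3 _ _].
exists a; have b0 : b = 0.
  by rewrite -[b]mul1r -[RHS](mulr0 a) -[a * 0]addr0 -[X in _ = _ + X](mulr0 b) E1; ring.
have c0 : c = 0 by move: E2; rewrite !mulr1 !mulr0 !mul0r !addr0 => ->.
have ad : d = a by move: E3; rewrite b0; move=> E3; apply: (lincomb1 E3 (-1)); ring.
rewrite b0 c0 ad; have -> : mx2 a 0 0 a = a%:M.
  by rewrite -scalemx1 !mx2_simp !mulr0 !mulr1.
by rewrite scalar_mxC mulmxK.
Qed.

End Pairs.

Section Intertwiner.
Variable R : realType.
Local Notation C := R[i].

(** The conjugating matrix between the two normal forms, divided by a square root
   of its determinant. *)
Lemma pair_intertwiner (P Q P1 Q1 : 'M[C]_2) :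
  P *m P = P -> \tr P = 1 -> Q *m Q = Q -> \tr Q = 1 ->
  P1 *m P1 = P1 -> \tr P1 = 1 -> Q1 *m Q1 = Q1 -> \tr Q1 = 1 ->
  \tr (P *m Q) = \tr (P1 *m Q1) -> \tr (P *m Q) != 0 -> \tr (P *m Q) != 1 ->
  exists H : SL2 C, H *m P1 *m invmx H = P /\ H *m Q1 *m invmx H = Q.
Proof.
move=> PP tP QQ tQ PP1 tP1 QQ1 tQ1 E p0 p1.
have [V [UV EP EQ]] := pair_normal_form PP tP QQ tQ erefl p0 p1.
have [V1 [UV1 EP1 EQ1]] := pair_normal_form PP1 tP1 QQ1 tQ1 (esym E) p0 p1.
pose h := V *m invmx V1.
have Uh : h \in unitmx by rewrite unitmx_mul UV unitmx_inv.
pose s := sqrtc (\det h).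
have s2 : s ^+ 2 = \det h by rewrite sqr_sqrtc.
have d0 : \det h != 0 by rewrite -unitfE -unitmxE.
have s0 : s != 0 by apply: contra d0 => /eqP s0; rewrite -s2 s0 expr0n.
have d1 : \det (s^-1 *: h) == 1 by rewrite detZ exprVn s2 mulVf.
have inter Y Y1 Y' : Y *m V = V *m Y' -> Y1 *m V1 = V1 *m Y' -> h *m Y1 = Y *m h.
  move=> EY EY1; have -> : Y1 = V1 *m Y' *m invmx V1 by rewrite -EY1 mulmxK.
  by rewrite /h !mulmxA mulmxKV // EY.
exists (MkSL2 d1) => /=.
have Us : s^-1 *: h \in unitmx by rewrite unitmxE (eqP d1) unitr1.
split; rewrite -scalemxAl; [rewrite (inter _ _ _ EP EP1)|rewrite (inter _ _ _ EQ EQ1)].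
all: by rewrite scalemxAr mulmxK.
Qed.

End Intertwiner.

(** * Equality of stretch factors implies conjugacy *)

Section ConjugatePencil.
Variable F : fieldType.
Implicit Types (P Q M N : 'M[F]_2) (l : F).

Lemma conj_eq_comm (G G1 Y : 'M[F]_2) : G \in unitmx -> G1 \in unitmx ->
  G *m Y *m invmx G = G1 *m Y *m invmx G1 ->
  (invmx G1 *m G) *m Y = Y *m (invmx G1 *m G).
Proof.
move=> UG UG1 E; have EY : G *m Y = G1 *m Y *m invmx G1 *m G by rewrite -E mulmxKV.
by rewrite -mulmxA EY !mulmxA mulVmx // mul1mx.
Qed.

Lemma pencilN P x y : pencil P (- x) (- y) = - pencil P x y.
Proof. by rewrite /pencil !scaleNr opprD. Qed.

(** The trace of [Q M Q M^-1] determines the eigenvalue of [M] up to sign and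
   inversion. *)
Lemma conj_pencil_eigen P Q M M1 l l1 :
  M = pencil P l l^-1 -> M1 = pencil P l1 l1^-1 ->
  P *m P = P -> \tr P = 1 -> Q *m Q = Q -> \tr Q = 1 ->
  \tr (P *m Q) != 0 -> \tr (P *m Q) != 1 -> l != 0 -> l1 != 0 ->
  \tr (Q *m (M *m Q *m invmx M)) = \tr (Q *m (M1 *m Q *m invmx M1)) ->
  [\/ l = l1, l = - l1, l * l1 = 1 | l * l1 = - 1].
Proof.
move=> EM EM1 PP tP QQ tQ p0 p1 l0 l10 /(congr1 (fun x => 1 - x)).
rewrite (mxtrace_conj_pencil EM PP tP QQ tQ l0).
rewrite (mxtrace_conj_pencil EM1 PP tP QQ tQ l10) => /oppr_inj/mulfI H.
have {}H : (l - l^-1) ^+ 2 = (l1 - l1^-1) ^+ 2.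
  by apply: H; rewrite mulf_neq0 // subr_eq0 eq_sym.
have : (l - l1) * (l + l1) * (l * l1 - 1) * (l * l1 + 1) = 0.
  have -> : (l - l1) * (l + l1) * (l * l1 - 1) * (l * l1 + 1) =
    (l * l1) ^+ 2 * ((l - l^-1) ^+ 2 - (l1 - l1^-1) ^+ 2) by field; rewrite l0 l10.
  by rewrite H subrr mulr0.
move/eqP; rewrite !mulf_eq0 !subr_eq0 !addr_eq0 => /orP[/orP[/orP[]|]|] /eqP ->.
- by constructor 1.
- by constructor 2.
- by constructor 3.
- by constructor 4.
Qed.

Lemma conj_pencil_sign P Q M M1 l l1 :
  M = pencil P l l^-1 -> M1 = pencil P l1 l1^-1 -> P *m P = P -> l1 != 0 ->
  l = l1 \/ l = - l1 -> M *m Q *m invmx M = M1 *m Q *m invmx M1.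
Proof.
move=> -> -> PP l10 [->//|->].
rewrite !pencil_inv ?oppr_eq0 // invrN !pencilN.
by rewrite mulNmx mulmxN mulNmx opprK.
Qed.

End ConjugatePencil.

Section Rigidity.
Variables (R : realType) (Gamma : groupType).
Local Notation C := R[i].
Implicit Types (l m : C) (A B P Q M N D : 'M[C]_2) (rho : Gamma -> PSL2 C).

Lemma mulr_neq_sign l l1 : 1 < normc l -> 1 < normc l1 -> (l * l1 != 1) && (l * l1 != -1).
Proof.
move=> h h1; have H : 1 < normc (l * l1).
  by rewrite normcM (lt_trans h) // ltr_pMr // (lt_trans ltr01).
by apply/andP; split; apply: contraTneq H => ->; rewrite ?normcN normc1 ltxx.
Qed.

Lemma gt1_neqV2 l : 1 < normc l -> l * l - l^-1 * l^-1 != 0.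
Proof.
move=> h; have := gt1_neqV h.
have -> : l * l - l^-1 * l^-1 = (l - l^-1) * (l + l^-1) by ring.
move=> n; rewrite mulf_neq0 //; apply/eqP => /(congr1 (fun x => l * x)).
rewrite mulrDr mulr0 mulfV ?gt1_neq0 // => /eqP; rewrite addr_eq0.
by case/andP: (mulr_neq_sign h h) => _ /negPf ->.
Qed.

Section Normalized.
Variables rho rho1 : Gamma -> PSL2 C.
Hypothesis rhoM : {morph rho : x y / (x * y)%g}.
Hypothesis rho1M : {morph rho1 : x y / (x * y)%g}.
Hypothesis stretchE : forall g A A1, mxlift rho g A -> mxlift rho1 g A1 ->
  stretch (\tr A) = stretch (\tr A1).
Hypothesis rho1_real :
  forall g A, mxlift rho1 g A -> complex.Im (\tr A) = 0.

Let stretchE1 g A A1 : mxlift rho g A -> mxlift rho1 g A1 ->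
  stretch (\tr A) = stretch (\tr A1) `^ 1.
Proof.
move=> gA gA1; rewrite (powRr1 (le_trans ler01 (stretch_ge1 _))).
exact (stretchE gA gA1).
Qed.

(** Two representations with the same stretch factors, one of them with real
   traces, coincide if they give the same projectors, in general position, to two
   elements: they then give the same projector to every loxodromic element, in
   particular to the conjugates of [a] and [b] by [g], which determine the image
   of [g]. *)
Lemma rigid_normalized a b l l1 m m1 P Q :
  spec rho a l P -> spec rho1 a l1 P -> spec rho b m Q -> spec rho1 b m1 Q ->
  \tr (P *m Q) != 0 -> \tr (P *m Q) != 1 -> rho =1 rho1.
Proof.
move=> sa sa1 sb sb1 p0 p1.
have traceE := spec_trace_eq rhoM rho1M ltr01 stretchE1 rho1_real erefl.
have [A aA [EA PP tP lt]] := sa; have [A1 aA1 [EA1 _ _ lt1]] := sa1.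
have [B _ [_ QQ tQ _]] := sb.
have l0 := gt1_neq0 lt; have l10 := gt1_neq0 lt1.
have sc := specJ rhoM aA sb; have sc1 := specJ rho1M aA1 sb1.
have El : l = l1 \/ l = - l1.
  have := traceE _ _ _ _ _ _ _ _ _ _ sb sb1 sc sc1.
  (* [l * l1] has modulus greater than one, so it is neither 1 nor -1 *)
  case/(conj_pencil_eigen EA EA1 PP tP QQ tQ p0 p1 l0 l10); [by left | by right | |].
  - by case/andP: (mulr_neq_sign lt lt1) => /eqP.
  - by case/andP: (mulr_neq_sign lt lt1) => _ /eqP.
have EQ' := conj_pencil_sign Q EA EA1 PP l10 El.
rewrite -EQ' in sc1.
(* all corresponding projectors coincide *)
have projE d n n1 D D1 : spec rho d n D -> spec rho1 d n1 D1 -> D = D1.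
  move=> sd sd1; have tD : \tr D = 1 by case: sd => [? _ []].
  have tD1 : \tr D1 = 1 by case: sd1 => [? _ []].
  have eP := traceE _ _ _ _ _ _ _ _ _ _ sd sd1 sa sa1.
  have eQ := traceE _ _ _ _ _ _ _ _ _ _ sd sd1 sb sb1.
  have eQ' := traceE _ _ _ _ _ _ _ _ _ _ sd sd1 sc sc1.
  rewrite EA in eQ'.
  apply/eqP; rewrite -subr_eq0; apply/eqP.
  apply: (pair_separates PP tP QQ tQ p0 p1 l0 (gt1_neqV2 lt)).
  - by rewrite mxtraceB tD tD1 subrr.
  - by rewrite mulmxBl mxtraceB eP subrr.
  - by rewrite mulmxBl mxtraceB eQ subrr.
  - by rewrite mulmxBl mxtraceB eQ' subrr.
move=> g; have [G gG] := mxlift_ex rho g; have [G1 gG1] := mxlift_ex rho1 g.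
have UG := mxlift_unit gG; have UG1 := mxlift_unit gG1.
have eP := projE _ _ _ _ _ (specJ rhoM gG sa) (specJ rho1M gG1 sa1).
have eQ := projE _ _ _ _ _ (specJ rhoM gG sb) (specJ rho1M gG1 sb1).
have [c Ec] := pair_commutant PP tP QQ tQ p0 p1 (conj_eq_comm UG UG1 eP)
  (conj_eq_comm UG UG1 eQ).
have EG : G = c *: G1 by rewrite -mul_mx_scalar -Ec mulKVmx.
have c2 : (c == 1) || (c == -1).
  have := mxlift_det gG; rewrite EG detZ (mxlift_det gG1) mulr1 => /eqP.
  by rewrite sqrf_eq1.
case/orP: c2 => /eqP E; rewrite E in EG.
- by rewrite scale1r in EG; rewrite EG in gG; exact: mxlift_inj gG gG1.
- rewrite scaleN1r in EG; have gG' := mxliftN gG1; rewrite -EG in gG'.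
  exact: mxlift_inj gG gG'.
Qed.

End Normalized.

(** The representation [rho] conjugated by the class of [H]. *)
Definition conj_rep (H : SL2 C) rho : Gamma -> PSL2 C :=
  fun g => (\pi_(PSL2 C) H * rho g * (\pi_(PSL2 C) H)^-1)%g.

Lemma conj_repM H rho : {morph rho : x y / (x * y)%g} ->
  {morph conj_rep H rho : x y / (x * y)%g}.
Proof. by move=> rhoM x y; rewrite /conj_rep rhoM !mulgA mulgVK. Qed.

Lemma mxlift_conj H rho g M : mxlift rho g M ->
  mxlift (conj_rep H rho) g (H *m M *m invmx H).
Proof.
case=> A EA <-; exists (H * A * H^-1)%g => //.
by rewrite /conj_rep -EA pi_PSL2V !pi_PSL2M.
Qed.

Lemma spec_conj_rep H rho g l P : spec rho g l P ->
  spec (conj_rep H rho) g l (H *m P *m invmx H).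
Proof.
case=> A gA S; exists (H *m A *m invmx H); first exact: mxlift_conj.
exact: spec_conj (SL2_unit H) S.
Qed.

Lemma mxlift_conj_trace H rho g M : mxlift (conj_rep H rho) g M ->
  exists2 N, mxlift rho g N & (\tr M = \tr N \/ \tr M = - \tr N).
Proof.
move=> gM; have [N gN] := mxlift_ex rho g; exists N => //.
case: (mxlift_sign (mxlift_conj H gN) gM) => ->; [left | right].
- by rewrite mxtraceJ // SL2_unit.
- by rewrite linearN /= mxtraceJ // SL2_unit.
Qed.

(** A representation whose stretch factors are powers of those of a representation
   with real traces, and which has two loxodromic elements in general position,
   is conjugate to it, and the exponent is one. *)
Lemma rigidity rho rho1 k a b l m P Q :
  {morph rho : x y / (x * y)%g} -> {morph rho1 : x y / (x * y)%g} -> 0 < k ->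
  (forall g A A1, mxlift rho g A -> mxlift rho1 g A1 ->
    stretch (\tr A) = stretch (\tr A1) `^ k) ->
  (forall g A, mxlift rho1 g A -> complex.Im (\tr A) = 0) ->
  spec rho a l P -> spec rho b m Q ->
  \tr (P *m Q) != 0 -> \tr (P *m Q) != 1 ->
  k = 1 /\ exists H, rho =1 conj_rep H rho1.
Proof.
move=> rhoM rho1M k0 sE real1 sa sb p0 p1.
have k1 : k = 1 := exponent_one rhoM rho1M k0 sE real1 sa sb p0 p1.
split=> //.
have [l1 [P1 sa1]] := spec_transfer sE sa; have [m1 [Q1 sb1]] := spec_transfer sE sb.
have E := spec_trace_eq rhoM rho1M k0 sE real1 k1 sa sa1 sb sb1.
have [_ _ [_ PP tP _]] := sa; have [_ _ [_ QQ tQ _]] := sb.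
have [_ _ [_ PP1 tP1 _]] := sa1; have [_ _ [_ QQ1 tQ1 _]] := sb1.
have [H [EP EQ]] := pair_intertwiner PP tP QQ tQ PP1 tP1 QQ1 tQ1 E p0 p1.
exists H; have sa2 := spec_conj_rep H sa1; have sb2 := spec_conj_rep H sb1.
rewrite EP in sa2; rewrite EQ in sb2.
apply: (rigid_normalized rhoM (conj_repM H rho1M) _ _ sa sa2 sb sb2 p0 p1).
- move=> g A A1 gA /mxlift_conj_trace[N gN EN].
  have := sE _ _ _ gA gN; rewrite k1 (powRr1 (le_trans ler01 (stretch_ge1 _))) => ->.
  by case: EN => ->; rewrite ?stretchN.
- move=> g A /mxlift_conj_trace[N gN EN]; have := real1 _ _ gN.
  by case: EN => ->; case: (\tr N) => x y //= ->; rewrite oppr0.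
Qed.

End Rigidity.

(** * Hyperbolic space *)

Section HermitianAlgebra.
Variable F : fieldType.
(* In the identities below, primed variables stand for complex conjugates. *)

(** The Poincare extension is the congruence of Hermitian matrices, with the
   coordinates of the image point written out. *)
Lemma herm_act_alg (a b c d a' b' c' d' z z' t : F) :
  let u := a * z + b in let v := c * z + d in
  let u' := a' * z' + b' in let v' := c' * z' + d' in
  let N := v * v' + c * c' * t ^+ 2 in
  let w := (u * v' + a * c' * t ^+ 2) / N in
  let w' := (u' * v + a' * c * t ^+ 2) / N in
  let s := t / N in
  a * d - b * c = 1 -> a' * d' - b' * c' = 1 -> t != 0 -> N != 0 ->
  mx2 ((w * w' + s ^+ 2) / s) (w / s) (w' / s) s^-1 =
  mx2 a b c d *m mx2 ((z * z' + t ^+ 2) / t) (z / t) (z' / t) t^-1 *m mx2 a' c' b' d'.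
Proof.
move=> u v u' v' N w w' s D D' t0 N0; rewrite !mx2_simp; congr mx2.
- have E : (u * v' + a * c' * t ^+ 2) * (u' * v + a' * c * t ^+ 2) + t ^+ 2 =
      (u * u' + a * a' * t ^+ 2) * N.
    have e1 : u * c - a * v = -1 by apply: (lincomb1 D (-1)); rewrite /u /v; ring.
    have e2 : u' * c' - a' * v' = -1 by apply: (lincomb1 D' (-1)); rewrite /u' /v'; ring.
    apply: (lincomb2 e1 (- (t ^+ 2 * (u' * c' - a' * v'))) e2 (t ^+ 2)); rewrite /N; ring.
  transitivity (((u * v' + a * c' * t ^+ 2) * (u' * v + a' * c * t ^+ 2) + t ^+ 2) / (N * t)).
    by rewrite /w /w' /s; field; rewrite t0 N0.
  rewrite E /u /u'; field; rewrite t0 N0 //.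
- by rewrite /w /s /u /v'; field; rewrite t0 N0.
- by rewrite /w' /s /u' /v; field; rewrite t0 N0.
- by rewrite /s /N /v /v'; field; rewrite t0 N0.
Qed.

Lemma herm_dist_alg (z z' w w' t s : F) : t != 0 -> s != 0 ->
  \tr (mx2 ((z * z' + t ^+ 2) / t) (z / t) (z' / t) t^-1 *m
    invmx (mx2 ((w * w' + s ^+ 2) / s) (w / s) (w' / s) s^-1)) =
  2 + ((z - w) * (z' - w') + (t - s) ^+ 2) / (t * s).
Proof.
move=> t0 s0; rewrite invmx_mx2; last by field.
by rewrite !mx2_simp; field; rewrite t0 s0.
Qed.

Lemma herm_disp_alg (a b c d a' b' c' d' z z' t : F) : t != 0 ->
  \tr (mx2 a b c d *m mx2 ((z * z' + t ^+ 2) / t) (z / t) (z' / t) t^-1 *m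
    mx2 a' c' b' d' *m
    invmx (mx2 ((z * z' + t ^+ 2) / t) (z / t) (z' / t) t^-1)) =
  (a - z * c) * (a' - z' * c') + (d + c * z) * (d' + c' * z') +
  (b + z * (a - d) - z ^+ 2 * c) * (b' + z' * (a' - d') - z' ^+ 2 * c') / t ^+ 2 +
  c * c' * t ^+ 2.
Proof.
move=> t0; rewrite invmx_mx2; last by field.
by rewrite !mx2_simp; field; rewrite t0.
Qed.

Lemma mxtrace_congr (A B X Y : 'M[F]_2) : A \in unitmx -> B \in unitmx ->
  Y \in unitmx -> \tr (A *m X *m B *m invmx (A *m Y *m B)) = \tr (X *m invmx Y).
Proof.
move=> UA UB UY; have -> : invmx (A *m Y *m B) = invmx B *m invmx Y *m invmx A.
  have UK : A *m Y *m B \in unitmx by rewrite !unitmx_mul UA UY UB.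
  have E : (A *m Y *m B) *m (invmx B *m invmx Y *m invmx A) = 1%:M.
    by rewrite !mulmxA !mulmxK // mulmxV.
  by rewrite -[LHS]mulmx1 -E mulKmx.
by rewrite !mulmxA mulmxK // mxtrace_mulC !mulmxA mulVmx // mul1mx.
Qed.

End HermitianAlgebra.

Section HyperbolicSpace.
Variable R : realType.
Local Notation C := R[i].
Implicit Types (A B : 'M[C]_2) (x y : C * R).

(** A point of the upper half space as a positive definite Hermitian matrix of
   determinant one. *)
Definition herm x : 'M[C]_2 :=
  mx2 ((x.1 * conjc x.1 + x.2%:C ^+ 2) / x.2%:C) (x.1 / x.2%:C) (conjc x.1 / x.2%:C) x.2%:C^-1.

(** The conjugate transpose. *)
Definition adj A : 'M[C]_2 :=
  mx2 (conjc (A 0 0)) (conjc (A 1 0)) (conjc (A 0 1)) (conjc (A 1 1)).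

(** [cosh] of the hyperbolic distance. *)
Definition dcosh x y : R :=
  1 + (normsq (x.1 - y.1) + (x.2 - y.2) ^+ 2) / (2 * x.2 * y.2).

Lemma dist3E x y : dist3 x y = arcosh (dcosh x y). Proof. by []. Qed.

Lemma conjcD (z w : C) : conjc (z + w) = conjc z + conjc w.
Proof. exact: (rmorphD (@conjc R)). Qed.

Lemma conjcB (z w : C) : conjc (z - w) = conjc z - conjc w.
Proof. exact: (rmorphB (@conjc R)). Qed.

Lemma conjcM (z w : C) : conjc (z * w) = conjc z * conjc w.
Proof. exact: (rmorphM (@conjc R)). Qed.

Lemma conjcX (z : C) n : conjc (z ^+ n) = conjc z ^+ n.
Proof. exact: (rmorphXn (@conjc R)). Qed.

Lemma conjcN (z : C) : conjc (- z) = - conjc z.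
Proof. exact: (rmorphN (@conjc R)). Qed.

Lemma conjcV (z : C) : conjc (z^-1) = (conjc z)^-1.
Proof. exact: (fmorphV (@conjc R)). Qed.

Lemma realCD (r s : R) : (r + s)%:C = r%:C + s%:C :> C.
Proof. exact: (rmorphD (real_complex R)). Qed.

Lemma realCB (r s : R) : (r - s)%:C = r%:C - s%:C :> C.
Proof. exact: (rmorphB (real_complex R)). Qed.

Lemma realCM (r s : R) : (r * s)%:C = r%:C * s%:C :> C.
Proof. exact: (rmorphM (real_complex R)). Qed.

Lemma realCX (r : R) n : (r ^+ n)%:C = r%:C ^+ n :> C.
Proof. exact: (rmorphXn (real_complex R)). Qed.

Lemma realCV (r : R) : (r^-1)%:C = r%:C^-1 :> C.
Proof. exact: (fmorphV (real_complex R)). Qed.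

Lemma conjc_realC (r : R) : conjc (r%:C) = r%:C :> C.
Proof. by rewrite /= oppr0. Qed.

Definition conj_simp := (conjcD, conjcB, conjcM, conjcV, conjc_realC, @conjcK R).

Lemma realC_eq0 (r : R) : (r%:C == 0 :> C) = (r == 0).
Proof. by rewrite (inj_eq (@complexI R)). Qed.

(** The denominator of the Poincare extension, by which the height is divided. *)
Definition moebius_den A x : R :=
  normsq (A 1 0 * x.1 + A 1 1) + normsq (A 1 0) * x.2 ^+ 2.

Lemma moebius_den_gt0 A x : \det A = 1 -> H3 x -> 0 < moebius_den A x.
Proof.
rewrite /H3 /moebius_den /=; elim/mx2_ind: A => a b c d; rewrite det_mx2 !mx2E => D t0.
have N0 : 0 <= normsq (c * x.1 + d) + normsq c * x.2 ^+ 2.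
  apply: addr_ge0; [exact: normsq_ge0 | apply: mulr_ge0]; [exact: normsq_ge0 | exact: sqr_ge0].
have M0 : 0 <= normsq c * x.2 ^+ 2.
  by apply: mulr_ge0; [exact: normsq_ge0 | exact: sqr_ge0].
rewrite lt_def N0 andbT (paddr_eq0 (normsq_ge0 _) M0) mulf_eq0 !normsq_eq0.
rewrite expf_eq0 /= (gt_eqF t0) orbF; apply/negP => /andP[/eqP E /eqP c0].
move: E D; rewrite c0 mul0r add0r => ->; rewrite !mulr0 subrr => /esym/eqP.
by rewrite oner_eq0.
Qed.

Lemma moebius_denE A x : (moebius_den A x)%:C =
  (A 1 0 * x.1 + A 1 1) * (conjc (A 1 0) * conjc x.1 + conjc (A 1 1)) +
  A 1 0 * conjc (A 1 0) * x.2%:C ^+ 2.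
Proof. by rewrite /moebius_den realCD realCM realCX !normsqE conjcD conjcM.
Qed.

Lemma moebius3E A x : moebius3 A x =
  (((A 0 0 * x.1 + A 0 1) * (conjc (A 1 0) * conjc x.1 + conjc (A 1 1)) +
     A 0 0 * conjc (A 1 0) * x.2%:C ^+ 2) / (moebius_den A x)%:C,
   x.2 / moebius_den A x).
Proof.
case: x => z t; rewrite /moebius3; cbv beta zeta; rewrite realCX conjcD conjcM.
by [].
Qed.

Lemma moebius3_H3 A x : \det A = 1 -> H3 x -> H3 (moebius3 A x).
Proof. by move=> D x0; rewrite moebius3E /H3 /= divr_gt0 // moebius_den_gt0. Qed.

(** The Poincare extension is the action on Hermitian matrices by congruence; this
   makes its composition law and the invariance of the distance evident. *)
Lemma herm_act A x : \det A = 1 -> H3 x ->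
  herm (moebius3 A x) = A *m herm x *m adj A.
Proof.
move=> D x0; have N0 := moebius_den_gt0 D x0.
have D' : conjc (A 0 0) * conjc (A 1 1) - conjc (A 0 1) * conjc (A 1 0) = 1.
  by rewrite -!conjcM -conjcB -det_mx2 -mx2P D /= oppr0.
have DA : A 0 0 * A 1 1 - A 0 1 * A 1 0 = 1 by rewrite -det_mx2 -mx2P.
have t0 : x.2%:C != 0 :> C by rewrite realC_eq0 gt_eqF.
have N1 : (moebius_den A x)%:C != 0 :> C by rewrite realC_eq0 gt_eqF.
rewrite moebius_denE in N1.
have := herm_act_alg DA D' t0 N1; rewrite /= -mx2P -/(adj A) -/(herm x) => <-.
rewrite /herm moebius3E [_.1]/= [_.2]/= -!moebius_denE realCM realCV !conj_simp.
by rewrite -?expr2.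
Qed.

Lemma adjM A B : adj (A *m B) = adj B *m adj A.
Proof.
elim/mx2_ind: A => a b c d; elim/mx2_ind: B => a' b' c' d'.
rewrite /adj mul_mx2 !mx2E mul_mx2 !conj_simp; congr mx2; ring.
Qed.

Lemma adj_det A : \det (adj A) = conjc (\det A).
Proof.
elim/mx2_ind: A => a b c d; rewrite /adj !mx2E !det_mx2 !conj_simp; ring.
Qed.

Lemma herm_det x : H3 x -> \det (herm x) = 1.
Proof.
case: x => z t; rewrite /H3 /herm /= => t0; rewrite det_mx2; field.
by rewrite realC_eq0 gt_eqF.
Qed.

Lemma herm_unit x : H3 x -> herm x \in unitmx.
Proof. by move=> x0; rewrite unitmxE herm_det // unitr1. Qed.

Lemma herm_inj x y : H3 x -> herm x = herm y -> x = y.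
Proof.
case: x y => [z t] [w s]; rewrite /H3 /herm /= => t0 /mx2_inj[_ E _ /invr_inj/complexI Et].
rewrite -Et in E *; congr pair; apply: (mulIf _ E).
by rewrite invr_eq0 realC_eq0 gt_eqF.
Qed.

Lemma moebius3M A B x : \det A = 1 -> \det B = 1 -> H3 x ->
  moebius3 (A *m B) x = moebius3 A (moebius3 B x).
Proof.
move=> DA DB x0; have DAB : \det (A *m B) = 1 by rewrite det_mulmx DA DB mulr1.
apply: herm_inj; first exact: moebius3_H3.
rewrite (herm_act DAB x0) (herm_act DA (moebius3_H3 DB x0)) (herm_act DB x0).
by rewrite adjM !mulmxA.
Qed.

Lemma moebius3_1 x : H3 x -> moebius3 1%:M x = x.
Proof.
move=> x0; apply: herm_inj; first by apply: moebius3_H3; rewrite ?det1.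
rewrite herm_act ?det1 // mul1mx -[RHS]mulmx1; congr (_ *m _).
by rewrite mx2_1 /adj !mx2E /= oppr0.
Qed.

(** The distance is a trace of Hermitian matrices. *)
Lemma dcosh_herm x y : H3 x -> H3 y ->
  (2 * dcosh x y)%:C = \tr (herm x *m invmx (herm y)).
Proof.
case: x y => [z t] [w s]; rewrite /H3 /= => t0 s0.
have t1 : t%:C != 0 :> C by rewrite realC_eq0 gt_eqF.
have s1 : s%:C != 0 :> C by rewrite realC_eq0 gt_eqF.
rewrite (herm_dist_alg _ _ _ _ t1 s1) /dcosh /=.
have -> : 2 * (1 + (normsq (z - w) + (t - s) ^+ 2) / (2 * t * s)) =
    2 + (normsq (z - w) + (t - s) ^+ 2) / (t * s).
  by field; rewrite !gt_eqF.
rewrite realCD realCM realCV realCD realCM realCX realCB normsqE conjcB.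
by rewrite [2%:C](rmorph_nat (real_complex R) 2).
Qed.

Lemma dcoshC x y : dcosh x y = dcosh y x.
Proof.
rewrite /dcosh -opprB normsqN -[x.2 - _]opprB sqrrN.
by rewrite -!mulrA (mulrC x.2).
Qed.

Lemma dcosh_act A x y : \det A = 1 -> H3 x -> H3 y ->
  dcosh (moebius3 A x) (moebius3 A y) = dcosh x y.
Proof.
move=> D x0 y0; apply: (mulfI (_ : 2 != 0)) => //; apply: (@complexI R).
rewrite (dcosh_herm (moebius3_H3 D x0) (moebius3_H3 D y0)) (dcosh_herm x0 y0).
rewrite (herm_act D x0) (herm_act D y0).
have UA : A \in unitmx by rewrite unitmxE D unitr1.
have Ua : adj A \in unitmx by rewrite unitmxE adj_det D /= oppr0 unitr1.
have Uy := herm_unit y0.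
exact (mxtrace_congr (herm x) UA Ua Uy).
Qed.

(** The displacement of [x = (z, t)]: conjugate [A] by the translation by [z] and
   by the homothety of factor [t]. *)
Lemma dcosh_displacement (a b c d z : C) (t : R) : a * d - b * c = 1 -> 0 < t ->
  dcosh (z, t) (moebius3 (mx2 a b c d) (z, t)) =
  (normsq (a - z * c) + normsq (d + c * z) +
   normsq (b + z * (a - d) - z ^+ 2 * c) / t ^+ 2 + normsq c * t ^+ 2) / 2.
Proof.
move=> D t0; have x0 : H3 (z, t) by [].
have DA : \det (mx2 a b c d) = 1 by rewrite det_mx2.
rewrite dcoshC; apply: (mulfI (_ : 2 != 0)) => //; apply: (@complexI R).
rewrite [2 * (_ / 2)]mulrC mulfVK //.
rewrite (dcosh_herm (moebius3_H3 DA x0) x0) (herm_act DA x0).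
have t1 : t%:C != 0 :> C by rewrite realC_eq0 gt_eqF.
have := herm_disp_alg a b c d (conjc a) (conjc b) (conjc c) (conjc d) z (conjc z) t1.
rewrite /adj /herm !mx2E /= => ->.
have E (n1 n2 n3 n4 : R) : (n1 + n2 + n3 / t ^+ 2 + n4 * t ^+ 2)%:C =
    n1%:C + n2%:C + n3%:C / t%:C ^+ 2 + n4%:C * t%:C ^+ 2.
  by rewrite !realCD !realCM realCV !realCX.
by rewrite E !normsqE !(conjcX, conjcB, conjcD, conjcM, conjcN).
Qed.

End HyperbolicSpace.

(** * Translation lengths *)

Section Arcosh.
Variable R : realType.
Implicit Types x y s L : R.

Lemma ler_arcosh x y : 1 <= x -> x <= y -> arcosh x <= arcosh y.
Proof.
move=> x1 xy; have y1 := le_trans x1 xy.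
have p z : 1 <= z -> 0 < z + Num.sqrt (z ^+ 2 - 1).
  by move=> z1; rewrite ltr_wpDr ?sqrtr_ge0 // (lt_le_trans ltr01).
rewrite /arcosh ler_ln ?posrE ?p // lerD // ler_wsqrtr // lerB // ler_sqr // nnegrE.
- by rewrite (le_trans ler01).
- by rewrite (le_trans ler01).
Qed.

Lemma expR_arcoshE L : 1 <= L ->
  1 <= expR (arcosh L) /\ (expR (arcosh L) + (expR (arcosh L))^-1) / 2 = L.
Proof.
move=> L1; have L2 : 0 <= L ^+ 2 - 1 by rewrite subr_ge0 exprn_ege1.
have s0 := sqrtr_ge0 (L ^+ 2 - 1); have s2 := sqr_sqrtr L2.
rewrite /arcosh lnK; last by rewrite posrE ltr_wpDr // (lt_le_trans ltr01).
move: (Num.sqrt _) s0 s2 => s s0 s2; split; first by rewrite (le_trans L1) // lerDl.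
have n0 : L + s != 0 by rewrite gt_eqF // ltr_wpDr // (lt_le_trans ltr01).
have -> : (L + s)^-1 = L - s.
  by apply: (mulfI n0); rewrite divff //; apply: (lincomb1 s2 1); ring.
by field.
Qed.

(** A right neighbourhood of [arcosh L] is the image of one of [L]; this is the
   continuity needed to take the infimum under [arcosh]. *)
Lemma arcosh_increment L e : 1 <= L -> 0 < e ->
  exists2 L', L < L' & arcosh L' = arcosh L + e.
Proof.
move=> L1 e0; have [s1 sL] := expR_arcoshE L1.
have e1 : 1 < expR e by rewrite expR_gt1.
have s'1 : 1 <= expR (arcosh L + e) by rewrite expRD mulr_ege1 // ltW.
exists ((expR (arcosh L + e) + (expR (arcosh L + e))^-1) / 2); last first.
  by apply: expR_inj; rewrite expR_arcosh.
rewrite -{1}sL ltr_pM2r // expRD.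
have s0 : 0 < expR (arcosh L) by rewrite expR_gt0.
move: (expR (arcosh L)) (expR e) s1 s0 e1 => s u s1 s0 u1.
rewrite -subr_gt0.
have -> : s * u + (s * u)^-1 - (s + s^-1) = (u - 1) * (s * s * u - 1) / (s * u).
  by field; rewrite !gt_eqF // (lt_trans ltr01).
rewrite divr_gt0 ?mulr_gt0 ?subr_gt0 // ?(lt_trans ltr01) //.
by rewrite (lt_le_trans u1) // ler_peMl ?(ltW (lt_trans ltr01 u1)) // mulr_ege1.
Qed.

(** An infimum of distances is computed on their hyperbolic cosines. *)
Lemma inf_arcosh (T : Type) (X : set T) (c : T -> R) L : 1 <= L ->
  (forall z, X z -> L <= c z) ->
  (forall e, 0 < e -> exists2 z, X z & c z <= L + e) ->
  inf [set arcosh (c z) | z in X] = arcosh L.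
Proof.
move=> L1 lb ap.
have lbS : lbound [set arcosh (c z) | z in X] (arcosh L).
  by move=> _ [x Xx <-]; apply: ler_arcosh => //; exact: lb.
have hS : has_lbound [set arcosh (c z) | z in X] by exists (arcosh L).
apply/eqP; rewrite eq_le; apply/andP; split; last first.
  have [x Xx _] := ap 1 ltr01.
  by apply: lb_le_inf => //; exists (arcosh (c x)), x.
apply/ler_addgt0Pr => e e0; have [L' LL' <-] := arcosh_increment L1 e0.
have [|x Xx cx] := ap (L' - L); first by rewrite subr_gt0.
apply: (le_trans (ge_inf hS (_ : _ (arcosh (c x))))); first by exists x.
apply: ler_arcosh; first by rewrite (le_trans L1) // lb.
by rewrite (le_trans cx) // addrC subrK.
Qed.

End Arcosh.

Section TranslationLength.
Variable R : realType.
Local Notation C := R[i].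

Lemma cosh_length_ge1 (t : C) : 1 <= cosh_length t.
Proof.
have [l l1 <-] := eigen_ex t.
have l0 : l != 0 by rewrite -normc_gt0 (lt_le_trans ltr01).
rewrite cosh_length_eigen //; have : 1 <= normc l ^+ 2 by rewrite exprn_ege1.
move: (normc l ^+ 2) => x x1; have x0 : 0 < x by rewrite (lt_le_trans ltr01).
rewrite -subr_ge0; have -> : (x + x^-1) / 2 - 1 = (x - 1) ^+ 2 / (2 * x).
  by field; rewrite gt_eqF.
by rewrite divr_ge0 ?sqr_ge0 // mulr_ge0 // ltW.
Qed.

Lemma normcB_sqr (z w : C) : normc (z ^+ 2 + 4 * w) <= normsq z + 4 * normc w.
Proof.
rewrite (le_trans (le_normcD _ _)) // normcX normc_sqr lerD2l normcM.
by rewrite -[4 : C](rmorph_nat (real_complex R)) normc_real ger0_norm.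
Qed.

(** Lower bound for the displacement at the point [(0, t)]: the off-diagonal terms
   are at least [2 |b c|] by the inequality between the arithmetic and geometric
   means, and [(a + d)^2 - 4 = (a - d)^2 + 4 b c]. *)
Lemma cosh_length_le (a b c d : C) (t : R) : a * d - b * c = 1 -> 0 < t ->
  cosh_length (a + d) <=
    (normsq a + normsq d + normsq b / t ^+ 2 + normsq c * t ^+ 2) / 2.
Proof.
move=> D t0; rewrite /cosh_length.
have -> : (a + d) ^+ 2 - 4 = (a - d) ^+ 2 + 4 * (b * c).
  by apply: (lincomb1 D 4); ring.
have := normcB_sqr (a - d) (b * c); rewrite normcM.
have := normsq_parallelogram a d.
have : 2 * (normc b * normc c) <= normsq b / t ^+ 2 + normsq c * t ^+ 2.
  have := sqr_ge0 (normc b / t - normc c * t); rewrite -!normc_sqr.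
  have -> : (normc b / t - normc c * t) ^+ 2 =
     normc b ^+ 2 / t ^+ 2 + normc c ^+ 2 * t ^+ 2 - 2 * (normc b * normc c).
    by field; rewrite gt_eqF.
  by rewrite subr_ge0.
move: (normc b * normc c) (normsq b / _) (normsq c * _) => x y z.
move: (normsq (a + d)) (normsq (a - d)) (normsq a) (normsq d) (normc ((a - d) ^+ 2 + _)).
by move=> n1 n2 n3 n4 n5; lra.
Qed.

Lemma displacement_lb (a b c d : C) (x : C * R) : a * d - b * c = 1 -> H3 x ->
  cosh_length (a + d) <= dcosh x (moebius3 (mx2 a b c d) x).
Proof.
case: x => z t D t0; rewrite dcosh_displacement //.
have -> : a + d = (a - z * c) + (d + c * z) by ring.
by apply: cosh_length_le => //; rewrite -D; ring.
Qed.

(** Up to an arbitrarily small error, the displacement [cosh_length (a + d)] is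
   realized by a point above a fixed point [z] of the Moebius transformation, at
   a small height. *)
Lemma displacement_root (a b c d z : C) e : a * d - b * c = 1 ->
  b + z * (a - d) - z ^+ 2 * c = 0 -> 0 < e ->
  exists2 t : R, 0 < t &
    dcosh (z, t) (moebius3 (mx2 a b c d) (z, t)) <= cosh_length (a + d) + e.
Proof.
move=> D root e0.
have E : cosh_length (a + d) = (normsq (a - z * c) + normsq (d + c * z)) / 2.
  have D' : (a - z * c) * (d + c * z) = 1 by apply: (lincomb2 D 1 root c); ring.
  have -> : a + d = (a - z * c) + (d + c * z) by ring.
  rewrite /cosh_length.
  have -> : ((a - z * c) + (d + c * z)) ^+ 2 - 4 = ((a - z * c) - (d + c * z)) ^+ 2.
    by apply: (lincomb1 D' 4); ring.
  by rewrite normcX normc_sqr normsq_parallelogram; field.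
pose t := Num.sqrt (e / (1 + normsq c)).
have n0 : 0 < 1 + normsq c by rewrite ltr_pwDl // normsq_ge0.
have t0 : 0 < t by rewrite sqrtr_gt0 divr_gt0.
exists t => //; rewrite dcosh_displacement // root E.
have -> : normsq (0 : C) = 0 by apply/eqP; rewrite normsq_eq0.
rewrite mul0r addr0 mulrDl lerD2l.
have : normsq c * t ^+ 2 <= e.
  have -> : t ^+ 2 = e / (1 + normsq c) by rewrite sqr_sqrtr // divr_ge0 // ltW.
  by rewrite mulrA (ler_pdivrMr _ _ n0) mulrC ler_pM2l // lerDr.
by move: (normsq c * _) => x; lra.
Qed.

(** The same when infinity is fixed, at a large height. *)
Lemma displacement_inf_c0 (a b d : C) e : a * d = 1 -> 0 < e ->
  exists2 t : R, 0 < t &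
    dcosh (0, t) (moebius3 (mx2 a b 0 d) (0, t)) <= cosh_length (a + d) + e.
Proof.
move=> D e0; have D0 : a * d - b * 0 = 1 by rewrite mulr0 subr0.
have N0 : normsq (0 : C) = 0 by apply/eqP; rewrite normsq_eq0.
have E : cosh_length (a + d) = (normsq a + normsq d) / 2.
  rewrite /cosh_length; have -> : (a + d) ^+ 2 - 4 = (a - d) ^+ 2.
    by apply: (lincomb1 D 4); ring.
  by rewrite normcX normc_sqr normsq_parallelogram; field.
pose t := Num.sqrt ((1 + normsq b) / e).
have n0 : 0 < 1 + normsq b by rewrite ltr_pwDl // normsq_ge0.
have t0 : 0 < t by rewrite sqrtr_gt0 divr_gt0.
exists t => //; rewrite dcosh_displacement // E.
rewrite !(mul0r, mulr0, expr0n, subr0, addr0) /= N0 mul0r addr0 mulrDl lerD2l.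
have : normsq b / t ^+ 2 <= e.
  have -> : t ^+ 2 = (1 + normsq b) / e by rewrite sqr_sqrtr // divr_ge0 // ltW.
  rewrite invf_div mulrCA ler_piMr ?(ltW e0) //.
  by rewrite (ler_pdivrMr _ _ n0) mul1r lerDr.
by move: (normsq b / _) => x; lra.
Qed.

(** The exponential of the translation length is the stretch factor. The infimum
   need not be attained: the element may be parabolic. *)
Lemma translation_length_H3 (A : SL2 C) :
  expR (translation_length (@H3 R) (@dist3 R) (act3 (\pi_(PSL2 C) A))) = stretch (\tr A).
Proof.
congr expR; have := valP A; rewrite /= => /eqP.
rewrite (_ : translation_length _ _ _ =
    inf [set arcosh (dcosh z (moebius3 A z)) | z in @H3 R]); last first.
  by congr inf; apply: eq_imagel => z _; rewrite act3_pi.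
move: (SL2_mx A); elim/mx2_ind => a b c d; rewrite det_mx2 tr_mx2 => D.
apply: inf_arcosh; first exact: cosh_length_ge1.
  by move=> z z0; exact: displacement_lb.
move=> e e0; have [c0|c0] := eqVneq c 0.
  have D' : a * d = 1 by rewrite -D c0 mulr0 subr0.
  have [t t0 H] := displacement_inf_c0 b D' e0.
  by exists (0, t) => //; rewrite c0.
pose s := sqrtc ((a + d) ^+ 2 - 4); pose z := (a - d + s) / (2 * c).
have s2 : s ^+ 2 = (a + d) ^+ 2 - 4 by rewrite sqr_sqrtc.
have root : b + z * (a - d) - z ^+ 2 * c = 0.
  have -> : b + z * (a - d) - z ^+ 2 * c = (4 * b * c + (a - d) ^+ 2 - s ^+ 2) / (4 * c).
    by rewrite /z; field.
  by rewrite s2 (_ : _ - _ = 0) ?mul0r //; apply: (lincomb1 D (-4)); ring.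
have [t t0 H] := displacement_root D root e0.
by exists (z, t).
Qed.

End TranslationLength.

(** * The hyperbolic plane in hyperbolic space *)

Section HyperbolicPlane.
Variable R : realType.
Local Notation C := R[i].
Implicit Types (z w : C).

(** The upper half plane as the vertical half plane above the real axis. *)
Definition half_plane z : C * R := ((complex.Re z)%:C, complex.Im z).

Lemma half_plane_H3 z : H2 z -> H3 (half_plane z).
Proof. by []. Qed.

Lemma half_plane_inj : injective half_plane.
Proof. by move=> [a b] [c d] [-> ->]. Qed.

Lemma dist2E z w : dist2 z w = arcosh (dcosh (half_plane z) (half_plane w)).
Proof.
by case: z w => [a b] [c d]; rewrite /dist2 /dcosh /half_plane /normsq /= subrr expr0n addr0.
Qed.

Lemma map_mx2 (a b c d : R) :
  map_mx (real_complex R) (mx2 a b c d) = mx2 a%:C b%:C c%:C d%:C.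
Proof. by rewrite [LHS]mx2P !mxE. Qed.

Lemma mxtrace_complexify (A : SL2 R) : \tr (SL2_complexify A) = (\tr A)%:C.
Proof.
rewrite /=; move: (SL2_mx A); elim/mx2_ind => a b c d.
by rewrite map_mx2 !tr_mx2 realCD.
Qed.

(** The vertical half plane is invariant under real matrices, which act on it as
   on the upper half plane. *)
Lemma half_plane_moebius (A : SL2 R) z : H2 z ->
  half_plane (moebius2 A z) = moebius3 (SL2_complexify A) (half_plane z).
Proof.
have : \det (SL2_mx A) = 1 := eqP (valP A).
rewrite /moebius2 -[SL2_mx (SL2_complexify A)]/(map_mx (real_complex R) (SL2_mx A)).
move: (SL2_mx A); elim/mx2_ind => a b c d; rewrite det_mx2 !mx2E => D.
case: z => x y y0; have {}y0 : 0 < y := y0.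
have N0 : (c * x + d) ^+ 2 + c ^+ 2 * y ^+ 2 != 0.
  apply/eqP => /eqP; rewrite (paddr_eq0 (sqr_ge0 _) (mulr_ge0 (sqr_ge0 _) (sqr_ge0 _))).
  rewrite -exprMn !sqrf_eq0 mulf_eq0.
  rewrite (gt_eqF y0) orbF => /andP[/eqP e /eqP c0]; move: e D.
  by rewrite c0 mul0r add0r => ->; rewrite !mulr0 subrr => /esym/eqP; rewrite oner_eq0.
pose N := (c * x + d) ^+ 2 + c ^+ 2 * y ^+ 2.
have -> : (a%:C * (x +i* y) + b%:C) / (c%:C * (x +i* y) + d%:C) =
    (((a * x + b) * (c * x + d) + a * c * y ^+ 2) / N) +i* (y / N).
  have V0 : c%:C * (x +i* y) + d%:C != 0.
    apply: contra_neq N0; simpc => -[e e'].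
    have cy : c * y = 0 by rewrite -e'; ring.
    have cxd : c * x + d = 0 by rewrite -e; ring.
    by rewrite cxd -exprMn cy !expr0n addr0.
  apply: (mulIf V0); rewrite mulfVK //; simpc; apply/eqP; rewrite eq_complex /=.
  apply/andP; split; apply/eqP.
  - by apply: (lincomb1 D (- (c * y ^+ 2) / N)); rewrite /N; field; rewrite exprMn.
  - by apply: (lincomb1 D (y * (c * x + d) / N)); rewrite /N; field; rewrite exprMn.
rewrite moebius3E map_mx2 /moebius_den !mx2E /half_plane [_.1]/= [_.2]/=.
rewrite -!realCM -!realCD !normsq_real -/N !conjc_realC.
by rewrite -!realCX -!realCM -!realCD -!realCM -realCD -realCV -realCM.
Qed.

Lemma translation_length_H2 (A : SL2 R) :
  expR (translation_length (@H2 R) (@dist2 R) (act2 (\pi_(PSL2 R) A))) =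
  stretch (\tr A)%:C.
Proof.
congr expR; have : \det (SL2_mx A) = 1 := eqP (valP A).
rewrite (_ : translation_length _ _ _ = inf [set arcosh (dcosh (half_plane z)
    (moebius3 (SL2_complexify A) (half_plane z))) | z in @H2 R]); last first.
  by congr inf; apply: eq_imagel => z z0; rewrite dist2E act2_pi half_plane_moebius.
rewrite -[SL2_mx (SL2_complexify A)]/(map_mx (real_complex R) (SL2_mx A)).
move: (SL2_mx A); elim/mx2_ind => a b c d; rewrite det_mx2 tr_mx2 map_mx2 => D.
have DC : a%:C * d%:C - b%:C * c%:C = 1 :> C by rewrite -!realCM -realCB D.
rewrite realCD; apply: inf_arcosh; first exact: cosh_length_ge1.
  by move=> z z0; exact: displacement_lb.
move=> e e0; have [c0|c0] := eqVneq c 0.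
  have D' : a%:C * d%:C = 1 :> C by rewrite -DC c0 mulr0 subr0.
  have [t t0 H] := displacement_inf_c0 b%:C D' e0.
  by exists (0 +i* t) => //; rewrite c0.
have [T4|T4] := leP 4 ((a + d) ^+ 2).
  pose s := Num.sqrt ((a + d) ^+ 2 - 4); pose x := (a - d + s) / (2 * c).
  have s2 : s ^+ 2 = (a + d) ^+ 2 - 4 by rewrite sqr_sqrtr // subr_ge0.
  have root : b + x * (a - d) - x ^+ 2 * c = 0.
    have -> : b + x * (a - d) - x ^+ 2 * c = (4 * b * c + (a - d) ^+ 2 - s ^+ 2) / (4 * c).
      by rewrite /x; field.
    by rewrite s2 (_ : _ - _ = 0) ?mul0r //; apply: (lincomb1 D (-4)); ring.
  have rootC : b%:C + x%:C * (a%:C - d%:C) - x%:C ^+ 2 * c%:C = 0.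
    by rewrite -realCX -realCB -!realCM -realCD -realCB root.
  have [t t0 H] := displacement_root DC rootC e0.
  by exists (x +i* t).
(* an elliptic element fixes a point of the half plane *)
pose s := Num.sqrt (4 - (a + d) ^+ 2).
have s0 : 0 < s by rewrite sqrtr_gt0 subr_gt0.
have s2 : s ^+ 2 = 4 - (a + d) ^+ 2 by rewrite sqr_sqrtr // subr_ge0 ltW.
pose x := (a - d) / (2 * c); pose t := s / (2 * `|c|).
have t0 : 0 < t by rewrite divr_gt0 // mulr_gt0 // normr_gt0.
exists (x +i* t) => //; rewrite (dcosh_displacement _ DC t0).
rewrite -!realCX -!realCM -!realCD -!realCB -!realCM -!realCD -!realCB !normsq_real.
apply: (@le_trans _ _ 1); last by rewrite ler_wpDr ?cosh_length_ge1 // ltW.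
have c2 : `|c| ^+ 2 = c ^+ 2 by rewrite real_normK // num_real.
have t2 : t ^+ 2 = (4 - (a + d) ^+ 2) / (4 * c ^+ 2).
  by rewrite -s2 -c2 /t; field; rewrite normr_eq0.
have s2n0 : 4 - (a + d) ^+ 2 != 0 by rewrite -s2 expf_neq0 // gt_eqF.
rewrite t2.
have -> : a - x * c = (a + d) / 2 by rewrite /x; field.
have -> : d + c * x = (a + d) / 2 by rewrite /x; field.
have -> : b + x * (a - d) - x ^+ 2 * c = - (4 - (a + d) ^+ 2) / (4 * c).
  have Eb : b = (a * d - 1) / c by rewrite -D; field.
  by rewrite Eb /x; field.
rewrite le_eqVlt; apply/orP; left; apply/eqP; field.
by rewrite s2n0 c0.
Qed.

End HyperbolicPlane.

(** * Limit sets of elementary groups *)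

Section HorosphereAlgebra.
Variable F : fieldType.

(* Primed variables stand for complex conjugates. *)
Lemma horo_alg (a b c d v w a' b' c' d' v' w' n : F) :
  a * d - b * c = 1 -> a' * d' - b' * c' = 1 -> d * d' + c * c' = n -> n != 0 ->
  (w * ((b * d' + a * c') / n) - v) * (w' * ((b' * d + a' * c) / n) - v') +
    w * w' * n^-1 ^+ 2 =
  n^-1 * ((d * v - b * w) * (d' * v' - b' * w') + (a * w - c * v) * (a' * w' - c' * v')).
Proof.
move=> D D' En n0; apply: (mulfI n0); apply: (mulfI n0).
have -> : n * (n * (n^-1 * ((d * v - b * w) * (d' * v' - b' * w') +
      (a * w - c * v) * (a' * w' - c' * v')))) =
    n * ((d * v - b * w) * (d' * v' - b' * w') + (a * w - c * v) * (a' * w' - c' * v')).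
  by field.
transitivity ((w * (b * d' + a * c') - v * n) * (w' * (b' * d + a' * c) - v' * n) + w * w').
  by field.
apply: (lincomb2 D (- (w * w' * (a' * d' - b' * c'))) D' (- (w * w'))).
by rewrite -En; ring.
Qed.

End HorosphereAlgebra.

Section LimitSet.
Variables (R : realType) (Gamma : groupType).
Local Notation C := R[i].
Implicit Types (rho : Gamma -> PSL2 C) (M K N : 'M[C]_2) (v w z : C).

(** A Jordan curve has at least four points, the images of four points of the
   circle. *)
Lemma jordan_curve_infinite (J : set (sphere3 R)) s1 s2 s3 : jordan_curve J ->
  exists y, [/\ J y, y <> s1, y <> s2 & y <> s3].
Proof.
case=> f [_ inj im]; apply: contrapT => H.
have in3 p : unit_circle p -> f p = s1 \/ f p = s2 \/ f p = s3.
  move=> Cp; have [->|n1] := pselect (f p = s1); first by left.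
  have [->|n2] := pselect (f p = s2); first by right; left.
  have [->|n3] := pselect (f p = s3); first by right; right.
  by case: H; exists (f p); split=> //; rewrite -im; exists p.
have c1 : unit_circle ((1 : R), (0 : R)) by rewrite /unit_circle /= expr1n expr0n addr0.
have c2 : unit_circle ((-1 : R), (0 : R)) by rewrite /unit_circle /= sqrrN expr1n expr0n addr0.
have c3 : unit_circle ((0 : R), (1 : R)) by rewrite /unit_circle /= expr1n expr0n add0r.
have c4 : unit_circle ((0 : R), (-1 : R)) by rewrite /unit_circle /= sqrrN expr1n expr0n add0r.
have ne p q : unit_circle p -> unit_circle q -> p <> q -> f p <> f q.
  by move=> Cp Cq pq fpq; apply: pq; apply: inj; rewrite ?inE.
have n12 := ne _ _ c1 c2; have n13 := ne _ _ c1 c3; have n14 := ne _ _ c1 c4.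
have n23 := ne _ _ c2 c3; have n24 := ne _ _ c2 c4; have n34 := ne _ _ c3 c4.
have d1 : (1 : R) <> 0 by apply/eqP; rewrite oner_eq0.
have d2 : (1 : R) <> -1.
  by move=> E; clear -E; lra.
have d3 : (-1 : R) <> 0 by move/eqP; rewrite oppr_eq0 oner_eq0.
have {}n12 : f (1, 0) <> f (-1, 0) by apply: n12 => -[].
have {}n13 : f (1, 0) <> f (0, 1) by apply: n13 => -[].
have {}n14 : f (1, 0) <> f (0, -1) by apply: n14 => -[].
have {}n23 : f (-1, 0) <> f (0, 1) by apply: n23 => -[].
have {}n24 : f (-1, 0) <> f (0, -1) by apply: n24 => -[].
have {}n34 : f (0, 1) <> f (0, -1) by apply: n34 => -[].
move: (in3 _ c1) (in3 _ c2) (in3 _ c3) (in3 _ c4) n12 n13 n14 n23 n24 n34.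
move: (f (1, 0)) (f (-1, 0)) (f (0, 1)) (f (0, -1)) => a b c d.
by move=> [->|[->|->]] [->|[->|->]] [->|[->|->]] [->|[->|->]].
Qed.

(** The finite points of the limit set belong to every closed set of R^3 that
   contains the orbit. *)
Lemma limit_set_closed rho (D : set (R * R * R)) z : closed D ->
  (forall g, let x := act3 (rho g) (0, 1) in
    D (complex.Re x.1, complex.Im x.1, x.2)) ->
  limit_set rho (to_sphere3 (z, 0)) -> D (complex.Re z, complex.Im z, 0).
Proof.
move=> cD orbD [_ cl]; apply: contrapT => nD.
have nb : nbhs (complex.Re z, complex.Im z, (0 : R)) (~` D).
  by apply: open_nbhs_nbhs; split => //; exact: closed_openC.
have [y [[x [g _ <-] <-] [q nq]]] := cl _ (@one_point_compactification_some_nbhs _ _ _ nb).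
by case=> Eq; apply: nq; rewrite Eq; exact: orbD.
Qed.

(** Removing infinity and two finite points does not exhaust the limit set. *)
Lemma jordan_limit_finite rho z1 z2 : jordan_curve (limit_set rho) ->
  exists z, [/\ limit_set rho (to_sphere3 (z, 0)), z <> z1 & z <> z2].
Proof.
move=> /(@jordan_curve_infinite _ None (to_sphere3 (z1, 0)) (to_sphere3 (z2, 0))).
move=> [y [Ly y0 y1 y2]]; have [[//|[z _ Ez]] _] := Ly.
exists z; split; first by rewrite Ez.
- by move=> E; apply: y1; rewrite -E.
- by move=> E; apply: y2; rewrite -E.
Qed.

(** A quadratic function on R^3 attached to the boundary point [v / w], infinity if
   [w = 0]: its quotient by the height is constant on each horosphere centred at
   that point, and its zeros of height zero are [v / w] only. *)
Definition horo v w (p : R * R * R) : R :=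
  normsq (w * (p.1.1 +i* p.1.2) - v) + normsq w * p.2 ^+ 2.

Lemma continuous_horo v w : continuous (horo v w).
Proof.
have E : horo v w = fun p : R * R * R =>
    (complex.Re w * p.1.1 - complex.Im w * p.1.2 - complex.Re v) *
    (complex.Re w * p.1.1 - complex.Im w * p.1.2 - complex.Re v) +
    (complex.Re w * p.1.2 + complex.Im w * p.1.1 - complex.Im v) *
    (complex.Re w * p.1.2 + complex.Im w * p.1.1 - complex.Im v) +
    normsq w * (p.2 * p.2).
  apply/funext => p; rewrite /horo; case: v w => [v1 v2] [w1 w2] /=.
  by rewrite /normsq /= !expr2.
rewrite E => p.
have cx : (fun q : R * R * R => q.1.1) @ p --> p.1.1.
  by apply: (cvg_comp _ _ cvg_fst); exact: cvg_fst.
have cy : (fun q : R * R * R => q.1.2) @ p --> p.1.2.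
  by apply: (cvg_comp _ _ cvg_fst); exact: cvg_snd.
have ct : (fun q : R * R * R => q.2) @ p --> p.2 by exact: cvg_snd.
by apply: cvgD; [apply: cvgD; apply: cvgM; apply: cvgB; try exact: cvg_cst;
  [apply: cvgB | apply: cvgB | apply: cvgD | apply: cvgD]; apply: cvgMl_tmp
  | apply: cvgMl_tmp; exact: cvgM].
Qed.

(** [hornorm v w M] is the squared norm of [invmx M *m (v, w)]. *)
Definition hornorm v w M : R :=
  normsq (M 1 1 * v - M 0 1 * w) + normsq (M 0 0 * w - M 1 0 * v).

(** The horosphere centred at [v / w] through [M (0, 1)] is the image of the one
   centred at [M^-1 (v / w)] through [(0, 1)]. *)
Lemma horo_orbit M v w : \det M = 1 -> let x := moebius3 M (0, 1) in
  horo v w (complex.Re x.1, complex.Im x.1, x.2) = x.2 * hornorm v w M.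
Proof.
move=> DM x; have x01 : H3 ((0, 1) : C * R) by exact: ltr01.
have N0 := moebius_den_gt0 DM x01; have EN := moebius_denE M (0, 1).
have N1 : (moebius_den M (0, 1))%:C != 0 :> C by rewrite realC_eq0 gt_eqF.
pose n := moebius_den M (0, 1); rewrite -/n in N0 EN N1.
have ReIm (z : C) : complex.Re z +i* complex.Im z = z by case: z.
have cj0 : conjc (0 : C) = 0 by rewrite conjc0.
have E1 : x.1 = (M 0 1 * conjc (M 1 1) + M 0 0 * conjc (M 1 0)) / n%:C.
  by rewrite /x moebius3E -/n; congr (_ / _); rewrite cj0 !mulr0 !add0r expr1n mulr1.
have E2 : x.2 = n^-1 by rewrite /x moebius3E -/n [LHS]/= div1r.
have {}EN : M 1 1 * conjc (M 1 1) + M 1 0 * conjc (M 1 0) = n%:C.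
  by rewrite EN cj0 !mulr0 !add0r expr1n mulr1.
have D' : conjc (M 0 0) * conjc (M 1 1) - conjc (M 0 1) * conjc (M 1 0) = 1.
  by rewrite -!conjcM -conjcB -det_mx2 -mx2P DM /= oppr0.
have DA : M 0 0 * M 1 1 - M 0 1 * M 1 0 = 1 by rewrite -det_mx2 -mx2P.
have H := @horo_alg _ _ _ _ _ v w _ _ _ _ (conjc v) (conjc w) n%:C DA D' EN N1.
clearbody x; rewrite /horo /hornorm /= ReIm E1 E2.
have C1 (r s t : R) : (r + s * t^-1 ^+ 2)%:C = r%:C + s%:C * t%:C^-1 ^+ 2.
  by rewrite realCD realCM realCX realCV.
have C2 (r s t : R) : (t^-1 * (r + s))%:C = t%:C^-1 * (r%:C + s%:C).
  by rewrite realCM realCD realCV.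
apply: (@complexI R); rewrite C1 C2 !normsqE; move: H.
by rewrite !(conjcX, conjcB, conjcD, conjcM, conjcN, conjcV, conjc_realC, @conjcK R).
Qed.

Section Elementary.
Variable rho : Gamma -> PSL2 C.
Hypothesis Jrho : jordan_curve (limit_set rho).

Lemma orbit_moebius g M : mxlift rho g M -> act3 (rho g) (0, 1) = moebius3 M (0, 1).
Proof. by case=> A <- <-; rewrite act3_pi. Qed.

(** No orbit of a group whose limit set is a Jordan curve stays above some
   positive height. *)
Lemma no_bounded_orbit B :
  (forall g M, mxlift rho g M -> normsq (M 1 0) + normsq (M 1 1) <= B) -> False.
Proof.
move=> HB; pose e := (1 + `|B|)^-1.
have e0 : 0 < e by rewrite invr_gt0 ltr_pwDl.
have [z [Lz _ _]] := jordan_limit_finite 0 0 Jrho.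
have cD : closed [set p : R * R * R | e <= p.2].
  by apply: (@closed_comp _ _ _ [set y | e <= y]);
    [move=> p _; exact: cvg_snd | exact: closed_ge].
suff : e <= 0 by rewrite leNgt e0.
apply: (limit_set_closed cD _ Lz) => g x.
have [M gM] := mxlift_ex rho g; have DM := mxlift_det gM.
have -> : x = moebius3 M (0, 1) := orbit_moebius gM.
rewrite moebius3E /= /moebius_den /= mulr0 add0r expr1n mulr1 div1r.
have x01 : H3 ((0, 1) : C * R) by exact: ltr01.
have := moebius_den_gt0 DM x01; rewrite /moebius_den /= mulr0 add0r expr1n mulr1 => n0.
have B0 : 0 < 1 + `|B| by rewrite ltr_pwDl.
have nB : normsq (M 1 1) + normsq (M 1 0) <= 1 + `|B|.
  rewrite addrC; apply: le_trans (HB _ _ gM) _.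
  by rewrite (le_trans (ler_norm B)) // lerDr.
by rewrite /e lef_pV2 ?posrE.
Qed.

(** Under the hypothesis, [horo v w * horo v' w' = k t^2] at the points of height
   [t] of the orbit, which lies on a horosphere if [v / w = v' / w'] and at
   constant distance from the geodesic with these ends otherwise. Its only
   accumulation points in C are then [v / w] and [v' / w']. If [w = 0] the value
   0 of the quotient merely excludes one more point. *)
Lemma no_invariant_horonorm v w v' w' k :
  (v != 0) || (w != 0) -> (v' != 0) || (w' != 0) ->
  (forall g M, mxlift rho g M -> hornorm v w M * hornorm v' w' M = k) -> False.
Proof.
move=> n0 n0' H.
have [z [Lz z1 z2]] := jordan_limit_finite (v / w) (v' / w') Jrho.
pose F (p : R * R * R) := horo v w p * horo v' w' p - k * (p.2 * p.2).
have cF : continuous F.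
  move=> p; apply: cvgB; first by apply: cvgM; exact: continuous_horo.
  by apply: cvgMl_tmp; apply: cvgM; exact: cvg_snd.
have cD : closed [set p | F p = 0].
  by apply: (@closed_comp _ _ F [set y | y = 0]); [move=> p _; exact: cF | exact: closed_eq].
have : F (complex.Re z, complex.Im z, 0) = 0.
  apply: (limit_set_closed cD _ Lz) => g x.
  have [M gM] := mxlift_ex rho g; have -> : x = moebius3 M (0, 1) := orbit_moebius gM.
  have h1 := horo_orbit v w (mxlift_det gM); have h2 := horo_orbit v' w' (mxlift_det gM).
  rewrite /mkset /F; cbv zeta in h1, h2; rewrite h1 h2 {h1 h2}.
  by rewrite [(_, _).2]/= mulrACA (H _ _ gM) mulrC subrr.
have ReIm (y : C) : complex.Re y +i* complex.Im y = y by case: y.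
rewrite /F /horo /= ReIm expr0n !mulr0 !addr0 subr0 => /eqP.
have root (y a b : C) : (a != 0) || (b != 0) -> y <> a / b -> normsq (b * y - a) != 0.
  move=> ab yab; rewrite normsq_eq0 subr_eq0; apply/eqP => E.
  have [b0|b0] := eqVneq b 0; last by apply: yab; rewrite -E mulrC mulKf.
  by move: ab; rewrite -E b0 mul0r !eqxx.
by rewrite mulf_eq0 (negPf (root _ _ _ n0 z1)) (negPf (root _ _ _ n0' z2)).
Qed.

End Elementary.
End LimitSet.

(** * Existence of two loxodromic elements in general position *)

Section ChangeOfBasis.
Variable F : fieldType.

(** The coordinates of the image of [(p, r)], the first column of the base change,
   by the adjugate of [M], which is the inverse if [M] has determinant one. *)
Lemma conj_col0 (p q r s a b c d : F) : p * s - q * r = 1 ->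
  let M := mx2 p q r s *m mx2 a b c d *m invmx (mx2 p q r s) in
  M 1 1 * p - M 0 1 * r = d * p - c * q /\ M 0 0 * r - M 1 0 * p = d * r - c * s.
Proof.
move=> D; rewrite /= (invmx_mx2 D) !mul_mx2 !mx2E; split.
- by apply: (lincomb1 D (d * p - c * q)); ring.
- by apply: (lincomb1 D (d * r - c * s)); ring.
Qed.

(** The same for the second column [(q, s)]. *)
Lemma conj_col1 (p q r s a b c d : F) : p * s - q * r = 1 ->
  let M := mx2 p q r s *m mx2 a b c d *m invmx (mx2 p q r s) in
  M 1 1 * q - M 0 1 * s = a * q - b * p /\ M 0 0 * s - M 1 0 * q = a * s - b * r.
Proof.
move=> D; rewrite /= (invmx_mx2 D) !mul_mx2 !mx2E; split.
- by apply: (lincomb1 D (a * q - b * p)); ring.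
- by apply: (lincomb1 D (a * s - b * r)); ring.
Qed.

Lemma pencil_diag (x y : F) : pencil (mx2 1 0 0 0) x y = mx2 x 0 0 y.
Proof. by rewrite /pencil !mx2_simp; congr mx2; ring. Qed.

Lemma mxtrace_pair_diag (a b c d : F) : a * d - b * c = 1 ->
  \tr (mx2 1 0 0 0 *m (mx2 a b c d *m mx2 1 0 0 0 *m invmx (mx2 a b c d))) = a * d.
Proof. by move=> D; rewrite (invmx_mx2 D) !mul_mx2 tr_mx2; ring. Qed.

(** A projector of rank one is diagonalizable by a matrix of determinant one. *)
Lemma idem_diag (P : 'M[F]_2) : P *m P = P -> \tr P = 1 ->
  exists H : SL2 F, H *m P *m invmx H = mx2 1 0 0 0.
Proof.
suff K_ex : P *m P = P -> \tr P = 1 ->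
    exists2 K : SL2 F, True & P *m K = K *m mx2 1 0 0 0.
  move=> PP tP; have [K _ E] := K_ex PP tP.
  by exists (SL2_inv K); rewrite /= invmxK -mulmxA E mulKmx // SL2_unit.
elim/mx2_ind: P => u s w v; rewrite !mx2_simp => /mx2_inj[E1 E2 E3 E4] tP.
have Ev : v = 1 - u by rewrite -tP; ring.
subst v.
have mk (p q r t : F) : p * t - q * r = 1 ->
    mx2 u s w (1 - u) *m mx2 p q r t = mx2 p q r t *m mx2 1 0 0 0 ->
    exists2 K : SL2 F, True & mx2 u s w (1 - u) *m K = K *m mx2 1 0 0 0.
  by move=> D E; have D1 : \det (mx2 p q r t) == 1; [rewrite det_mx2 D | exists (MkSL2 D1)].
have [s0|s0] := eqVneq s 0; last first.
  apply: (mk s (- 1) (1 - u) (u / s)); first by field.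
  rewrite !mul_mx2; congr mx2; rewrite ?mulr1 ?mulr0 ?addr0.
  - by ring.
  - by field.
  - by apply: (lincomb1 E4 1); ring.
  - by apply: (mulIf s0); apply: (lincomb1 E4 (-1)); field.
rewrite {}s0 in E1 E2 E3 E4 mk *.
have : (u == 0) || (u == 1).
  by rewrite -[u == 1]subr_eq0 -mulf_eq0; apply/eqP; apply: (lincomb1 E1 1); ring.
case/orP => /eqP u01; rewrite {}u01 in E1 E2 E3 E4 mk tP *.
- by apply: (mk 0 (- 1) 1 w); [ring | rewrite !mul_mx2; congr mx2; ring].
- by apply: (mk 1 0 w 1); [ring | rewrite !mul_mx2; congr mx2; ring].
Qed.

(** A parabolic matrix, of double eigenvalue [l = 1] or [l = -1], is conjugate to
   an upper triangular one. *)
Lemma unipotent_triangular (A : 'M[F]_2) l : \det A = 1 -> \tr A = l + l ->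
  l * l = 1 -> A != l%:M ->
  exists2 H : SL2 F, True & exists2 t, t != 0 & H *m A *m invmx H = mx2 l t 0 l.
Proof.
elim/mx2_ind: A => a b c d; rewrite det_mx2 tr_mx2 => D T ll.
have [c0|c0] := eqVneq c 0.
  rewrite {}c0 mulr0 subr0 in D * => Al.
  have al : a = l.
    apply/eqP; rewrite -subr_eq0 -sqrf_eq0; apply/eqP.
    by apply: (lincomb3 T a D (-1) ll 1); ring.
  have dl : d = l by move: T; rewrite al => /addrI.
  exists (SL2_one F) => //; exists b.
    apply: contraNneq Al => ->; rewrite al dl -scalemx1 !mx2_simp.
    by rewrite !mulr0 !mulr1.
  by rewrite /= invmx1 mul1mx mulmx1 al dl.
move=> _; have DH : (0 : F) * (l - d) - c^-1 * - c = 1 by field.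
have D1 : \det (mx2 0 c^-1 (- c) (l - d)) == 1 by rewrite det_mx2 DH.
exists (MkSL2 D1) => //; exists (- c^-1); first by rewrite oppr_eq0 invr_eq0.
rewrite /= (invmx_mx2 DH) !mul_mx2; congr mx2.
- by apply: (mulIf c0); field.
- by field.
- by apply: (lincomb3 T (- (c * l)) D c ll (- c)); ring.
- by apply: (mulIf c0); apply: (lincomb1 T c); field.
Qed.

Lemma comm_upper (a b d l : F) : a * d = 1 -> l != 0 ->
  mx2 l 0 0 l^-1 *m mx2 a b 0 d *m invmx (mx2 l 0 0 l^-1) *m invmx (mx2 a b 0 d) =
  mx2 1 (a * b * (l ^+ 2 - 1)) 0 1.
Proof.
move=> D l0; rewrite invmx_mx2; last by field.
rewrite invmx_mx2; last by rewrite -D; ring.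
rewrite !mul_mx2; congr mx2.
- by apply: (lincomb1 D 1); field.
- by field.
- by field.
- by apply: (lincomb1 D 1); field.
Qed.

Lemma comm_lower (a c d l : F) : a * d = 1 -> l != 0 ->
  mx2 l 0 0 l^-1 *m mx2 a 0 c d *m invmx (mx2 l 0 0 l^-1) *m invmx (mx2 a 0 c d) =
  mx2 1 0 (c * d * (l ^- 2 - 1)) 1.
Proof.
move=> D l0; rewrite invmx_mx2; last by field.
rewrite invmx_mx2; last by rewrite -D; ring.
rewrite !mul_mx2; congr mx2.
- by apply: (lincomb1 D 1); field.
- by field.
- by field.
- by apply: (lincomb1 D 1); field.
Qed.

Lemma conj_upper (x t : F) : x != 0 ->
  invmx (mx2 x 0 0 x^-1) *m mx2 1 t 0 1 *m mx2 x 0 0 x^-1 =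
  1%:M + (t * (x^-1) ^+ 2) *: mx2 0 1 0 0.
Proof.
by move=> x0; rewrite invmx_mx2; [rewrite !mx2_simp; congr mx2; field | field].
Qed.

Lemma conj_lower (x t : F) : x != 0 ->
  mx2 x 0 0 x^-1 *m mx2 1 0 t 1 *m invmx (mx2 x 0 0 x^-1) =
  1%:M + (t * (x^-1) ^+ 2) *: mx2 0 0 1 0.
Proof.
by move=> x0; rewrite invmx_mx2; [rewrite !mx2_simp; congr mx2; field | field].
Qed.

(** The last two hypotheses say that [M *m M] and [M *m D *m M] have a zero entry,
   where [M] has rows [(a, b)] and [(c, d)] and [D] is diagonal with eigenvalues
   [l] and [l^-1]. *)
Lemma monomial_of_zero (a b c d l : F) : a * d - b * c = 1 -> l != 0 -> l ^+ 2 != 1 ->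
  (a * a + b * c) * (a * b + b * d) * (c * a + d * c) * (c * b + d * d) = 0 ->
  ((a * l + b * 0) * a + (a * 0 + b * l^-1) * c) *
  ((a * l + b * 0) * b + (a * 0 + b * l^-1) * d) *
  ((c * l + d * 0) * a + (c * 0 + d * l^-1) * c) *
  ((c * l + d * 0) * b + (c * 0 + d * l^-1) * d) = 0 ->
  (a = 0 -> d = 0) /\ (d = 0 -> a = 0).
Proof.
move=> D l0 l2 Z1 Z2; have li : l^-1 != 0 by rewrite invr_eq0.
have bc x : a * d = 0 -> x * (b * c) = - x.
  by move=> E; apply: (lincomb2 D (- x) E x); ring.
split=> e0; apply/eqP; apply: contraT => n0; exfalso; rewrite e0 ?(mul0r, mulr0) in Z1 Z2 bc D.
- have b0 : b != 0 by apply: contra_eqN D => /eqP ->; rewrite mul0r subrr eq_sym oner_eq0.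
  have c0 : c != 0 by apply: contra_eqN D => /eqP ->; rewrite mulr0 subrr eq_sym oner_eq0.
  have d1 : d ^+ 2 = 1.
    move: Z1; rewrite !add0r => /eqP; rewrite !mulf_eq0 (negPf b0) (negPf c0) (negPf n0) /=.
    by move=> /eqP E; apply: (lincomb2 E 1 (bc 1 erefl) (-1)); ring.
  have dl : d ^+ 2 = l ^+ 2.
    move: Z2; rewrite !(mul0r, mulr0, add0r, addr0) => /eqP.
    rewrite !mulf_eq0 (negPf b0) (negPf c0) (negPf n0) (negPf li) /=.
    by move=> /eqP E; apply: (lincomb2 E l (bc (l ^+ 2) erefl) (-1)); field.
  by move: l2; rewrite -dl d1 eqxx.
- have b0 : b != 0 by apply: contra_eqN D => /eqP ->; rewrite mul0r subrr eq_sym oner_eq0.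
  have c0 : c != 0 by apply: contra_eqN D => /eqP ->; rewrite mulr0 subrr eq_sym oner_eq0.
  have a1 : a ^+ 2 = 1.
    move: Z1; rewrite !addr0 => /eqP; rewrite !mulf_eq0 (negPf b0) (negPf c0) (negPf n0) /=.
    rewrite ?orbF => /eqP E; apply: (lincomb2 E 1 (bc 1 erefl) (-1)); ring.
  have al : a ^+ 2 * l ^+ 2 = 1.
    move: Z2; rewrite !(mul0r, mulr0, add0r, addr0) => /eqP.
    rewrite !mulf_eq0 (negPf b0) (negPf c0) (negPf n0) (negPf l0) /= ?orbF.
    by move=> /eqP E; apply: (lincomb2 E l (bc 1 erefl) (-1)); field.
  have E : l ^+ 2 = 1 by apply: (lincomb2 al 1 a1 (- l ^+ 2)); ring.
  by move: l2; rewrite E eqxx.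
Qed.

End ChangeOfBasis.

Section NonElementary.
Variables (R : realType) (Gamma : groupType).
Local Notation C := R[i].
Implicit Types (l : C) (M N K : 'M[C]_2) (H : SL2 C).
Variable rho : Gamma -> PSL2 C.
Hypothesis rhoM : {morph rho : x y / (x * y)%g}.
Hypothesis rho_discrete : discrete_in_PSL2 (range rho).
Hypothesis Jrho : jordan_curve (limit_set rho).

(** The conjugate of [rho] by [H] is [rho] written in another basis; this returns
   to the original one. *)
Lemma mxlift_unconj H g M : mxlift (conj_rep H rho) g M ->
  mxlift rho g (invmx H *m M *m H).
Proof.
have UH := SL2_unit H; move=> gM; have [N gN] := mxlift_ex rho g.
have E : invmx H *m (H *m N *m invmx H) *m H = N.
  by rewrite !mulmxA mulVmx // mul1mx mulmxKV.
case: (mxlift_sign (mxlift_conj H gN) gM) => ->; first by rewrite E.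
by rewrite mulmxN mulNmx E; exact: mxliftN.
Qed.

Section Basis.
Variable H : SL2 C.
Local Notation rho' := (conj_rep H rho).
Let K := invmx H.

Let KE : exists p q r s : C, K = mx2 p q r s /\ p * s - q * r = 1.
Proof.
exists (K 0 0), (K 0 1), (K 1 0), (K 1 1); split; first exact: mx2P.
by rewrite -det_mx2 -mx2P det_inv (eqP (valP H)) invr1.
Qed.

Let lift_basis g : exists2 M, mxlift rho' g M &
  forall N, mxlift rho g N -> N = K *m M *m invmx K \/ N = - (K *m M *m invmx K).
Proof.
have [M gM] := mxlift_ex rho' g; exists M => // N gN.
by apply: mxlift_sign gN; rewrite invmxK; exact: mxlift_unconj.
Qed.

Lemma hornormN (v w : C) M : hornorm v w (- M) = hornorm v w M.
Proof. by rewrite /hornorm !mxE !mulNr -!opprD !normsqN. Qed.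

Lemma det_col (p q r s : C) : p * s - q * r = 1 -> (p != 0) || (r != 0).
Proof.
move=> D; apply: contraPT D; rewrite negb_or !negbK => /andP[/eqP-> /eqP->].
by rewrite mul0r mulr0 subrr => /esym/eqP; rewrite oner_eq0.
Qed.

(** The group does not preserve the horospheres centred at the image of infinity,
   the first vector of the basis. *)
Lemma no_fixed_point0 :
  (forall g M, mxlift rho' g M -> M 1 0 = 0 /\ normc (M 1 1) = 1) -> False.
Proof.
move=> HM; have [p [q [r [s [EK D]]]]] := KE.
apply: (no_invariant_horonorm Jrho (det_col D) (det_col D)
  (k := (normsq p + normsq r) ^+ 2)) => g N gN.
have [M gM EM] := lift_basis g; have [M10 M11] := HM _ _ gM.
have -> : hornorm p r N = hornorm p r (K *m M *m invmx K).
  by case: (EM _ gN) => ->; rewrite ?hornormN.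
rewrite EK [M]mx2P /hornorm.
have [-> ->] := conj_col0 (M 0 0) (M 0 1) (M 1 0) (M 1 1) D.
by rewrite M10 !mul0r !subr0 !normsqM -[normsq (M 1 1)]normc_sqr M11 expr1n !mul1r.
Qed.

(** The same at the image of 0, the second vector of the basis. *)
Lemma no_fixed_point1 :
  (forall g M, mxlift rho' g M -> M 0 1 = 0 /\ normc (M 0 0) = 1) -> False.
Proof.
move=> HM; have [p [q [r [s [EK D]]]]] := KE.
have D' : s * p - r * q = 1 by rewrite -D; ring.
have := det_col D'; rewrite orbC => D''.
apply: (no_invariant_horonorm Jrho D'' D''
  (k := (normsq q + normsq s) ^+ 2)) => g N gN.
have [M gM EM] := lift_basis g; have [M01 M00] := HM _ _ gM.
have -> : hornorm q s N = hornorm q s (K *m M *m invmx K).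
  by case: (EM _ gN) => ->; rewrite ?hornormN.
rewrite EK [M]mx2P /hornorm.
have [-> ->] := conj_col1 (M 0 0) (M 0 1) (M 1 0) (M 1 1) D.
by rewrite M01 !mul0r !subr0 !normsqM -[normsq (M 0 0)]normc_sqr M00 expr1n !mul1r.
Qed.

(** The geodesic with ends 0 and infinity in the chosen basis is not invariant. *)
Lemma no_invariant_geodesic : (forall g M, mxlift rho' g M ->
    (M 0 1 = 0 /\ M 1 0 = 0) \/ (M 0 0 = 0 /\ M 1 1 = 0)) -> False.
Proof.
move=> HM; have [p [q [r [s [EK D]]]]] := KE.
have D' : s * p - r * q = 1 by rewrite -D; ring.
have := det_col D'; rewrite orbC => D''.
apply: (no_invariant_horonorm Jrho (det_col D) D''
  (k := (normsq p + normsq r) * (normsq q + normsq s))) => g N gN.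
have [M gM EM] := lift_basis g.
have -> : hornorm p r N = hornorm p r (K *m M *m invmx K).
  by case: (EM _ gN) => ->; rewrite ?hornormN.
have -> : hornorm q s N = hornorm q s (K *m M *m invmx K).
  by case: (EM _ gN) => ->; rewrite ?hornormN.
have DM := mxlift_det gM; rewrite [M in \det M]mx2P det_mx2 in DM.
rewrite EK [M]mx2P /hornorm.
have [-> ->] := conj_col0 (M 0 0) (M 0 1) (M 1 0) (M 1 1) D.
have [-> ->] := conj_col1 (M 0 0) (M 0 1) (M 1 0) (M 1 1) D.
case: (HM _ _ gM) => -[e1 e2]; rewrite e1 e2 in DM *.
- have n1 : normsq (M 0 0) * normsq (M 1 1) = 1.
    rewrite -normsqM -[X in normsq X](subr0) -[X in _ - X](mul0r 0) DM.
    by rewrite /normsq /= expr1n expr0n addr0.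
  rewrite !mul0r !subr0 !normsqM -!mulrDr mulrACA (mulrC (normsq (M 1 1))) n1 mul1r //.
- have n1 : normsq (M 0 1) * normsq (M 1 0) = 1.
    rewrite -normsqM -normsqN -[X in normsq X](add0r) -[X in X + _](mul0r 0) DM.
    by rewrite /normsq /= expr1n expr0n addr0.
  rewrite !mul0r !sub0r !normsqN !normsqM -!mulrDr mulrACA (mulrC (normsq (M 1 0))) n1 mul1r.
  by rewrite mulrC.
Qed.

(** Matrices [1 + t x^n N] with [|x| < 1] are distinct from the identity, up to
   sign, and tend to it. *)
Lemma no_unipotent_sequence (x t : C) N (gs : nat -> Gamma) :
  normc x < 1 -> x != 0 -> t != 0 -> N != 0 -> \tr N = 0 ->
  (forall n, mxlift rho' (gs n) (1%:M + (t * x ^+ n) *: N)) -> False.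
Proof.
move=> x1 x0 t0 N0 trN Hg.
have rho1 : rho 1%g = 1%g by apply: (mulgI (rho 1%g)); rewrite -rhoM !mulg1.
have [e e0 He] := rho_discrete (A := 1%g) (ex_intro2 _ _ 1%g I rho1).
have [er er0 Ee] : exists2 r : R, 0 < r & e = r%:C.
  case: e e0 {He} => r s; rewrite ltcE /= => /andP[/eqP -> r0].
  by exists r.
pose Y := invmx H *m N *m H.
pose b := normc (Y 0 0) + normc (Y 0 1) + normc (Y 1 0) + normc (Y 1 1).
have Yb i j : normc (Y i j) <= b.
  have h00 := normc_ge0 (Y 0 0); have h01 := normc_ge0 (Y 0 1).
  have h10 := normc_ge0 (Y 1 0); have h11 := normc_ge0 (Y 1 1).
  have i2 (h : 'I_2) : h = 0 \/ h = 1.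
    by case: h => [[|[|//]] ?]; [left|right]; apply/val_inj.
  rewrite /b; case: (i2 i) => ->; case: (i2 j) => ->; move: h00 h01 h10 h11;
    move: (normc (Y 0 0)) (normc (Y 0 1)) (normc (Y 1 0)) (normc (Y 1 1)) => y1 y2 y3 y4; lra.
have [n small] : exists n, normc t * b * normc x ^+ n < er.
  have := @cvg_geometric R (normc t * b) (normc x).
  rewrite ger0_norm ?normc_ge0 // => /(_ x1)/cvgr0_norm_lt/(_ _ er0)[n _ /(_ n (leqnn n))].
  by move=> /(le_lt_trans (ler_norm _)) h; exists n.
have s0 : t * x ^+ n != 0 by rewrite mulf_neq0 // expf_neq0.
have [B EB mB] := mxlift_unconj (Hg n).
have UH := SL2_unit H.
have BE : SL2_mx B = 1%:M + (t * x ^+ n) *: Y.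
  by rewrite mB mulmxDr mulmxDl mulmx1 mulVmx // -scalemxAr -scalemxAl.
have : \pi_(PSL2 C) B = \pi_(PSL2 C) 1%g.
  apply: He; first by rewrite EB; exists (gs n).
  move=> i j; rewrite BE (_ : SL2_mx (1%g : SL2 C) = 1%:M) // mxE.
  rewrite addrAC subrr add0r mxE normc_normr Ee ltcR normcM.
  rewrite (le_lt_trans _ small) // normcM normcX mulrAC ler_wpM2r ?exprn_ge0 ?normc_ge0 //.
  by rewrite ler_wpM2l ?normc_ge0.
have back c : (t * x ^+ n) *: Y = c%:M -> (t * x ^+ n) *: N = c%:M.
  move=> E; have -> : N = H *m Y *m invmx H by rewrite !mulmxA mulmxV // mul1mx mulmxK.
  by rewrite scalemxAl scalemxAr E scalar_mxC mulmxK.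
move=> /eqP/PSL2_eqP[] /(congr1 (@SL2_mx C)); rewrite BE /= => EY.
- have /back/eqP : (t * x ^+ n) *: Y = 0%:M.
    by rewrite -scalemx1 scale0r; apply: (addrI 1%:M); rewrite EY addr0.
  by rewrite -scalemx1 scale0r scaler_eq0 (negPf s0) (negPf N0).
- have /back : (t * x ^+ n) *: Y = (-2)%:M.
    by apply: (addrI 1%:M); rewrite EY -[(-2)%:M]scalemx1 !mx2_simp; congr mx2; ring.
  move/(congr1 mxtrace); rewrite linearZ /= trN mulr0 mxtrace_scalar.
  by move/esym/eqP; rewrite mulrn_eq0 oppr_eq0 pnatr_eq0.
Qed.

Let rho'M := conj_repM H rhoM.

Section Loxodromic.
Variables (a : Gamma) (l : C).
Hypothesis aD : mxlift rho' a (mx2 l 0 0 l^-1).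
Hypothesis l1 : 1 < normc l.

Let l0 := gt1_neq0 l1.

Let lift_aX n : mxlift rho' (a ^+ n)%g (mx2 (l ^+ n) 0 0 (l ^- n)).
Proof.
have EE : mx2 1 0 0 0 *m mx2 1 0 0 0 = mx2 1 0 0 0 :> 'M[C]_2.
  by rewrite mul_mx2; congr mx2; ring.
have aD' : mxlift rho' a (pencil (mx2 1 0 0 0) l l^-1) by rewrite pencil_diag.
by have := mxliftX rho'M n aD' EE; rewrite pencil_diag.
Qed.

Let powVV n : (l ^- n) ^+ 2 = (l ^- 2) ^+ n.
Proof. by rewrite -!exprVn -!exprM mulnC. Qed.

(** In a discrete group no element fixes exactly one fixed point of a loxodromic
   element [a]: its commutator with [a] would be a nontrivial unipotent matrix,
   whose conjugates by the powers of [a] tend to the identity. *)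
Lemma no_upper g M : mxlift rho' g M -> M 1 0 = 0 -> M 0 1 = 0.
Proof.
move=> gM M10; apply/eqP; apply: contraT => M01; exfalso.
have DM := mxlift_det gM; rewrite [M]mx2P det_mx2 M10 mulr0 subr0 in DM.
have gc := mxliftM rho'M (mxliftJ rho'M aD gM) (mxliftV rho'M gM).
rewrite [M]mx2P M10 (comm_upper _ DM l0) in gc.
have M00 : M 0 0 != 0.
  by apply: contra_eqN DM => /eqP ->; rewrite mul0r eq_sym oner_eq0.
have ll : l ^+ 2 - 1 != 0.
  have := gt1_neqV l1; have -> : l ^+ 2 - 1 = l * (l - l^-1) by field.
  exact: mulf_neq0.
apply: (@no_unipotent_sequence (l ^- 2) (M 0 0 * M 0 1 * (l ^+ 2 - 1)) (mx2 0 1 0 0)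
  (fun n => (a ^+ n)^-1 * (a * g * a^-1 * g^-1) * a ^+ n)%g).
- by rewrite normcV normcX invf_lt1 ?exprn_egt1 // exprn_gt0 // (lt_trans ltr01).
- by rewrite invr_eq0 expf_neq0.
- by rewrite !mulf_neq0.
- by rewrite mx2_0; apply/eqP => /mx2_inj[_ /eqP]; rewrite oner_eq0.
- by rewrite tr_mx2 addr0.
move=> n; have := mxliftM rho'M (mxliftM rho'M (mxliftV rho'M (lift_aX n)) gc) (lift_aX n).
by rewrite (conj_upper _ (expf_neq0 n l0)) powVV.
Qed.

Lemma no_lower g M : mxlift rho' g M -> M 0 1 = 0 -> M 1 0 = 0.
Proof.
move=> gM M01; apply/eqP; apply: contraT => M10; exfalso.
have DM := mxlift_det gM; rewrite [M]mx2P det_mx2 M01 mul0r subr0 in DM.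
have gc := mxliftM rho'M (mxliftJ rho'M aD gM) (mxliftV rho'M gM).
rewrite [M]mx2P M01 (comm_lower _ DM l0) in gc.
have M11 : M 1 1 != 0.
  by apply: contra_eqN DM => /eqP ->; rewrite mulr0 eq_sym oner_eq0.
have ll : l ^- 2 - 1 != 0.
  have := gt1_neqV l1; have -> : l ^- 2 - 1 = - (l^-1 * (l - l^-1)) by field.
  by move=> n0; rewrite oppr_eq0 mulf_neq0 // invr_eq0.
apply: (@no_unipotent_sequence (l ^- 2) (M 1 0 * M 1 1 * (l ^- 2 - 1)) (mx2 0 0 1 0)
  (fun n => a ^+ n * (a * g * a^-1 * g^-1) * (a ^+ n)^-1)%g).
- by rewrite normcV normcX invf_lt1 ?exprn_egt1 // exprn_gt0 // (lt_trans ltr01).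
- by rewrite invr_eq0 expf_neq0.
- by rewrite !mulf_neq0.
- by rewrite mx2_0; apply/eqP => /mx2_inj[_ _ /eqP]; rewrite oner_eq0.
- by rewrite tr_mx2 addr0.
move=> n; have := mxliftJ rho'M (lift_aX n) gc.
by rewrite (conj_lower _ (expf_neq0 n l0)) powVV.
Qed.

(** Some element maps neither fixed point 0 or infinity of [a] to one of them:
   otherwise every element would preserve the pair of fixed points. *)
Lemma loxodromic_full_entries : exists g M, mxlift rho' g M /\
  M 0 0 * M 0 1 * M 1 0 * M 1 1 != 0.
Proof.
apply: contrapT => none.
have zero g M : mxlift rho' g M -> M 0 0 * M 0 1 * M 1 0 * M 1 1 = 0.
  by move=> gM; apply/eqP; apply: contraT => n0; case: none; exists g, M.
have l2 : l ^+ 2 != 1.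
  by apply: contraTneq (exprn_egt1 2 l1) => E; rewrite -normcX E normc1 ltxx.
apply: no_invariant_geodesic => g M gM.
have DM := mxlift_det gM; rewrite [M]mx2P det_mx2 in DM.
have z1 := zero _ _ gM; have z2 := zero _ _ (mxliftM rho'M gM gM).
have z3 := zero _ _ (mxliftM rho'M (mxliftM rho'M gM aD) gM).
have up := no_upper gM; have low := no_lower gM.
rewrite [M in M *m M]mx2P !mul_mx2 !mx2E in z2.
rewrite [M in M *m _ *m M]mx2P !mul_mx2 !mx2E in z3.
have [e00 e11] := monomial_of_zero DM l0 l2 z2 z3.
move/eqP: z1; rewrite !mulf_eq0 => /orP[/orP[/orP[]|]|] /eqP E.
- by right; split=> //; apply: e00.
- by left; split=> //; apply: low.
- by left; split=> //; apply: up.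
- by right; split=> //; apply: e11.
Qed.

End Loxodromic.

Section NoLoxodromic.
Hypothesis stretch1 : forall g M, mxlift rho' g M -> stretch (\tr M) = 1.

Let trace_le2 g M : mxlift rho' g M -> normc (\tr M) <= 2.
Proof. by move=> gM; apply: stretch_eq1; apply: stretch1 gM. Qed.

Let unimodular (g : Gamma) M x y : mxlift rho' g M -> x * y = 1 -> \tr M = x + y ->
  normc x = 1.
Proof.
move=> gM xy tM; have x0 : x != 0.
  by apply: contra_eqN xy => /eqP ->; rewrite mul0r eq_sym oner_eq0.
have Ey : y = x^-1 by rewrite -[LHS]mul1r -(mulVf x0) -mulrA xy mulr1.
by apply: stretch_eq1_eigen => //; rewrite -Ey -tM; apply: stretch1 gM.
Qed.

Let all_upper : (forall g M, mxlift rho' g M -> M 1 0 = 0) -> False.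
Proof.
move=> up; apply: no_fixed_point0 => g M gM; have M10 := up _ _ gM; split=> //.
have DM := mxlift_det gM; rewrite [M]mx2P det_mx2 M10 mulr0 subr0 in DM.
apply: (unimodular (y := M 0 0) gM); first by rewrite mulrC.
by rewrite [M in \tr M]mx2P tr_mx2 addrC.
Qed.

Let all_lower : (forall g M, mxlift rho' g M -> M 0 1 = 0) -> False.
Proof.
move=> low; apply: no_fixed_point1 => g M gM; have M01 := low _ _ gM; split=> //.
have DM := mxlift_det gM; rewrite [M]mx2P det_mx2 M01 mul0r subr0 in DM.
apply: (unimodular (y := M 1 1) gM) => //.
by rewrite [M in \tr M]mx2P tr_mx2.
Qed.

(** If [a] were parabolic, the traces of [a^2n g], which are affine functions of
   [n] and bounded, would be constant, and [g] would fix the fixed point of [a]. *)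
Lemma no_parabolic a (l t : C) : l * l = 1 -> t != 0 ->
  mxlift rho' a (mx2 l t 0 l) -> False.
Proof.
move=> ll t0 aA; pose u := 2 * l * t.
have l0 : l != 0 by apply: contra_eqN ll => /eqP ->; rewrite mul0r eq_sym oner_eq0.
have u0 : u != 0 by rewrite !mulf_neq0 // pnatr_eq0.
have aa : mxlift rho' (a * a)%g (mx2 1 u 0 1).
  have := mxliftM rho'M aA aA; rewrite mul_mx2.
  have -> : mx2 (l * l + t * 0) (l * t + t * l) (0 * l + l * 0) (0 * t + l * l) = mx2 1 u 0 1.
    by rewrite ll /u; congr mx2; ring.
  by [].
have aX n : mxlift rho' ((a * a) ^+ n)%g (mx2 1 (n%:R * u) 0 1).
  elim: n => [|n IH].
    by have := mxlift1 rho'M; rewrite expg0 mul0r mx2_1.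
  have := mxliftM rho'M aa IH; rewrite -expgS mul_mx2.
  have -> : mx2 (1 * 1 + u * 0) (1 * (n%:R * u) + u * 1) (0 * 1 + 1 * 0)
      (0 * (n%:R * u) + 1 * 1) = mx2 1 (n.+1%:R * u) 0 1.
    by rewrite -natr1; congr mx2; ring.
  by [].
apply: all_upper => g M gM; apply/eqP; rewrite -normc_eq0 eq_le normc_ge0 andbT leNgt.
apply/negP => M0.
have y0 : 0 < normc u * normc (M 1 0) by rewrite mulr_gt0 // normc_gt0.
pose n := Num.bound (4 / (normc u * normc (M 1 0))).
have hn : 4 < n%:R * (normc u * normc (M 1 0)).
  by rewrite -ltr_pdivrMr //; apply: archi_boundP; rewrite divr_ge0 // ltW.
have E : n%:R * u * M 1 0 = \tr (mx2 1 (n%:R * u) 0 1 *m M) - \tr M.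
  by rewrite [M in _ *m M]mx2P [M in _ - \tr M]mx2P mul_mx2 !tr_mx2; ring.
have nn : normc (n%:R : C) = n%:R.
  by rewrite -[n%:R in LHS](rmorph_nat (real_complex R)) normc_real ger0_norm.
have := trace_le2 (mxliftM rho'M (aX n) gM); have := trace_le2 gM.
have := le_normcD (\tr (mx2 1 (n%:R * u) 0 1 *m M)) (- \tr M).
have E' : normc (n%:R * u * M 1 0) = n%:R * (normc u * normc (M 1 0)).
  by rewrite -mulrA [LHS]normcM nn [X in _ * X]normcM.
rewrite -E E' normcN; move: hn; move: (_ * (_ * normc (M 1 0))) (normc (\tr M)) => z y.
by move: (normc _) => x; lra.
Qed.

(** The sum of the moduli of the entries, a submultiplicative norm. *)
Definition mxnorm M : R :=
  normc (M 0 0) + normc (M 0 1) + (normc (M 1 0) + normc (M 1 1)).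

Lemma mxnorm_ge0 M : 0 <= mxnorm M.
Proof. by rewrite !addr_ge0 // normc_ge0. Qed.

Lemma mxnormN M : mxnorm (- M) = mxnorm M.
Proof. by rewrite /mxnorm !mxE !normcN. Qed.

Lemma mxnormM M N : mxnorm (M *m N) <= mxnorm M * mxnorm N.
Proof.
have le2 (x y z w : C) : normc (x * y + z * w) <= normc x * normc y + normc z * normc w.
  by rewrite -!normcM le_normcD.
rewrite [M]mx2P [N]mx2P mul_mx2 /mxnorm !mx2E.
move: (M 0 0) (M 0 1) (M 1 0) (M 1 1) (N 0 0) (N 0 1) (N 1 0) (N 1 1) => a b c d x y z w.
apply: (le_trans (lerD (lerD (le2 _ _ _ _) (le2 _ _ _ _)) (lerD (le2 _ _ _ _) (le2 _ _ _ _)))).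
rewrite -subr_ge0.
have -> : (normc a + normc b + (normc c + normc d)) *
  (normc x + normc y + (normc z + normc w)) -
  (normc a * normc x + normc b * normc z + (normc a * normc y + normc b * normc w) +
  (normc c * normc x + normc d * normc z + (normc c * normc y + normc d * normc w))) =
  (normc a + normc c) * (normc z + normc w) + (normc b + normc d) * (normc x + normc y).
  by ring.
by rewrite addr_ge0 // mulr_ge0 // addr_ge0 // normc_ge0.
Qed.

(** A group with bounded entries in some basis has bounded orbits. *)
Lemma no_bounded_group B : (forall g M, mxlift rho' g M -> mxnorm M <= B) -> False.
Proof.
move=> HB; pose c := mxnorm K * B * mxnorm (invmx K).
apply: (no_bounded_orbit Jrho (B := c ^+ 2 + c ^+ 2)) => g N gN.
have [M gM EM] := lift_basis g.
have Nc : mxnorm N <= c.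
  have -> : mxnorm N = mxnorm (K *m M *m invmx K).
    by case: (EM _ gN) => ->; rewrite ?mxnormN.
  apply: (le_trans (mxnormM _ _)); rewrite ler_wpM2r ?mxnorm_ge0 //.
  apply: (le_trans (mxnormM _ _)); rewrite ler_wpM2l ?mxnorm_ge0 //.
  exact: HB gM.
have c0 := le_trans (mxnorm_ge0 N) Nc.
move: Nc; rewrite /mxnorm -!normc_sqr.
have := normc_ge0 (N 0 0); have := normc_ge0 (N 0 1).
have := normc_ge0 (N 1 0); have := normc_ge0 (N 1 1).
move: (normc (N 0 0)) (normc (N 0 1)) (normc (N 1 0)) (normc (N 1 1)) => x y z w.
move=> w0 z0 y0 x0 le.
by rewrite lerD // ler_sqr ?nnegrE //; apply: le_trans le; lra.
Qed.

(** If [a] were elliptic, the traces of [g] and [a g] would bound the diagonal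
   entries of [g]; those of the products of [g] with an element that is not lower
   triangular and with one that is not upper triangular would bound the other
   entries, and the group would be bounded. *)
Lemma no_elliptic a (l : C) : l != 0 -> l - l^-1 != 0 -> normc l = 1 ->
  mxlift rho' a (mx2 l 0 0 l^-1) -> False.
Proof.
move=> l0 ll l1 aD; have li1 : normc l^-1 = 1 by rewrite normcV l1 invr1.
have n0 : 0 < normc (l - l^-1) by rewrite normc_gt0.
pose c0 := 4 / normc (l - l^-1).
have diag g M : mxlift rho' g M -> normc (M 0 0) <= c0 /\ normc (M 1 1) <= c0.
  move=> gM; have t1 := trace_le2 gM; have t2 := trace_le2 (mxliftM rho'M aD gM).
  have bnd (x y : C) : normc y = 1 -> normc (\tr (mx2 l 0 0 l^-1 *m M) - y * \tr M) <= 4.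
    move=> y1; apply: (le_trans (le_normcD _ _)); rewrite normcN normcM y1 mul1r.
    by move: t1 t2; move: (normc _) (normc _) => z w; lra.
  have E0 : (l - l^-1) * M 0 0 = \tr (mx2 l 0 0 l^-1 *m M) - l^-1 * \tr M.
    by rewrite [M in _ *m M]mx2P [M in _ * \tr M]mx2P mul_mx2 !tr_mx2; ring.
  have E1 : (l - l^-1) * M 1 1 = - (\tr (mx2 l 0 0 l^-1 *m M) - l * \tr M).
    by rewrite [M in _ *m M]mx2P [M in _ * \tr M]mx2P mul_mx2 !tr_mx2; ring.
  split; rewrite /c0 ler_pdivlMr // mulrC -normcM.
    by rewrite E0; apply: (bnd 0).
  by rewrite E1 normcN; apply: (bnd 0).
have [B [b [bB B01]]] : exists B b, mxlift rho' b B /\ B 0 1 != 0.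
  apply: contrapT => none; apply: all_lower => g M gM; apply/eqP; apply: contraT => n.
  by case: none; exists M, g.
have [B' [b' [bB' B10]]] : exists B b, mxlift rho' b B /\ B 1 0 != 0.
  apply: contrapT => none; apply: all_upper => g M gM; apply/eqP; apply: contraT => n.
  by case: none; exists M, g.
rewrite -normc_gt0 in B01; rewrite -normc_gt0 in B10.
pose c1 := c0 + c0 * c0.
apply: (no_bounded_group (B := c0 + c1 / normc (B' 1 0) + (c1 / normc (B 0 1) + c0))).
move=> g M gM; have [d0 d1] := diag _ _ gM.
have [f0 _] := diag _ _ bB'; have [_ f1] := diag _ _ bB.
have [h0 _] := diag _ _ (mxliftM rho'M gM bB'); have [_ h1] := diag _ _ (mxliftM rho'M gM bB).
rewrite [M in M *m _]mx2P [B' in _ *m B']mx2P mul_mx2 mx2E in h0.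
rewrite [M in M *m _]mx2P [B in _ *m B]mx2P mul_mx2 mx2E in h1.
have bnd (x y z w : C) : normc (x * y + z * w) <= c0 -> normc x <= c0 -> normc y <= c0 ->
    normc z * normc w <= c1.
  move=> h hx hy; have -> : normc z * normc w = normc ((x * y + z * w) - x * y).
    by rewrite -normcM; congr normc; ring.
  apply: (le_trans (le_normcD _ _)); rewrite normcN normcM lerD // ler_pM // normc_ge0 //.
rewrite /mxnorm !lerD // ler_pdivlMr //; first exact: bnd h0 d0 f0.
by rewrite addrC in h1; exact: bnd h1 d1 f1.
Qed.

End NoLoxodromic.

End Basis.

Lemma spec_unconj H g l P : spec (conj_rep H rho) g l P ->
  spec rho g l (invmx H *m P *m H).
Proof.
case=> A gA S; exists (invmx H *m A *m H); first exact: mxlift_unconj.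
have UI : invmx H \in unitmx by rewrite unitmx_inv SL2_unit.
by have := spec_conj UI S; rewrite invmxK.
Qed.

(** An element different from the identity is loxodromic, parabolic or elliptic,
   and a group with none of the first kind has none of the other two; the trivial
   group has a bounded orbit. *)
Lemma exists_loxodromic : exists g M, mxlift rho g M /\ 1 < stretch (\tr M).
Proof.
apply: contrapT => none.
have stretch1 g M : mxlift rho g M -> stretch (\tr M) = 1.
  move=> gM; apply/eqP; rewrite eq_le stretch_ge1 andbT leNgt; apply/negP => lt.
  by apply: none; exists g, M.
have stretch1' H g M : mxlift (conj_rep H rho) g M -> stretch (\tr M) = 1.
  case/mxlift_conj_trace => N gN; have := stretch1 _ _ gN.
  by move=> E [] ->; rewrite ?stretchN.
have [[g [A [gA A1 AN1]]]|triv] := pselect (exists g A,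
    [/\ mxlift rho g A, A != 1%:M & A != (-1)%:M]); last first.
  apply: (no_bounded_orbit Jrho (B := 1)) => g M gM.
  have [->|n1] := eqVneq M 1%:M.
    by rewrite !mxE /= /normsq /= !expr0n expr1n !addr0 add0r.
  have [->|n2] := eqVneq M (-1)%:M.
    by rewrite !mxE /= mulr0n mulr1n /normsq /= sqrrN oppr0 !expr0n expr1n !addr0 add0r.
  by case: triv; exists g, M.
have [l lge tl] := eigen_ex (\tr A); have DA := mxlift_det gA.
have l0 : l != 0 by rewrite -normc_gt0 (lt_le_trans ltr01).
have l1 : normc l = 1 by apply: stretch_eq1_eigen => //; rewrite tl; exact: stretch1 gA.
have [ll|ll] := eqVneq (l - l^-1) 0.
  have l2 : l * l = 1 by apply: (lincomb1 ll l); field.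
  have El : l^-1 = l by apply: (lincomb1 ll (-1)); ring.
  have Al : A != l%:M.
    have : (l == 1) || (l == -1) by rewrite -sqrf_eq1 expr2 l2.
    by case/orP => /eqP ->.
  rewrite El in tl; have [H _ [t t0 EH]] := unipotent_triangular DA (esym tl) l2 Al.
  have gH := mxlift_conj H gA; rewrite EH in gH.
  exact (no_parabolic (stretch1' H) l2 t0 gH).
have [P [EA PP tP]] := pencil_ex DA l0 ll (esym tl).
have [H EH] := idem_diag PP tP.
have gH := mxlift_conj H gA; rewrite EA pencilJ ?SL2_unit // EH pencil_diag in gH.
exact (no_elliptic (stretch1' H) l0 ll l1 gH).
Qed.

(** A loxodromic element and its conjugate by an element that maps neither of its
   fixed points to one of them. *)
Lemma exists_loxodromic_pair : exists a b l m P Q,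
  [/\ spec rho a l P, spec rho b m Q, \tr (P *m Q) != 0 & \tr (P *m Q) != 1].
Proof.
have [a [A [aA A1]]] := exists_loxodromic.
have [l [P S]] := spec_lift_ex aA A1.
have [A' aA' [EA' PP tP l1]] := S.
have [H EH] := idem_diag PP tP.
have SH := spec_conj_rep H S; rewrite EH in SH.
have aD : mxlift (conj_rep H rho) a (mx2 l 0 0 l^-1).
  by case: SH => D aD [ED _ _ _]; move: aD; rewrite ED pencil_diag.
have [g [M [gM nz]]] := loxodromic_full_entries aD l1.
have SJ := specJ (conj_repM H rhoM) gM SH.
have DM := mxlift_det gM; rewrite [M]mx2P det_mx2 in DM.
have T : \tr (mx2 1 0 0 0 *m (M *m mx2 1 0 0 0 *m invmx M)) = M 0 0 * M 1 1.
  by rewrite [M in LHS]mx2P; exact: mxtrace_pair_diag.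
have S1 := spec_unconj SH; have S2 := spec_unconj SJ.
exists a, (g * a * g^-1)%g, l, l, (invmx H *m mx2 1 0 0 0 *m H),
  (invmx H *m (M *m mx2 1 0 0 0 *m invmx M) *m H).
have UH := SL2_unit H.
have E X Y : \tr ((invmx H *m X *m H) *m (invmx H *m Y *m H)) = \tr (X *m Y).
  by rewrite !mulmxA mulmxK // mxtrace_mulC !mulmxA mulmxV // mul1mx.
rewrite !mulf_eq0 !negb_or -!andbA in nz; have /and4P[n1 n2 n3 n4] := nz.
rewrite E T.
split; [exact S1 | exact S2 | by rewrite mulf_neq0 | ].
apply/eqP => E1; rewrite E1 in DM; move/eqP: (mulf_neq0 n2 n3); apply.
by apply: (lincomb1 DM (-1)); ring.
Qed.

End NonElementary.

(** * Complexification and conclusion *)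

Section Complexification.
Variables (R : realType) (Gamma : groupType).
Local Notation C := R[i].

(** The inclusion of PSL_2(R) in PSL_2(C). *)
Definition PSL2_complexify (p : PSL2 R) : PSL2 C :=
  \pi_(PSL2 C) (SL2_complexify (repr p)).

Lemma PSL2_complexify_pi (A : SL2 R) :
  PSL2_complexify (\pi_(PSL2 R) A) = \pi_(PSL2 C) (SL2_complexify A).
Proof.
apply/eqP/PSL2_eqP; case: (PSL2_repr A) => ->; [by left | right].
by apply: val_inj; rewrite /= map_mxN.
Qed.

Lemma PSL2_complexifyM : {morph PSL2_complexify : p q / (p * q)%g}.
Proof.
move=> p q; rewrite -[p]reprK -[q]reprK pi_PSL2M !PSL2_complexify_pi pi_PSL2M.
by congr (\pi_(PSL2 C) _); apply: val_inj; rewrite /= map_mxM.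
Qed.

Variable rho0 : Gamma -> PSL2 R.
(** The representation [rho0], viewed in PSL_2(C). *)
Definition complex_rep : Gamma -> PSL2 C := fun g => PSL2_complexify (rho0 g).

Lemma complex_rep_lift g M : mxlift complex_rep g M ->
  \tr M = (\tr (repr (rho0 g)))%:C \/ \tr M = - (\tr (repr (rho0 g)))%:C.
Proof.
move=> gM; have gM' : mxlift complex_rep g (SL2_complexify (repr (rho0 g))).
  by exists (SL2_complexify (repr (rho0 g))).
rewrite -mxtrace_complexify; case: (mxlift_sign gM' gM) => ->; [by left | right].
exact: raddfN.
Qed.

Lemma complex_rep_real g M : mxlift complex_rep g M -> complex.Im (\tr M) = 0.
Proof. by case/complex_rep_lift => ->; rewrite //= oppr0. Qed.

Lemma stretch_complex_rep g M : mxlift complex_rep g M ->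
  stretch (\tr M) = expR (length_Sigma rho0 g).
Proof.
move=> gM; have -> : expR (length_Sigma rho0 g) = stretch (\tr (repr (rho0 g)))%:C.
  by rewrite -translation_length_H2 reprK.
by case: (complex_rep_lift gM) => ->; rewrite ?stretchN.
Qed.

Lemma stretch_length_M (rho : Gamma -> PSL2 C) g M : mxlift rho g M ->
  stretch (\tr M) = expR (length_M rho g).
Proof. by case=> A EA <-; rewrite -translation_length_H3 EA. Qed.

Lemma stretch_proportional (rho : Gamma -> PSL2 C) k :
  (forall g, length_M rho g = k * length_Sigma rho0 g) ->
  forall g A A1, mxlift rho g A -> mxlift complex_rep g A1 ->
    stretch (\tr A) = stretch (\tr A1) `^ k.
Proof.
move=> H g A A1 gA gA1; rewrite (stretch_length_M gA) (stretch_complex_rep gA1) H.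
by rewrite /powR gt_eqF ?expR_gt0 // expRK.
Qed.

End Complexification.

Section TotallyGeodesic.
Variables (R : realType) (Gamma : groupType).
Local Notation C := R[i].
Variables (rho0 : Gamma -> PSL2 R) (H : SL2 C).
Variable rho : Gamma -> PSL2 C.
Hypothesis rhoM : {morph rho : x y / (x * y)%g}.
Hypothesis rhoE : rho =1 conj_rep H (complex_rep rho0).

Let DH : \det (SL2_mx H) = 1 := eqP (valP H).

(** The upper half plane carried by [H] to a plane invariant under [rho]. *)
Definition plane_map (z : C) : C * R := moebius3 H (half_plane z).

Lemma plane_map_H3 z : H2 z -> H3 (plane_map z).
Proof. by move=> z0; apply: moebius3_H3 DH _. Qed.

Lemma plane_map_dist z w : H2 z -> H2 w ->
  dist3 (plane_map z) (plane_map w) = dist2 z w.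
Proof. by move=> z0 w0; rewrite dist2E dist3E dcosh_act. Qed.

Lemma moebius3K x : H3 x -> moebius3 (invmx H) (moebius3 H x) = x.
Proof.
move=> x0; rewrite -moebius3M //; last by rewrite det_inv DH invr1.
by rewrite mulVmx ?SL2_unit // moebius3_1.
Qed.

Lemma plane_map_inj z w : H2 z -> H2 w -> plane_map z = plane_map w -> z = w.
Proof.
move=> z0 w0 /(congr1 (moebius3 (invmx H))).
by rewrite !moebius3K //; exact: half_plane_inj.
Qed.

Lemma act2_H2 g z : H2 z -> H2 (act2 (rho0 g) z).
Proof.
move=> z0; have : H3 (half_plane (act2 (rho0 g) z)) by
  rewrite /act2 half_plane_moebius //; apply: moebius3_H3 (half_plane_H3 z0);
  exact: eqP (valP (SL2_complexify (repr (rho0 g)))).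
by [].
Qed.

(** [plane_map] conjugates the action of [rho0] on the upper half plane to that of
   [rho] on its image. *)
Lemma plane_map_equivariant g z : H2 z ->
  plane_map (act2 (rho0 g) z) = act3 (rho g) (plane_map z).
Proof.
move=> z0; pose A := SL2_complexify (repr (rho0 g)).
have DA : \det (SL2_mx A) = 1 := eqP (valP A).
have DI : \det (invmx H) = 1 by rewrite det_inv DH invr1.
have -> : rho g = \pi_(PSL2 C) (H * A * H^-1)%g.
  rewrite rhoE /conj_rep -[complex_rep rho0 g]/(\pi_(PSL2 C) A).
  by rewrite pi_PSL2V (pi_PSL2M H A) (pi_PSL2M (H * A)%g).
have z1 := half_plane_H3 z0.
rewrite act3_pi /plane_map /act2 (half_plane_moebius _ z0) -/A.
rewrite -[SL2_mx (_ * _)%g]/(H *m A *m invmx H).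
rewrite (moebius3M _ DI (moebius3_H3 DH z1)); last by rewrite det_mulmx DH DA mulr1.
by rewrite (moebius3K z1) (moebius3M DH DA z1).
Qed.

Lemma rep_inv g x : H3 x -> act3 (rho g) (act3 (rho g^-1%g) x) = x.
Proof.
have [M gM] := mxlift_ex rho g; have DM := mxlift_det gM.
have [N gN] := mxlift_ex rho g^-1%g; have DN := mxlift_det gN.
have act (h : Gamma) X : mxlift rho h X -> forall y, act3 (rho h) y = moebius3 X y.
  by case=> A <- <- y; rewrite act3_pi.
move=> x0; rewrite (act _ _ gN) (act _ _ gM) -moebius3M //.
rewrite -(act _ _ (mxliftM rhoM gM gN)) mulgV.
by rewrite (act _ _ (mxlift1 rhoM)) moebius3_1.
Qed.

Lemma plane_map_orbit z : H2 z ->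
  plane_map @` Defs.orbit (@act2 R) rho0 z = Defs.orbit (@act3 R) rho (plane_map z).
Proof.
move=> z0; apply/seteqP; split=> [_ [_ [g _ <-] <-]|_ [g _ <-]].
- by exists g => //; rewrite plane_map_equivariant.
- by exists (act2 (rho0 g) z); [exists g | rewrite plane_map_equivariant].
Qed.

Lemma orbit_H2 z : H2 z -> Defs.orbit (@act2 R) rho0 z `<=` @H2 R.
Proof. by move=> z0 _ [g _ <-]; exact: act2_H2. Qed.

Lemma totally_geodesic_quotient : isometric_to_totally_geodesic_surface rho rho0.
Proof.
exists (plane_map @` @H2 R); split.
- split; first by move=> _ [z z0 <-]; exact: plane_map_H3.
  exists plane_map; split; last exact: plane_map_dist.
  split; first by move=> z z0; exists z.
  + by move=> z w; rewrite !inE; exact: plane_map_inj.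
  + by [].
- move=> g; apply/seteqP; split=> [_ [_ [z z0 <-] <-]|_ [z z0 <-]].
    by exists (act2 (rho0 g) z); [exact: act2_H2 | rewrite plane_map_equivariant].
  exists (plane_map (act2 (rho0 g^-1%g) z)).
    by exists (act2 (rho0 g^-1%g) z) => //; exact: act2_H2.
  by rewrite plane_map_equivariant // rep_inv //; exact: plane_map_H3.
- exists (fun U => plane_map @` U); split; last first.
    move=> _ _ [z z0 <-] [w w0 <-]; rewrite /quotient_dist; congr inf.
    apply/seteqP; split=> [_ [_ [u Uu <-] [_ [v Vv <-] <-]]|_ [u Uu [v Vv <-]]].
      exists u => //; exists v => //.
      by rewrite plane_map_dist //; [exact: orbit_H2 Uu | exact: orbit_H2 Vv].
    exists (plane_map u); first by exists u.
    exists (plane_map v); first by exists v.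
    by rewrite plane_map_dist //; [exact: orbit_H2 Uu | exact: orbit_H2 Vv].
  split.
  + move=> _ [z z0 <-]; exists (plane_map z); first by exists z.
    by rewrite plane_map_orbit.
  + move=> U V; rewrite !inE => -[z z0 <-] [w w0 <-] E.
    have sub z1 z2 : H2 z1 -> H2 z2 ->
        plane_map @` Defs.orbit (@act2 R) rho0 z1 =
          plane_map @` Defs.orbit (@act2 R) rho0 z2 ->
        Defs.orbit (@act2 R) rho0 z1 `<=` Defs.orbit (@act2 R) rho0 z2.
      move=> h1 h2 E12 u Uu.
      have : (plane_map @` Defs.orbit (@act2 R) rho0 z2) (plane_map u).
        by rewrite -E12; exists u.
      case=> v Vv Ev; have <- // : v = u.
      by apply: plane_map_inj Ev; [exact: orbit_H2 Vv | exact: orbit_H2 Uu].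
    by apply/seteqP; split; apply: sub.
  + move=> _ [_ [z z0 <-] <-]; exists (Defs.orbit (@act2 R) rho0 z); first by exists z.
    by rewrite plane_map_orbit.
Qed.

End TotallyGeodesic.

Theorem theorem1p5 (R : realType) (g : nat) (S : topologicalType) (x0 : S)
    (Gamma : groupType)
    (rhoQF : {multiplicative Gamma -> PSL2 R[i]})
    (rho0 : {multiplicative Gamma -> PSL2 R}) (k : R) :
  (2 <= g)%N ->
  closed_orientable_surface R g S ->
  is_fundamental_group R x0 Gamma ->
  quasi_fuchsian rhoQF ->
  discrete_faithful rho0 ->
  0 < k ->
  (forall gamma : Gamma, length_M rhoQF gamma = k * length_Sigma rho0 gamma) ->
  [/\ fuchsian rhoQF, k = 1 & isometric_to_totally_geodesic_surface rhoQF rho0].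
Proof.
move=> _ _ _ [[_ disc] jordan] _ k0 lengthE.
have rhoM : {morph rhoQF : x y / (x * y)%g} by move=> x y; rewrite gmulfM.
have rho1M : {morph complex_rep rho0 : x y / (x * y)%g}.
  by move=> x y; rewrite /complex_rep gmulfM PSL2_complexifyM.
have [a [b [l [m [P [Q [sa sb p0 p1]]]]]]] := exists_loxodromic_pair rhoM disc jordan.
have [k1 [H rhoE]] := rigidity rhoM rho1M k0 (stretch_proportional lengthE)
  (@complex_rep_real _ _ rho0) sa sb p0 p1.
split=> //; last exact: totally_geodesic_quotient rhoM rhoE.
exists (\pi_(PSL2 R[i]) H)^-1%g => gamma; exists (repr (rho0 gamma)).
by rewrite invgK rhoE /conj_rep !mulgA mulVg mul1g mulgVK.
Qed.
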